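(* Let $\Omega\subset\mathbb{R}^D$ and suppose that for $\mathcal{H}^d$-almost every $x\in\Omega$ there is $h_0>0$ such that $B(x,h_0)\cap\Omega$ is a smooth embedded $d$-dimensional submanifold of $\mathbb{R}^D$. Let $P$ be a probability measure on $\Omega$ with density $p$ with respect to $\mathcal{H}^d$, where $p$ is twice continuously differentiable (i.e. near each such $x$ it is the restriction of a $C^2$ function on a neighbourhood of $x$ in $\mathbb{R}^D$). Let $X_1,X_2,\ldots$ be i.i.d. with law $P$. Let $K:[0,\infty)\to\mathbb{R}$ vanish outside $[0,1]$, satisfy $\int_{\mathbb{R}^d}K(\|u\|)\,du=1$, and be such that $u\mapsto K(\|u\|)$ is twice continuously differentiable on $\mathbb{R}^D$. If $h_n=c\,n^{-1/(d+4)}$ for a constant $c>0$, then for $\mathcal{H}^d$-almost every $x\in\Omega$, $$\mathrm{MSE}(\hat p_n(x))=\mathbb{E}\big[(\hat p_n(x)-p(x))^2\big]=O\!\left(n^{-4/(d+4)}\right)\quad(n\to\infty).$$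
   Context: $\mathcal{H}^d$ denotes $d$-dimensional Hausdorff measure on $\mathbb{R}^D$; $B(x,r)$ is the open Euclidean ball. Given i.i.d. samples $X_1,\dots,X_n\sim P$, a kernel $K$ and bandwidth $h_n>0$, the estimator is $\hat p_n(x)=\frac{1}{n h_n^d}\sum_{i=1}^n K\!\left(\frac{\|X_i-x\|}{h_n}\right)$. *)

(* Defs.v *)
From HB Require Import structures.
From mathcomp Require Import all_boot all_order all_algebra.
From mathcomp Require Import all_classical all_reals all_analysis.
Set Implicit Arguments. Unset Strict Implicit. Unset Printing Implicit Defensive.
Import Order.TTheory GRing.Theory Num.Theory.
Import numFieldNormedType.Exports.
Local Open Scope classical_set_scope.
Local Open Scope ring_scope.

Definition enorm {R : realType} {D : nat} (v : 'rV[R]_D) : R :=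
  Num.sqrt (\sum_(i < D) v 0 i ^+ 2).

Definition eball {R : realType} {D : nat} (x : 'rV[R]_D) (r : R) : set 'rV[R]_D :=
  [set y | enorm (y - x) < r].

Definition BorelR (R : realType) (D : nat) :=
  g_sigma_algebraType (@open 'rV[R]_D).

Fixpoint unit_ball_vol {R : realType} (d : nat) : R :=
  match d with
  | 0%N => 1
  | 1%N => 2
  | (k.+2)%N => (2 * pi / k.+2%:R) * unit_ball_vol k
  end.

(* Euclidean diameter of a set (in \bar R; -oo for the empty set) *)
Definition ediam {R : realType} {D : nat} (C : set 'rV[R]_D) : \bar R :=
  ereal_sup [set (enorm (x - y))%:E | x in C & y in C].

Definition hterm {R : realType} {D : nat} (d : nat) (C : set 'rV[R]_D) : \bar R :=
  if C == set0 then 0%E else (unit_ball_vol d * (fine (ediam C) / 2) ^+ d)%:E.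

Definition hausdorff_delta {R : realType} {D : nat} (d : nat) (delta : R)
  (A : set 'rV[R]_D) : \bar R :=
  ereal_inf [set (\sum_(0 <= i <oo) hterm d (C i))%E |
     C in [set C : nat -> set 'rV[R]_D |
            A `<=` \bigcup_i C i /\ forall i, (ediam (C i) <= delta%:E)%E]].

Definition hausdorff {R : realType} {D : nat} (d : nat) (A : set 'rV[R]_D) : \bar R :=
  ereal_sup [set hausdorff_delta d delta A | delta in [set delta : R | 0 < delta]].

Definition ebasis {R : realType} {D : nat} (i : 'I_D) : 'rV[R]_D := delta_mx 0 i.

Fixpoint Ck {R : realType} {D : nat} {W : normedModType R} (k : nat)
  (f : 'rV[R]_D -> W) (U : set 'rV[R]_D) : Prop :=
  match k with
  | 0%N => {in U, continuous f}
  | k'.+1 => {in U, continuous f} /\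
      forall i : 'I_D, (forall x, U x -> derivable f x (ebasis i)) /\
                       Ck k' (fun x => 'D_(ebasis i) f x) U
  end.

Definition smooth_on {R : realType} {D : nat} {W : normedModType R}
  (f : 'rV[R]_D -> W) (U : set 'rV[R]_D) : Prop := forall k, Ck k f U.

Definition flat {R : realType} {D : nat} (d : nat) : set 'rV[R]_D :=
  [set v | forall i : 'I_D, (d <= i)%N -> v 0 i = 0].

Definition embedded_submanifold {R : realType} {D : nat} (d : nat)
  (M : set 'rV[R]_D) : Prop :=
  forall y, M y -> exists (U V : set 'rV[R]_D) (phi psi : 'rV[R]_D -> 'rV[R]_D),
    [/\ open U, U y, open V, smooth_on phi U & smooth_on psi V] /\
    (forall z, U z -> V (phi z) /\ psi (phi z) = z) /\
    (forall w, V w -> U (psi w) /\ phi (psi w) = w) /\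
    phi @` (U `&` M) = V `&` flat d.

(* kernel density estimator hat p_n(x) evaluated at the sample X_1..X_n
   (X_{i+1} = X i w) *)
Definition kde {R : realType} {D : nat} {T : Type} (d : nat) (K : R -> R)
  (h : nat -> R) (X : nat -> T -> 'rV[R]_D) (n : nat) (x : 'rV[R]_D) (w : T) : R :=
  (n%:R * h n ^+ d)^-1 * \sum_(i < n) K (enorm (X i w - x) / h n).

Definition mutually_independent {R : realType} {D : nat} {dT : measure_display}
  {T : measurableType dT} (Pr : probability T R) (X : nat -> T -> 'rV[R]_D) : Prop :=
  forall (s : seq nat) (A : nat -> set (BorelR R D)), uniq s ->
    (forall i, measurable (A i)) ->
    Pr (\bigcap_(i in [set` s]) (X i @^-1` A i)) =
    (\prod_(i <- s) Pr (X i @^-1` A i))%E.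

(* Main.v *)
(** The mean square error is at most twice the squared bias plus twice the variance
    of a sum of n i.i.d. terms, so it suffices to show, at a regular point x, that
    E K(|X - x| / h) = p(x) h^d + O(h^(d+2)) and E K(|X - x| / h)^2 = O(h^d); for
    h = c n^(-1/(d+4)) both h^4 and 1 / (n h^d) are of order n^(-4/(d+4)).

    The orthogonal projection pi of Omega onto its tangent space at x is one-to-one
    near x, with |y - x| = |pi y| + O(|pi y|^3), and it distorts distances at
    distance s from x by a factor 1 + O(s^2) only. Hence H^d(pi^-1 A) and the
    Lebesgue measure of A agree up to a factor 1 + O(s^2) for A in the ball of radius
    s, and E K(|X - x| / h) is, up to O(h^(d+2)), the integral over R^d of
    K(|u| / h) (p(x) + <b, u>), whose linear part vanishes by symmetry.

    This needs H^d = Lebesgue measure on R^d for the diameter normalisation of H^d.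
    H^d >= Lebesgue is the isodiametric inequality, deduced from Prekopa-Leindler;
    conversely H^d is a translation invariant multiple c of Lebesgue measure, and
    packing one ball in each cell of a fine cubic grid forces c <= 1. *)

Require Import Defs.
From HB Require Import structures.
From mathcomp Require Import all_boot all_order all_algebra.
From mathcomp Require Import all_classical all_reals all_analysis.
From mathcomp Require Import measurable_realfun.
From mathcomp Require Import ring lra.
Import Order.TTheory GRing.Theory Num.Theory.
Import numFieldNormedType.Exports.
Local Open Scope classical_set_scope.
Local Open Scope ring_scope.

Set Implicit Arguments. Unset Strict Implicit. Unset Printing Implicit Defensive.

(** * Borel sets and Lebesgue measure of R^n *)

(** The squared bias must be O(h^4), so every error that symmetry does not cancel must be of
    relative order h^2, whereas a general chart controls lengths only up to a factor 1 + O(h). The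
    tangent projection gains the missing order: the component of [y - z] normal to the tangent space
    is a Taylor remainder, and Pythagoras adds only its square to the squared tangential length. The
    bound on |y - x| - |pi y| has to be cubic because the Lipschitz kernel divides it by [h].
    Measures are compared through Lipschitz bounds alone: the projection is 1-Lipschitz, its inverse
    is (1 + O(s^2))-Lipschitz, and a map of constant l multiplies H^d by at most l^d. This carries
    H^d on Omega to H^d on R^d, and there the constant must be exactly 1: any other multiple of
    Lebesgue measure would leave a bias that does not tend to 0. Since [unit_ball_vol] is a bare
    recursion, it is tied to Lebesgue measure by computing a Gaussian integral in two ways. *)

Section borel.
Context {R : realType}.

Lemma open_Borel n (A : set 'rV[R]_n) : open A -> measurable (A : set (BorelR R n)).
Proof. by move=> oA; exact: sub_sigma_algebra. Qed.

Lemma closed_Borel n (A : set 'rV[R]_n) : closed A -> measurable (A : set (BorelR R n)).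
Proof.
move=> cA; rewrite -(setCK A); apply: measurableC.
by apply: open_Borel; exact: closed_openC.
Qed.

(** An open set is the countable union of the boxes with rational centre and radius 1/(k+1) that it
    contains, and the preimage of a box is a finite intersection of conditions on coordinates. *)
Lemma measurable_fun_row d (T : measurableType d) n (f : T -> BorelR R n) :
  (forall i, measurable_fun setT (fun t => (f t : 'rV[R]_n) 0 i)) ->
  measurable_fun setT f.
Proof.
move=> fi; apply: (@measurability _ _ _ (BorelR R n) _ _ (@open 'rV[R]_n) erefl).
move=> _ [ O oO <-]; rewrite setTI.
pose box (qk : 'rV[rat]_n * nat) : set 'rV[R]_n :=
  [set y | forall i, `|y 0 i - ratr (qk.1 0 i)| < qk.2.+1%:R^-1].
pose S := [set qk | box qk `<=` O].
have OE : O = \bigcup_(qk in S) box qk.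
  apply/seteqP; split=> [x Ox|x [qk]]; last by move=> /[apply].
  have /nbhs_ballP[e /= e0 xeO] : nbhs x O by exact: open_nbhs_nbhs.
  have [k ke] : exists k : nat, k.+1%:R^-1 < e / 2.
    have e20 : 0 < e / 2 by rewrite divr_gt0.
    exists (Num.trunc (e / 2)^-1).
    rewrite -[ltRHS]invrK ltf_pV2 ?posrE ?invr_gt0//.
    exact: truncnS_gt.
  have k0 : 0 < k.+1%:R^-1 :> R by rewrite invr_gt0.
  set d' := k.+1%:R^-1 in ke k0.
  have /choice[q qP] : forall i, exists r : rat, `|x 0 i - ratr r| < d'.
    move=> i; have : x 0 i - d' < x 0 i + d' by lra.
    move=> /rat_in_itvoo[r]; rewrite in_itv/= => /andP[r1 r2]; exists r.
    by rewrite ltr_norml; apply/andP; split; lra.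
  exists (\row_i q i, k); last by move=> i; rewrite mxE.
  move=> y; rewrite /box/= => yP; apply: xeO.
  split => // i j; rewrite (ord1 i).
  have := yP j; rewrite mxE /= -/d' => yj; have := qP j => xj.
  rewrite /ball/=; rewrite !ltr_norml in yj xj *.
  by move/andP: yj => [? ?]; move/andP: xj => [? ?]; apply/andP; split; lra.
rewrite OE preimage_bigcup bigcup_mkcond; apply: countable_bigcupT_measurable => [|qk].
  exact: countableP.
case: ifPn => // _; rewrite (_ : f @^-1` box qk = \bigcap_(i in [set: 'I_n])
   ((fun t => (f t : 'rV[R]_n) 0 i - ratr (qk.1 0 i)) @^-1` (ball (0:R) qk.2.+1%:R^-1))); last first.
  apply/seteqP; split => t /= h i.
    by move=> _; rewrite /ball/= sub0r normrN; exact: h.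
  by have := h i I; rewrite /ball/= sub0r normrN.
apply: fin_bigcap_measurable => // i _; rewrite -[X in measurable X]setTI.
apply: measurable_funB => //.
by apply: open_measurable; exact: ball_open.
Qed.

Lemma measurable_coord n (i : 'I_n) :
  measurable_fun setT (fun v : BorelR R n => (v : 'rV[R]_n) 0 i).
Proof.
apply: (measurability _ (RGenOpens.measurableE R)).
move=> _ [_ [a [b ->] <-]]; rewrite setTI; apply: open_Borel.
by apply: open_comp; [move=> x _; exact: coord_continuous|exact: interval_open].
Qed.

Lemma continuous_Borel m n (f : 'rV[R]_m -> 'rV[R]_n) : continuous f ->
  measurable_fun setT (f : BorelR R m -> BorelR R n).
Proof.
move=> cf; apply: (@measurability _ _ _ (BorelR R n) _ _ (@open 'rV[R]_n) erefl).
move=> _ [ O oO <-]; rewrite setTI; apply: open_Borel.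
by apply: open_comp => // x _; exact: cf.
Qed.

Lemma continuous_Borel_real m (f : 'rV[R]_m -> R) : continuous f ->
  measurable_fun setT (f : BorelR R m -> R).
Proof.
move=> cf; apply: (measurability _ (RGenOpens.measurableE R)).
move=> _ [_ [a [b ->] <-]]; rewrite setTI; apply: open_Borel.
by apply: open_comp; [move=> x _; exact: cf|exact: interval_open].
Qed.

(** Written exactly like the boxes on which the theorem prescribes [lam], so that uniqueness applies
    to [lam] directly. *)
Definition cbox n (a b : 'rV[R]_n) : set (BorelR R n) :=
  [set u | forall i, a 0 i <= (u : 'rV[R]_n) 0 i <= b 0 i].

Lemma cboxE n (a b : 'rV[R]_n) : cbox a b = \bigcap_(i in [set: 'I_n])
   ((fun v : BorelR R n => (v : 'rV[R]_n) 0 i) @^-1` `[a 0 i, b 0 i]%classic).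
Proof.
apply/seteqP; split => u /= h i; first by move=> _; rewrite /= in_itv/=; exact: h.
by have := h i I; rewrite /= in_itv/=.
Qed.

Lemma measurable_cbox n (a b : 'rV[R]_n) : measurable (cbox a b).
Proof.
rewrite cboxE; apply: fin_bigcap_measurable => // i _.
rewrite -[X in measurable X]setTI; apply: measurable_coord => //.
Qed.

Definition cboxes n : set (set (BorelR R n)) := [set A | exists a b, A = cbox a b].

Lemma cboxI n : setI_closed (@cboxes n).
Proof.
move=> _ _ [a [b ->]] [a' [b' ->]].
exists (\row_i Num.max (a 0 i) (a' 0 i)), (\row_i Num.min (b 0 i) (b' 0 i)).
apply/seteqP; split=> u /=.
  by move=> [h h'] i; rewrite !mxE ge_max le_min; case/andP: (h i) (h' i) => -> -> /andP[-> ->].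
move=> h; split => i; have := h i; rewrite !mxE ge_max le_min.
  by move=> /andP[/andP[-> _] /andP[-> _]].
by move=> /andP[/andP[_ ->] /andP[_ ->]].
Qed.

Lemma cbox_cover n : \bigcup_k (cbox (\row_(i < n) - k%:R) (\row_(i < n) k%:R)) = setT.
Proof.
rewrite -subTset => u _; pose u' := u : 'rV[R]_n.
have [k kP] : exists k : nat, `|u'| <= k%:R.
  by exists (Num.trunc `|u'|).+1; rewrite ltW// truncnS_gt.
exists k => // i; rewrite !mxE -ler_norml (le_trans _ kP)//.
by rewrite [leRHS]/Num.Def.normr/= mx_normrE; exact: (le_bigmax _ _ (0, i)).
Qed.

(** For the inclusion of Borel sets, the identity from the sigma-algebra of boxes is measurable as
    soon as its coordinates are, and a half-space [u 0 i <= a] is a countable union of boxes. *)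
Lemma Borel_cboxes n : @measurable _ (BorelR R n) = <<s @cboxes n >>.
Proof.
apply/seteqP; split; last first.
  apply: smallest_sub; first exact: sigma_algebra_measurable.
  by move=> _ [a [b ->]]; exact: measurable_cbox.
suff : measurable_fun setT (id : g_sigma_algebraType (@cboxes n) -> BorelR R n).
  by move=> mid A mA; have := mid measurableT A mA; rewrite setTI.
apply: measurable_fun_row => i.
apply: (measurability _ (RGenOInfty.measurableE R)).
move=> _ [_ [a ->] <-]; rewrite setTI -[X in measurable X]setCK; apply: measurableC.
have -> : ~` ((fun t : g_sigma_algebraType (@cboxes n) => (id t : 'rV[R]_n) 0 i) @^-1` `]a, +oo[%classic) =
  \bigcup_k (cbox (\row_(i < n) - k%:R) (\row_j if j == i then a else k%:R)).
  apply/seteqP; split=> u /=.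
    rewrite in_itv/= andbT => /negP; rewrite -leNgt => ua.
    have : (\bigcup_k (cbox (\row_(i < n) - k%:R) (\row_(i < n) k%:R))) u by rewrite cbox_cover.
    move=> [k _ uk]; exists k => // j; have := uk j; rewrite !mxE => /andP[-> ujk] /=.
    by case: ifPn => [/eqP ->|].
  move=> [k _ /(_ i)]; rewrite !mxE eqxx => /andP[_ ua].
  by rewrite in_itv/= andbT; apply/negP; rewrite -leNgt.
apply: bigcupT_measurable => k; apply: sub_sigma_algebra.
by eexists; eexists.
Qed.

(** Boxes form a pi-system that exhausts the space. The order condition on [a] and [b] excludes
    empty boxes, for which a product of negative side lengths would be a wrong volume. *)
Lemma Borel_measure_unique n (m1 m2 : {measure set (BorelR R n) -> \bar R}) :
  (forall a b : 'rV[R]_n, (forall i, a 0 i <= b 0 i) -> m1 (cbox a b) = m2 (cbox a b)) ->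
  (forall a b : 'rV[R]_n, (forall i, a 0 i <= b 0 i) -> (m1 (cbox a b) < +oo)%E) ->
  forall A, measurable A -> m1 A = m2 A.
Proof.
move=> m12 m1oo A mA; apply: (measure_unique (@cboxes n)
   (fun k => cbox (\row_(i < n) - k%:R) (\row_(i < n) k%:R))) => //.
- exact: Borel_cboxes.
- exact: cboxI.
- by move=> k; eexists; eexists.
- exact: cbox_cover.
- move=> _ [a [b ->]]; have [ab|/existsNP[i /negP abi]] := pselect (forall i, a 0 i <= b 0 i).
    exact: m12.
  suff -> : cbox a b = set0 by rewrite !measure0.
  rewrite -subset0 => u /(_ i)/andP[] /le_trans /[apply]; exact/negP.
- by move=> k; apply: m1oo => i; rewrite !mxE (le_trans _ (ler0n _ k))// oppr_le0.
Qed.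

End borel.

(** * Euclidean norm and inner product, orthonormal frames *)

Section enorm.
Context {R : realType}.

Definition edot n (u v : 'rV[R]_n) : R := \sum_(i < n) u 0 i * v 0 i.

Section fixed_dim.
Variable n : nat.
Implicit Types (u v w : 'rV[R]_n) (a : R).

Lemma edotC u v : edot u v = edot v u.
Proof. by apply: eq_bigr => i _; rewrite mulrC. Qed.

Lemma edotDl u v w : edot (u + v) w = edot u w + edot v w.
Proof. by rewrite -big_split; apply: eq_bigr => i _; rewrite mxE mulrDl. Qed.

Lemma edotDr u v w : edot u (v + w) = edot u v + edot u w.
Proof. by rewrite edotC edotDl !(edotC u). Qed.

Lemma edotZl a u v : edot (a *: u) v = a * edot u v.
Proof. by rewrite mulr_sumr; apply: eq_bigr => i _; rewrite mxE mulrA. Qed.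

Lemma edotZr a u v : edot u (a *: v) = a * edot u v.
Proof. by rewrite edotC edotZl edotC. Qed.

Lemma edot_ge0 u : 0 <= edot u u.
Proof. by apply: sumr_ge0 => i _; rewrite -expr2 sqr_ge0. Qed.

Lemma enorm_ge0 u : 0 <= enorm u. Proof. exact: sqrtr_ge0. Qed.

Lemma sqr_enorm u : enorm u ^+ 2 = edot u u.
Proof.
rewrite sqr_sqrtr; last by apply: sumr_ge0 => i _; exact: sqr_ge0.
by apply: eq_bigr => i _; rewrite expr2.
Qed.

Lemma enorm_le u a : 0 <= a -> (enorm u <= a) = (edot u u <= a ^+ 2).
Proof. by move=> a0; rewrite -sqr_enorm ler_sqr// nnegrE enorm_ge0. Qed.

Lemma enorm0 : enorm (0 : 'rV[R]_n) = 0.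
Proof. by rewrite /enorm big1 ?sqrtr0// => i _; rewrite mxE expr0n. Qed.

Lemma enorm0_eq0 u : enorm u = 0 -> u = 0.
Proof.
move=> u0; have : edot u u == 0 by rewrite -sqr_enorm u0 expr0n.
rewrite psumr_eq0 => [/allP u0'|i _]; last by rewrite -expr2 sqr_ge0.
apply/rowP => i; have := u0' i; rewrite mem_index_enum mulf_eq0 orbb mxE.
by move=> /(_ isT)/eqP.
Qed.

Lemma enormZ a u : enorm (a *: u) = `|a| * enorm u.
Proof.
apply/eqP; rewrite -(@eqrXn2 _ 2%N) ?mulr_ge0 ?enorm_ge0//; apply/eqP.
by rewrite exprMn !sqr_enorm edotZl edotZr mulrA real_normK ?num_real// expr2.
Qed.

Lemma enormN u : enorm (- u) = enorm u.
Proof. by rewrite -scaleN1r enormZ normrN1 mul1r. Qed.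

Lemma enorm_distC u v : enorm (u - v) = enorm (v - u).
Proof. by rewrite -enormN opprB. Qed.

(** Cauchy-Schwarz, from expanding the squared norm of [enorm v *: u - enorm u *: v]. *)
Lemma edot_le u v : edot u v <= enorm u * enorm v.
Proof.
have [u0|u0] := eqVneq (enorm u) 0.
  by rewrite (enorm0_eq0 u0) enorm0 mul0r /edot big1// => i _; rewrite mxE mul0r.
have [v0|v0] := eqVneq (enorm v) 0.
  by rewrite (enorm0_eq0 v0) enorm0 mulr0 /edot big1// => i _; rewrite mxE mulr0.
have ugt0 : 0 < enorm u by rewrite lt_neqAle eq_sym u0 enorm_ge0.
have vgt0 : 0 < enorm v by rewrite lt_neqAle eq_sym v0 enorm_ge0.
have := edot_ge0 (enorm v *: u - enorm u *: v).
rewrite -scaleNr !(edotDl, edotDr, edotZl, edotZr) (edotC v u) -!sqr_enorm.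
move: (edot u v) (enorm u) (enorm v) ugt0 vgt0 => d a b a0 b0 {u0 v0} h.
have ab : 0 < a * b by exact: mulr_gt0.
rewrite -(ler_pM2l ab); nra.
Qed.

Lemma ler_enormD u v : enorm (u + v) <= enorm u + enorm v.
Proof.
rewrite enorm_le ?addr_ge0 ?enorm_ge0// !(edotDl, edotDr) (edotC v u) -!sqr_enorm.
have := edot_le u v; nra.
Qed.

Lemma ler_enorm_dist u v : `|enorm u - enorm v| <= enorm (u - v).
Proof.
rewrite ler_norml; apply/andP; split.
  by rewrite lerBrDl; have := ler_enormD u (v - u); rewrite addrC subrK enorm_distC; lra.
by rewrite lerBlDr; have := ler_enormD (u - v) v; rewrite subrK.
Qed.

Lemma coord_le_enorm u i : `|u 0 i| <= enorm u.
Proof.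
rewrite -ler_sqr ?nnegrE ?enorm_ge0// sqr_enorm /edot (bigD1 i)//= real_normK ?num_real//.
by rewrite -expr2 lerDl sumr_ge0// => j _; rewrite -expr2 sqr_ge0.
Qed.

Lemma enorm_le_sum u : enorm u <= \sum_(i < n) `|u 0 i|.
Proof.
rewrite enorm_le ?sumr_ge0// expr2 mulr_suml ler_sum// => i _.
rewrite mulr_sumr (bigD1 i)//= -normrM (le_trans (ler_norm _))// lerDl.
by rewrite sumr_ge0// => j _; rewrite mulr_ge0.
Qed.

Lemma coord_le_norm u i : `|u 0 i| <= `|u|.
Proof. by rewrite [leRHS]/Num.Def.normr/= mx_normrE; exact: (le_bigmax _ _ (0, i)). Qed.

(** The norm carried by row vectors, which defines their topology, is the sup norm. This bound and
    [enorm_le_norm] pass between it and the Euclidean norm, at the price of a factor [n]. *)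
Lemma norm_le_enorm u : `|u| <= enorm u.
Proof.
rewrite [leLHS]/Num.Def.normr/= mx_normrE; apply/bigmax_leP; split.
  exact: enorm_ge0.
by move=> [j i] _ /=; rewrite (ord1 j) coord_le_enorm.
Qed.

Lemma enorm_le_norm u : enorm u <= n%:R * `|u|.
Proof.
rewrite (le_trans (enorm_le_sum u))// (@le_trans _ _ (\sum_(i < n) `|u|))//.
  by rewrite ler_sum// => i _; exact: coord_le_norm.
by rewrite sumr_const card_ord mulr_natl.
Qed.

Lemma enorm_continuous : continuous (@enorm R n).
Proof.
move=> u; apply/(@cvgrPdist_lt _ _ _ (nbhs u)) => e e0.
apply/nbhs_ballP; exists (n.+1%:R^-1 * e) => /=; first by rewrite mulr_gt0// invr_gt0.
move=> v; rewrite -ball_normE/= => uv.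
rewrite (le_lt_trans (ler_enorm_dist _ _))// (le_lt_trans (enorm_le_norm _))//.
apply: (@le_lt_trans _ _ (n.+1%:R * `|u - v|)); last by rewrite -ltr_pdivlMl ?ltr0n.
by rewrite ler_wpM2r// ler_nat.
Qed.

Lemma eball_open (x : 'rV[R]_n) r : open (eball x r).
Proof.
rewrite (_ : eball x r = (fun y => enorm (y - x)) @^-1` [set t | t < r])//.
apply: open_comp; last exact: open_lt.
move=> y _; apply: (@continuous_comp 'rV[R]_n 'rV[R]_n R^o (fun y => y - x) (@enorm R n) y).
  by apply: continuousB; [exact: cvg_id|exact: cst_continuous].
exact: enorm_continuous.
Qed.

Lemma open_eball (U : set 'rV[R]_n) x : open U -> U x ->
  exists2 r, 0 < r & eball x r `<=` U.
Proof.
move=> oU Ux; have /nbhs_ballP[e /= e0 xeU] : nbhs x U by exact: open_nbhs_nbhs.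
exists e => // y; rewrite /eball/= => yx; apply: xeU.
by rewrite -ball_normE/= distrC (le_lt_trans (norm_le_enorm _)).
Qed.

End fixed_dim.

Lemma mulmx_edot m n (u : 'rV[R]_m) (v : 'rV[R]_n) (A : 'M[R]_(m, n)) :
  edot (u *m A) v = edot u (v *m A^T).
Proof.
rewrite /edot; under eq_bigr do rewrite mxE mulr_suml.
under [RHS]eq_bigr do rewrite mxE mulr_sumr.
rewrite exchange_big/=; apply: eq_bigr => i _; apply: eq_bigr => j _.
by rewrite mxE; ring.
Qed.

Section isometry.
Variables (m n : nat) (L : 'M[R]_(m, n)).
Hypothesis LL : L *m L^T = 1%:M.

Lemma enorm_isometry (u : 'rV[R]_m) : enorm (u *m L) = enorm u.
Proof.
apply/eqP; rewrite -(@eqrXn2 _ 2%N) ?enorm_ge0//; apply/eqP.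
by rewrite !sqr_enorm mulmx_edot -mulmxA LL mulmx1.
Qed.

(** The rows of [L] are orthonormal, so [y *m L^T] holds the coordinates of the orthogonal
    projection [y *m L^T *m L] onto their span, and the remainder is orthogonal to that span. *)
Lemma enorm_pythagoras (y : 'rV[R]_n) :
  enorm y ^+ 2 = enorm (y *m L^T) ^+ 2 + enorm (y - y *m L^T *m L) ^+ 2.
Proof.
rewrite -(enorm_isometry (y *m L^T)) !sqr_enorm; set q := y *m L^T *m L.
have -> : edot y y = edot (q + (y - q)) (q + (y - q)) by rewrite addrC subrK.
have qy : edot q (y - q) = 0.
  rewrite /q mulmx_edot mulmxBl -!mulmxA LL mulmx1 subrr /edot big1// => i _.
  by rewrite [X in _ * X]mxE mulr0.
by rewrite (edotDl q) !(edotDr _ q) (edotC (y - q) q) qy add0r addr0.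
Qed.

Lemma enorm_proj (y : 'rV[R]_n) : enorm (y *m L^T) <= enorm y.
Proof.
rewrite -ler_sqr ?nnegrE ?enorm_ge0// (enorm_pythagoras y) lerDl sqr_ge0//.
Qed.

End isometry.
End enorm.

(** * Lebesgue measure on R^n as an iterated product *)

Section leb.
Context {R : realType}.
Local Notation mR := (measurableTypeR R).
Local Notation lebesgue := (@lebesgue_measure R).

Definition rv_cons n (p : R * 'rV[R]_n) : 'rV[R]_n.+1 :=
  \row_i (if unlift ord0 i is Some j then p.2 0 j else p.1).

Lemma rv_cons0 n (p : R * 'rV[R]_n) : rv_cons p 0 ord0 = p.1.
Proof. by rewrite mxE unlift_none. Qed.

Lemma rv_consS n (p : R * 'rV[R]_n) j : rv_cons p 0 (lift ord0 j) = p.2 0 j.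
Proof. by rewrite mxE liftK. Qed.

Lemma measurable_rv_cons n :
  measurable_fun setT (@rv_cons n : (mR * BorelR R n)%type -> BorelR R n.+1).
Proof.
apply: measurable_fun_row => i; case: (unliftP ord0 i) => [j|] ->.
  under eq_fun do rewrite rv_consS.
  exact: (measurableT_comp (measurable_coord j) measurable_snd).
under eq_fun do rewrite rv_cons0.
exact: measurable_fst.
Qed.

End leb.

Section pushm.
Context d1 d2 (T1 : measurableType d1) (T2 : measurableType d2) (R : realType).
Variables (m : {measure set T1 -> \bar R}) (f : T1 -> T2) (mf : measurable_fun setT f).

(* An alias of [pushforward] that records the measurability of [f], so that it is
   canonically a measure. *)
Definition pushm of measurable_fun setT f : set T2 -> \bar R := pushforward m f.

HB.instance Definition _ := Measure.copy (pushm mf)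
  (measure_function_pushforward__canonical__measure_function_Measure m mf).

End pushm.


Section leb_def.
Context {R : realType}.
Local Notation mR := (measurableTypeR R).
Local Notation lebesgue := (@lebesgue_measure R).

Definition rv_split n (v : 'rV[R]_n.+1) : R * 'rV[R]_n :=
  (v 0 ord0, \row_j v 0 (lift ord0 j)).

Lemma rv_consK n : cancel (@rv_cons R n) (@rv_split n).
Proof.
by move=> [x v]; rewrite /rv_split rv_cons0; congr pair; apply/rowP => j; rewrite mxE rv_consS.
Qed.

Lemma measurable_rv_split n :
  measurable_fun setT (@rv_split n : BorelR R n.+1 -> (mR * BorelR R n)%type).
Proof.
apply/measurable_fun_pairP; split; first exact: measurable_coord.
by apply: measurable_fun_row => i /=; under eq_fun do rewrite mxE; exact: measurable_coord.
Qed.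

Section lebS.
Variables (n : nat) (m : {sigma_finite_measure set (BorelR R n) -> \bar R}).

Definition lebS : set (BorelR R n.+1) -> \bar R :=
  pushm (lebesgue \x m)%E (@measurable_rv_cons R n).

HB.instance Definition _ := Measure.on lebS.

(** This lets the construction be iterated: the second factor of a product measure has to be
    sigma-finite. *)
Lemma lebS_sigma_finite : sigma_finite setT lebS.
Proof.
have /sigma_finiteP[F [TF ndF Foo]] := sigma_finiteT lebesgue.
have /sigma_finiteP[G [TG ndG Goo]] := sigma_finiteT m.
exists (fun k => @rv_split n @^-1` (F k `*` G k)).
  apply/seteqP; split => // v _.
  have [i _ Fi] : (\bigcup_k F k) (rv_split v).1 by rewrite -TF.
  have [j _ Gj] : (\bigcup_k G k) (rv_split v).2 by rewrite -TG.
  exists (maxn i j) => //; split.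
    by move: Fi; exact/subsetPset/ndF/leq_maxl.
  by move: Gj; exact/subsetPset/ndG/leq_maxr.
move=> k; have [mF Fk] := Foo k; have [mG Gk] := Goo k; split.
  by rewrite -[X in measurable X]setTI; apply: measurable_rv_split => //; exact: measurableX.
rewrite /lebS /pushm /pushforward -comp_preimage (_ : _ \o _ = id) ?preimage_id; last first.
  by apply/funext => x; exact: rv_consK.
by rewrite /= product_measure1E// lte_mul_pinfty// ge0_fin_numE.
Qed.

HB.instance Definition _ :=
  Measure_isSigmaFinite.Build _ _ _ lebS lebS_sigma_finite.

End lebS.

(** In dimension 0 the single point has mass 1, in accordance with the empty product of side
    lengths. *)
Fixpoint leb n : {sigma_finite_measure set (BorelR R n) -> \bar R} :=
  match n with
  | 0%N => @dirac _ (BorelR R 0) (0 : 'rV[R]_0) R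
  | n'.+1 => lebS (leb n')
  end.

Lemma lebS_integral n (f : BorelR R n.+1 -> \bar R) :
  measurable_fun setT f -> (forall x, 0 <= f x)%E ->
  (\int[leb n.+1]_x f x = \int[lebesgue]_x \int[leb n]_y f (rv_cons (x, y)))%E.
Proof.
move=> mf f0; rewrite /= /lebS /pushm (ge0_integral_pushforward (@measurable_rv_cons R n))//.
rewrite preimage_setT fubini_tonelli1//.
  by apply: measurableT_comp => //; exact: measurable_rv_cons.
by move=> x; exact: f0.
Qed.

Lemma leb_cbox n (a b : 'rV[R]_n) : (forall i, a 0 i <= b 0 i) ->
  leb n (cbox a b) = (\prod_(i < n) (b 0 i - a 0 i))%:E.
Proof.
elim: n a b => [|n IH] a b ab.
  by rewrite big_ord0 /= diracE mem_set// => -[].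
rewrite /= /lebS /pushm /pushforward.
rewrite (_ : _ @^-1` _ = `[a 0 ord0, b 0 ord0]%classic `*`
   cbox (rv_split a).2 (rv_split b).2); last first.
  apply/seteqP; split=> -[x v] /=.
    move=> h; split; first by have := h ord0; rewrite rv_cons0 in_itv.
    by move=> i; have := h (lift ord0 i); rewrite rv_consS/= !mxE.
  move=> [xab h] i; case: (unliftP ord0 i) => [j|] ->; last by rewrite rv_cons0.
  by rewrite rv_consS/=; have := h j; rewrite !mxE.
rewrite /= product_measure1E//; last exact: measurable_cbox.
rewrite IH; last by move=> i; rewrite !mxE.
rewrite [X in (X * _)%E]lebesgue_measure_itv/= lte_fin big_ord_recl.
under eq_bigr do rewrite !mxE.
have [_|ba] := ltP (a 0 ord0) (b 0 ord0); first by rewrite -EFinB -EFinM.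
have -> : b 0 ord0 = a 0 ord0 by apply/eqP; rewrite eq_le ba ab.
by rewrite subrr mul0r mul0e.
Qed.

Lemma leb_unique n (m : {measure set (BorelR R n) -> \bar R}) :
  (forall a b : 'rV[R]_n, (forall i, a 0 i <= b 0 i) ->
     m (cbox a b) = (\prod_(i < n) (b 0 i - a 0 i))%:E) ->
  forall A, measurable A -> m A = leb n A.
Proof.
move=> mab; apply: Borel_measure_unique => a b ab; rewrite mab ?ltry//.
by apply/esym; exact: leb_cbox.
Qed.

Lemma leb_shift n (v : 'rV[R]_n) (A : set (BorelR R n)) : measurable A ->
  leb n ((fun u : BorelR R n => v + (u : 'rV[R]_n) : BorelR R n) @^-1` A) = leb n A.
Proof.
have mv : measurable_fun setT (fun u : BorelR R n => v + (u : 'rV[R]_n) : BorelR R n).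
  apply: measurable_fun_row => i; under eq_fun do rewrite mxE.
  by apply: measurable_funD => //; exact: measurable_coord.
move=> mA; rewrite -[LHS]/(pushm (leb n) mv A); apply: leb_unique => // a b ab.
rewrite /= /pushm /pushforward (_ : _ @^-1` _ = cbox (a - v) (b - v)); last first.
  by apply/seteqP; split=> u h i; have := h i; rewrite !mxE -?lerBlDr -?lerBrDr => /andP[h1 h2]; apply/andP; split; lra.
rewrite leb_cbox => [|i]; last by rewrite !mxE lerD2r.
by congr EFin; apply: eq_bigr => i _; rewrite !mxE; ring.
Qed.

(** The pushforward multiplied by [|s| ^+ n] has the right mass on boxes. A negative [s] exchanges
    the ends of each side; the case [s = -1] is the symmetry used for the isodiametric inequality
    and for odd integrands. *)
Lemma leb_scale n (s : R) (A : set (BorelR R n)) : s != 0 -> measurable A ->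
  leb n ((fun u : BorelR R n => s *: (u : 'rV[R]_n) : BorelR R n) @^-1` A) =
    ((`|s| ^- n)%:E * leb n A)%E.
Proof.
move=> s0.
have mv : measurable_fun setT (fun u : BorelR R n => s *: (u : 'rV[R]_n) : BorelR R n).
  apply: measurable_fun_row => i; under eq_fun do rewrite mxE.
  by apply: measurable_funM => //; exact: measurable_coord.
have sn0 : 0 < `|s| ^+ n by rewrite exprn_gt0// normr_gt0.
have sn : 0 <= `|s| ^+ n by exact: ltW.
move=> mA; have : (mscale (NngNum sn) (pushm (leb n) mv)) A = leb n A.
  apply: leb_unique => // a b ab.
  rewrite /= /mscale /= /pushm /pushforward.
  have [s_gt0|s_le0] := ltP 0 s.
    rewrite (_ : _ @^-1` _ = cbox (s^-1 *: a) (s^-1 *: b)); last first.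
      apply/seteqP; split=> u h i; have := h i; rewrite !mxE.
        by rewrite ler_pdivrMl// ler_pdivlMl.
      by rewrite ler_pdivrMl// ler_pdivlMl.
    rewrite leb_cbox => [|i]; last by rewrite !mxE ler_pM2l// invr_gt0.
    rewrite -EFinM; congr EFin; rewrite -[n in _ ^+ n]card_ord -prodr_const -big_split/=.
    by apply: eq_bigr => i _; rewrite !mxE gtr0_norm//; field.
  have s_lt0 : s < 0 by rewrite lt_neqAle s0.
  rewrite (_ : _ @^-1` _ = cbox (s^-1 *: b) (s^-1 *: a)); last first.
    apply/seteqP; split=> u h i; have := h i; rewrite !mxE.
      by rewrite ler_ndivrMl// ler_ndivlMl// andbC.
    by rewrite ler_ndivrMl// ler_ndivlMl// andbC.
  rewrite leb_cbox => [|i]; last by rewrite !mxE ler_nM2l// invr_lt0.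
  rewrite -EFinM; congr EFin; rewrite -[n in _ ^+ n]card_ord -prodr_const -big_split/=.
  by apply: eq_bigr => i _; rewrite !mxE ltr0_norm//; field.
move=> <-; rewrite /mscale /= muleA -EFinM mulVf ?mul1e//.
by rewrite gt_eqF.
Qed.

End leb_def.

(** * Volume of balls *)

Section ball_volume.
Context {R : realType}.
Local Notation lebesgue := (@lebesgue_measure R).

(** Minus the derivative of the Gaussian exp(-r^2) on the half-line, so that its integral over [a,
    +oo[ is [gauss_fun a]. *)
Let k (r : R) : R := 2 * r * gauss_fun r * (0 <= r)%R%:R.

Let k_ge0 r : 0 <= k r.
Proof.
rewrite /k; case: (leP 0 r) => r0; last by rewrite mulr0.
by rewrite mulr1 !mulr_ge0// gauss_fun_ge0.
Qed.

#[local] Hint Resolve k_ge0 : core.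

Lemma measurable_natb d (T : measurableType d) (f g : T -> R) :
  measurable_fun setT f -> measurable_fun setT g ->
  measurable_fun setT (fun t => (f t <= g t)%R%:R : R).
Proof.
move=> mf mg.
rewrite (_ : (fun _ => _) = (fun t => if f t <= g t then 1 else 0 : R)); last first.
  by apply/funext => t; case: leP.
by apply: measurable_fun_ifT => //; exact: measurable_fun_ler.
Qed.

Let measurable_k : measurable_fun setT k.
Proof.
apply: measurable_funM; last by apply: measurable_natb.
apply: measurable_funM; last exact: measurable_gauss_fun.
exact: measurable_funM.
Qed.

Lemma gauss_tail (a : R) : 0 <= a ->
  (\int[lebesgue]_r (k r * (a <= r)%R%:R)%:E = (gauss_fun a)%:E)%E.
Proof.
move=> a0; transitivity (\int[lebesgue]_(r in `[a, +oo[) (2 * r * gauss_fun r)%:E)%E.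
  rewrite [RHS]integral_mkcond; apply: eq_integral => r _; rewrite patchE /k.
  rewrite mem_setE in_itv/= andbT; case: (leP a r) => ar; last by rewrite mulr0.
  by rewrite (le_trans a0 ar) !mulr1.
have dF (x : R) : is_derive x (1:R) (fun x => - gauss_fun x) (2 * x * gauss_fun x).
  have h : is_derive x (1:R) (fun x : R => - x ^+ 2) (- (2 * x)).
    apply: is_derive_eq; rewrite /GRing.scale/=; ring.
  have h2 := @is_derive1_comp _ expR (fun x : R => - x ^+ 2) x _ _ (is_derive_expR _) h.
  have := is_deriveN h2; rewrite mulrN opprK mulrC; exact.
have cF : continuous (fun x : R => - gauss_fun x).
  by move=> x; apply: continuousN; exact: continuous_gauss_fun.
rewrite (@ge0_continuous_FTC2y _ _ (fun x => - gauss_fun x) _ 0).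
- by rewrite sub0e EFinN oppeK.
- by move=> x ax; rewrite !mulr_ge0 ?gauss_fun_ge0// (le_trans a0).
- apply: continuous_subspaceT => x; apply: continuousM.
    by apply: continuousM => //; exact: cst_continuous.
  exact: continuous_gauss_fun.
- by rewrite -oppr0; apply: cvgN; exact: cvg_gauss_fun.
- by move=> x _; exact: ex_derive.
- by apply: cvg_at_right_filter; exact: cF.
- by move=> x _; rewrite derive1E; exact: derive_val.
Qed.

(** Layer-cake formula: write [gauss_fun (N t)] as the integral of [k] over r >= N t and exchange by
    Tonelli. It serves on the line for the moments and on R^n, with [N] the norm, for the volume of
    balls. *)
Lemma gauss_layer d (T : measurableType d) (nu : {sigma_finite_measure set T -> \bar R})
    (N w : T -> R) : measurable_fun setT N -> measurable_fun setT w ->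
  (forall t, 0 <= N t) -> (forall t, 0 <= w t) ->
  (\int[nu]_t (w t * gauss_fun (N t))%:E =
   \int[lebesgue]_r ((k r)%:E * \int[nu]_t (w t * (N t <= r)%R%:R)%:E))%E.
Proof.
move=> mN mw N0 w0.
pose f (p : T * measurableTypeR R) : \bar R := (w p.1 * (k p.2 * (N p.1 <= p.2)%R%:R))%:E.
have mf : measurable_fun setT f.
  apply/measurable_EFinP; apply: measurable_funM.
    exact: measurableT_comp mw measurable_fst.
  apply: measurable_funM; first exact: measurableT_comp measurable_k measurable_snd.
  apply: measurable_natb; last exact: measurable_snd.
  exact: measurableT_comp mN measurable_fst.
have f0 p : (0 <= f p)%E by rewrite lee_fin mulr_ge0// mulr_ge0.
transitivity (\int[nu]_t \int[lebesgue]_r f (t, r))%E.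
  apply: eq_integral => t _; rewrite /f/=; under eq_integral do rewrite EFinM.
  rewrite ge0_integralZl//=; first by rewrite gauss_tail.
  - apply/measurable_EFinP; apply: measurable_funM => //.
    exact: measurable_natb.
  - by move=> r _; rewrite lee_fin mulr_ge0.
  - by rewrite lee_fin.
rewrite (fubini_tonelli f)//; apply: eq_integral => r _; rewrite /f/=.
under eq_integral do rewrite mulrCA EFinM.
rewrite ge0_integralZl//=.
- apply/measurable_EFinP; apply: measurable_funM => //.
  exact: measurable_natb.
- by move=> t _; rewrite lee_fin mulr_ge0.
- by rewrite lee_fin.
Qed.

Lemma exprn_integral (m : nat) (r : R) : 0 <= r ->
  (\int[lebesgue]_(t in `[0%R, r]) (m.+1%:R * t ^+ m)%:E = (r ^+ m.+1)%:E)%E.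
Proof.
rewrite le_eqVlt => /predU1P[<-|r0].
  by rewrite set_itv1 integral_set1 expr0n.
have dF (x : R) : is_derive x (1:R) (fun x => x ^+ m.+1) (m.+1%:R * x ^+ m).
  have -> : (fun x : R => x ^+ m.+1) = id ^+ m.+1 by rewrite exprfctE.
  by apply: is_derive_eq; rewrite /GRing.scale/= mulr1 mulr_natl.
have cF : continuous (fun x : R => x ^+ m.+1) by move=> x; exact: exprn_continuous.
rewrite (@continuous_FTC2 _ _ (fun x => x ^+ m.+1))//.
- by rewrite expr0n/= sube0.
- apply: continuous_subspaceT => x.
  by apply: (@continuousM _ _ (fun=> m.+1%:R) (fun t : R => t ^+ m)); [exact: cst_continuous|exact: exprn_continuous].
- split.
  + by move=> x _; exact: ex_derive.
  + by apply: cvg_at_right_filter; exact: cF.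
  + by apply: cvg_at_left_filter; exact: cF.
- by move=> x _; rewrite derive1E; exact: derive_val.
Qed.

Let G (m : nat) : \bar R := (\int[lebesgue]_(t in `[0%R, +oo[) (t ^+ m * gauss_fun t)%:E)%E.

(** An integration by parts in the form of [gauss_layer]: the inner integral of (m+1) t^m over
    [0, r] is r^(m+1), and [k] supplies the factor 2 r. *)
Lemma gauss_moment_rec m : (m.+1%:R%:E * G m = 2%:R%:E * G m.+2)%E.
Proof.
pose w (t : R) : R := m.+1%:R * t ^+ m * (0 <= t)%R%:R.
have w0 t : 0 <= w t.
  rewrite /w; case: (leP 0 t) => t0; last by rewrite mulr0.
  by rewrite mulr1 mulr_ge0// exprn_ge0.
have mXg i : measurable_fun setT (fun t : R => (t ^+ i * gauss_fun t)%:E).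
  by apply/measurable_EFinP; apply: measurable_funM => //; exact: measurable_gauss_fun.
have mw : measurable_fun setT w.
  by apply: measurable_funM; [exact: measurable_funM|exact: measurable_natb].
have XG i (t : R) : `[0%R, +oo[%classic t -> (0 <= (t ^+ i * gauss_fun t)%:E)%E.
  by rewrite /= in_itv/= andbT => t0; rewrite lee_fin mulr_ge0 ?exprn_ge0 ?gauss_fun_ge0.
rewrite /G -ge0_integralZl//; [|by apply: measurable_funTS; exact: mXg|by move=> t; exact: XG].
rewrite -ge0_integralZl//; [|by apply: measurable_funTS; exact: mXg|by move=> t; exact: XG].
transitivity (\int[lebesgue]_t (w t * gauss_fun `|t|)%:E)%E.
  rewrite integral_mkcond; apply: eq_integral => t _; rewrite patchE mem_setE in_itv/= andbT.
  rewrite /w; case: (leP 0 t) => t0; last by rewrite mulr0 mul0r.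
  by rewrite mulr1 -EFinM mulrA ger0_norm.
rewrite (@gauss_layer _ _ lebesgue (fun t : R => `|t|) w)//; last exact: normr_measurable.
rewrite [RHS]integral_mkcond; apply: eq_integral => r _; rewrite patchE mem_setE in_itv/= andbT.
rewrite /k; case: (leP 0 r) => r0; last by rewrite mulr0 mul0e.
rewrite mulr1 (_ : (\int[_]_t _)%E = (r ^+ m.+1)%:E).
  by rewrite -!EFinM !exprS; congr EFin; ring.
rewrite -exprn_integral// [RHS]integral_mkcond; apply: eq_integral => t _.
rewrite patchE mem_setE in_itv/= /w; case: (leP 0 t) => t0 /=; last by rewrite mulr0 mul0r.
rewrite mulr1 ger0_norm//; case: (leP t r) => tr /=; last by rewrite mulr0.
by rewrite mulr1.
Qed.

Let g := fix g (m : nat) : R :=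
  match m with 0%N => Num.sqrt pi / 2 | 1%N => 2^-1 | (m'.+2)%N => m'.+1%:R / 2 * g m' end.

Let double_inj (x : \bar R) (y : R) : (2%:R%:E * x = (2 * y)%:E)%E -> x = y%:E.
Proof.
case: x => [r| |].
- by rewrite -EFinM => -[/mulfI ->].
- by rewrite gt0_muley ?lte_fin.
- by rewrite gt0_muleNy ?lte_fin.
Qed.

Lemma gauss_momentE m : G m = (g m)%:E.
Proof.
suff H i : G i = (g i)%:E /\ G i.+1 = (g i.+1)%:E by have [] := H m.
elim: i => [|i [IH1 IH2]]; split => //.
- rewrite /G; under eq_integral do rewrite expr0 mul1r.
  exact: integral0y_gauss.
- have := @gauss_tail 0 (lexx 0); rewrite [in RHS]/gauss_fun expr0n oppr0 expR0 => H1.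
  apply: double_inj; rewrite /= mulfV// -[RHS]H1 /G -ge0_integralZl//=; last first.
  + by move=> t; rewrite in_itv/= andbT => t0; rewrite lee_fin mulr_ge0 ?gauss_fun_ge0.
  + apply: measurable_funTS; apply/measurable_EFinP; apply: measurable_funM => //.
    exact: measurable_gauss_fun.
  rewrite integral_mkcond; apply: eq_integral => t _; rewrite patchE mem_setE in_itv/= andbT.
  by rewrite /k; case: (leP 0 t) => t0; rewrite ?mulr1 ?mulr0// -EFinM mulrA.
- apply: double_inj.
  by rewrite -gauss_moment_rec IH1 -!EFinM /=; congr EFin; field.
Qed.

Lemma gauss_integral_leb n :
  (\int[leb n]_u (gauss_fun (enorm (u : 'rV[R]_n)))%:E = (Num.sqrt pi ^+ n)%:E)%E.
Proof.
elim: n => [|n IH].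
  rewrite [LHS]integral_dirac//; last first.
    apply/measurable_EFinP; apply: measurableT_comp; first exact: measurable_gauss_fun.
    by apply: continuous_Borel_real; exact: enorm_continuous.
  by rewrite diracT mul1e enorm0 /gauss_fun expr0n oppr0 expR0.
rewrite lebS_integral//; last 2 first.
- apply/measurable_EFinP; apply: measurableT_comp; first exact: measurable_gauss_fun.
  by apply: continuous_Borel_real; exact: enorm_continuous.
- by move=> x; rewrite lee_fin gauss_fun_ge0.
transitivity (\int[lebesgue]_x ((Num.sqrt pi ^+ n)%:E * (gauss_fun x)%:E))%E; last first.
  rewrite ge0_integralZl//.
  - by rewrite integralT_gauss -EFinM exprSr.
  - by apply/measurable_EFinP; exact: measurable_gauss_fun.
  - by move=> x _; rewrite lee_fin gauss_fun_ge0.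
apply: eq_integral => x _; rewrite -IH muleC -ge0_integralZl//.
- apply: eq_integral => y _; rewrite -EFinM; congr EFin.
  rewrite /gauss_fun -expRD; congr expR.
  rewrite !sqr_enorm /edot big_ord_recl rv_cons0 opprD; congr (- _ - _) => //.
  by apply: eq_bigr => i _; rewrite rv_consS.
- apply/measurable_EFinP; apply: measurableT_comp; first exact: measurable_gauss_fun.
  by apply: continuous_Borel_real; exact: enorm_continuous.
- by move=> y _; rewrite lee_fin gauss_fun_ge0.
- by rewrite lee_fin gauss_fun_ge0.
Qed.

Definition cball n (r : R) : set (BorelR R n) := [set u | enorm (u : 'rV[R]_n) <= r].

Lemma measurable_cball n r : measurable (@cball n r).
Proof.
apply: closed_Borel; rewrite (_ : cball _ = (@enorm R n) @^-1` [set t | t <= r])//.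
by apply: closed_comp; [move=> x _; exact: enorm_continuous|exact: closed_le].
Qed.

Lemma leb_cball_scale n r : 0 < r -> leb n (@cball n r) = ((r ^+ n)%:E * leb n (@cball n 1))%E.
Proof.
move=> r0; rewrite -(gtr0_norm r0) -{2}(invrK r) normfV exprVn -leb_scale ?invr_eq0 ?gt_eqF//; last first.
  exact: measurable_cball.
congr (leb n _); apply/seteqP; split => u; rewrite /cball/= enormZ normfV (gtr0_norm r0).
  by rewrite ler_pdivrMl// mulr1.
by rewrite ler_pdivrMl// mulr1.
Qed.

(* The integral of the Gaussian over R^n is [sqrt pi ^+ n] by Fubini, and is
   [|B(0, 1)| * 2 * int t^(n+1) exp(- t^2)] when its graph is sliced into balls;
   the half-line moments [g] obey the two-step recursion of [unit_ball_vol]. *)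
Lemma unit_ball_vol_moment n : @unit_ball_vol R n * (2 * g n.+1) = Num.sqrt pi ^+ n.
Proof.
suff H i : @unit_ball_vol R i * (2 * g i.+1) = Num.sqrt pi ^+ i /\
   @unit_ball_vol R i.+1 * (2 * g i.+2) = Num.sqrt pi ^+ i.+1 by have [] := H n.
elim: i => [|i [IH1 IH2]]; split => //=.
- by rewrite expr0 mul1r mulfV.
- by rewrite expr1; field.
- rewrite [RHS]exprS exprSr -IH1 mulrC -!mulrA [LHS](_ : _ = (Num.sqrt pi * Num.sqrt pi) * (unit_ball_vol i * (2 * g i.+1))).
    by rewrite /=; ring.
  have -> : Num.sqrt pi * Num.sqrt pi = pi :> R by rewrite -expr2 sqr_sqrtr// pi_ge0.
  by rewrite /=; field; apply: lt0r_neq0; have := ler0n R i; lra.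
Qed.

Let g_gt0 m : 0 < g m.
Proof.
suff H i : 0 < g i /\ 0 < g i.+1 by have [] := H m.
elim: i => [|i [IH1 IH2]]; split => //=; last by rewrite mulr_gt0// divr_gt0.
by rewrite divr_gt0// sqrtr_gt0 pi_gt0.
Qed.

Lemma leb_cball n r : 0 < r -> leb n (@cball n r) = (unit_ball_vol n * r ^+ n)%:E.
Proof.
move=> r0; rewrite leb_cball_scale// muleC EFinM; congr (_ * _)%E.
have men : measurable_fun setT (@enorm R n : BorelR R n -> R).
  by apply: continuous_Borel_real; exact: enorm_continuous.
have := gauss_integral_leb n.
under eq_integral do rewrite -[gauss_fun _]mul1r.
rewrite (@gauss_layer _ _ (leb n) (@enorm R n) (fun=> 1))//; last exact: enorm_ge0.
rewrite (_ : (\int[_]_r _)%E = (leb n (@cball n 1) * (2 * g n.+1)%:E)%E).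
  rewrite -unit_ball_vol_moment.
  have c0 : 0 < 2 * g n.+1 by rewrite mulr_gt0.
  (* The ball is not yet known to have finite volume; an infinite one would make the finite Gaussian
     integral infinite. *)
  case: (leb n (cball 1)) => [v| |].
  - by rewrite -EFinM => -[/mulIf ->]//; rewrite gt_eqF.
  - by rewrite gt0_mulye ?lte_fin.
  - by rewrite gt0_mulNye ?lte_fin.
have mXg : measurable_fun setT (fun t : R => (t ^+ n.+1 * gauss_fun t)%:E).
  by apply/measurable_EFinP; apply: measurable_funM => //; exact: measurable_gauss_fun.
have XG (t : R) : `[0%R, +oo[%classic t -> (0 <= (t ^+ n.+1 * gauss_fun t)%:E)%E.
  by rewrite /= in_itv/= andbT => t0; rewrite lee_fin mulr_ge0 ?exprn_ge0 ?gauss_fun_ge0.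
rewrite EFinM -gauss_momentE /G muleA -ge0_integralZl//; last 2 first.
- by apply: measurable_funTS; exact: mXg.
- by rewrite mule_ge0.
rewrite [RHS]integral_mkcond; apply: eq_integral => t _; rewrite patchE mem_setE in_itv/= andbT.
rewrite /k; have [t0|t0] := leP 0 t; last by rewrite mulr0 mul0e.
move: t0; rewrite le_eqVlt => /predU1P[<-|t_gt0].
  by rewrite !mulr0 !mul0r expr0n /= mul0r mul0e mule0.
rewrite (_ : (\int[_]_t _)%E = leb n (@cball n t)).
  rewrite (leb_cball_scale _ t_gt0) mulr1 muleA -EFinM -muleA muleC.
  by congr (_ * _)%E; rewrite -EFinM; congr EFin; rewrite exprS; ring.
rewrite -[RHS]mul1e -integral_cst; last exact: measurable_cball.
rewrite [RHS]integral_mkcond; apply: eq_integral => u _; rewrite patchE mul1r.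
have -> : (u \in @cball n t) = (enorm (u : 'rV[R]_n) <= t) by apply/idP/idP; rewrite inE.
by case: leP.
Qed.

(** At [r = 0] the ball is a point: mass 0 for n > 0 and mass 1 for n = 0, in agreement with 0^0 =
    1. *)
Lemma leb_cball_ge0 n r : 0 <= r -> leb n (@cball n r) = (unit_ball_vol n * r ^+ n)%:E.
Proof.
rewrite le_eqVlt => /predU1P[<-|]; last exact: leb_cball.
have -> : @cball n 0 = cbox 0 0.
  apply/seteqP; split=> u; rewrite /cball /=.
    move=> u0; have /enorm0_eq0 -> : enorm (u : 'rV[R]_n) = 0.
      by apply/eqP; rewrite eq_le u0 enorm_ge0.
    by move=> i; rewrite lexx.
  move=> h; rewrite (_ : u = (0 : 'rV[R]_n)) ?enorm0//; apply/rowP => i.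
  by apply/eqP; rewrite eq_le andbC; have := h i; rewrite mxE.
rewrite leb_cbox//; case: n => [|n]; first by rewrite big_ord0 expr0 mulr1.
by rewrite big_ord_recl !mxE subrr mul0r expr0n/= mulr0.
Qed.

End ball_volume.

(** * Prekopa-Leindler and isodiametric inequalities *)

Section prekopa_leindler.
Context {R : realType}.
Local Notation lebesgue := (@lebesgue_measure R).

Lemma lebesgue_double_shift (b : R) (A : set R) : measurable A ->
  (2%:E * lebesgue ((fun z : R => (2 * z - b)%R) @^-1` A) = lebesgue A)%E.
Proof.
have mf : measurable_fun setT (fun z : measurableTypeR R => (2 * z - b) : measurableTypeR R).
  by apply: measurable_funB => //; exact: measurable_funM.
have h0 : 0 <= 2%:R :> R by [].
move=> mA; apply/esym.
apply: (@lebesgue_measure_unique R (mscale (NngNum h0) (pushm lebesgue mf))) => // _ [[a c]] _ <-.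
rewrite /= /mscale /= /pushm /pushforward.
rewrite (_ : _ @^-1` _ = `](a + b) / 2, (c + b) / 2]%classic); last first.
  apply/seteqP; split=> z; rewrite /= !in_itv/= => /andP[h1 h2]; apply/andP; split; lra.
rewrite !lebesgue_measure_itv/= !lte_fin.
have -> : ((a + b) / 2 < (c + b) / 2) = (a < c) by apply/idP/idP => ?; lra.
by case: ifP => _; rewrite ?mule0// -!EFinB -EFinM; congr EFin; field.
Qed.

(** Approximate [A] and [B] from inside by compact sets, with maximum [a] and minimum [b]
    respectively. The midpoints of the first set with [b] lie to the left of (a + b)/2, those of the
    second with [a] to the right; both sets lie in [C] and share at most one point. *)
Lemma brunn_minkowski1 (A B C : set R) : measurable A -> measurable B -> measurable C ->
  A !=set0 -> B !=set0 -> (lebesgue A < +oo)%E -> (lebesgue B < +oo)%E ->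
  (forall x y, A x -> B y -> C ((x + y) / 2)) ->
  (lebesgue A + lebesgue B <= 2%:E * lebesgue C)%E.
Proof.
move=> mA mB mC [a0 Aa0] [b0 Bb0] Aoo Boo ABC; apply/lee_addgt0Pr => e e0.
have e20 : 0 < e / 2 by rewrite divr_gt0.
have [K1 [cK1 K1A K1e]] := lebesgue_regularity_inner mA Aoo e20.
have [K2 [cK2 K2B K2e]] := lebesgue_regularity_inner mB Boo e20.
pose K1' := K1 `|` [set a0]; pose K2' := K2 `|` [set b0].
have cK1' : compact K1' by apply: compactU => //; exact: compact_set1.
have cK2' : compact K2' by apply: compactU => //; exact: compact_set1.
have mK1' : measurable K1' by apply: closed_measurable; exact: compact_closed.
have mK2' : measurable K2' by apply: closed_measurable; exact: compact_closed.
have cid' (K : set R) : {within K, continuous (id : R -> R)}.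
  by apply: continuous_subspaceT => x; exact: cvg_id.
have K1'0 : K1' !=set0 by exists a0; right.
have K2'0 : K2' !=set0 by exists b0; right.
have [a /set_mem K1a amax] := compact_EVT_max K1'0 cK1' (cid' _).
have [b /set_mem K2b bmin] := compact_EVT_min K2'0 cK2' (cid' _).
have K1'A : K1' `<=` A by move=> x [/K1A|->].
have K2'B : K2' `<=` B by move=> x [/K2B|->].
have mK (K A' : set R) (z : R) : measurable A' -> compact K -> (lebesgue (A' `\` K) < (e / 2)%:E)%E ->
    (lebesgue A' <= lebesgue (K `|` [set z]) + (e / 2)%:E)%E.
  move=> mA' cK Ke.
  have mmK : measurable K by apply: closed_measurable; exact: compact_closed.
  have mKz : measurable (K `|` [set z]) by apply: measurableU.
  apply: (@le_trans _ _ (lebesgue ((K `|` [set z]) `|` (A' `\` K)))).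
    apply: le_measure; rewrite ?inE//; first by apply: measurableU => //; exact: measurableD.
    by move=> x A'x; have [Kx|Kx] := pselect (K x); [left; left|right].
  rewrite (le_trans (measureU2 _ _ _))//; first exact: measurableD.
  by rewrite leeD2l// ltW.
have h1 := mK K1 A a0 mA cK1 K1e; have h2 := mK K2 B b0 mB cK2 K2e.
(* [S1] is (K1' + b)/2 and [S2] is (K2' + a)/2: each has half the measure of the original set. *)
set S1 := (fun z : R => 2 * z - b) @^-1` K1'.
set S2 := (fun z : R => 2 * z - a) @^-1` K2'.
pose m := (a + b) / 2.
have mdouble (c : R) : measurable_fun setT (fun z : R => 2 * z - c).
  by apply: measurable_funB => //; exact: measurable_funM.
have mS1 : measurable S1 by rewrite -[X in measurable X]setTI; exact: mdouble.
have mS2 : measurable S2 by rewrite -[X in measurable X]setTI; exact: mdouble.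
have S1C : S1 `<=` C `&` `]-oo, m].
  move=> z /= S1z; split.
    by have -> : z = ((2 * z - b) + b) / 2 by [field]; apply: ABC; [exact: K1'A|exact: K2'B].
  by have := amax _ (mem_set S1z); rewrite in_itv/= /m; lra.
have S2C : S2 `\ m `<=` C `&` `]m, +oo[.
  move=> z /= [S2z /eqP zm]; split.
    by have -> : z = (a + (2 * z - a)) / 2 by [field]; apply: ABC; [exact: K1'A|exact: K2'B].
  have := bmin _ (mem_set S2z); rewrite in_itv/= andbT lt_neqAle eq_sym zm /m /=; lra.
apply: (@le_trans _ _ (lebesgue K1' + lebesgue K2' + e%:E)%E).
  rewrite [e]splitr EFinD addeACA; exact: leeD.
rewrite leeD2r// -(lebesgue_double_shift b mK1') -(lebesgue_double_shift a mK2') -/S1 -/S2.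
rewrite -ge0_muleDr// lee_pmul2l//.
have S2m : (lebesgue S2 <= lebesgue (S2 `\ m))%E.
  apply: (@le_trans _ _ (lebesgue ((S2 `\ m) `|` [set m]))).
    apply: le_measure; rewrite ?inE//; first by apply: measurableU => //; exact: measurableD.
    by move=> x S2x; have [->|xm] := pselect (x = m); [right|left].
  rewrite (le_trans (measureU2 _ _ _))//; first exact: measurableD.
  rewrite [X in (_ + X <= _)%E](_ : _ = 0%E) ?adde0//; exact: lebesgue_measure_set1.
have -> : lebesgue C = (lebesgue (C `&` `]-oo, m]) + lebesgue (C `&` `]m, +oo[))%E.
  rewrite -measureU//.
  - rewrite -setIUr -(setIT C); congr (lebesgue _); rewrite -setIA setTI; congr (_ `&` _).
    apply/seteqP; split=> // x _ /=; rewrite !in_itv/= andbT.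
    by case: (leP x m) => _; [left|right].
  - exact: measurableI.
  - exact: measurableI.
  - rewrite -subset0 => x [[_ h] [_]]; move: h; rewrite /= !in_itv/= andbT; lra.
apply: leeD.
  by apply: le_measure; rewrite ?inE//; exact: measurableI.
apply: (le_trans S2m); apply: le_measure; rewrite ?inE//; last exact: measurableI.
exact: measurableD.
Qed.

(** Indicator of the subgraph of [f], cut at heights between 0 and 1. *)
Let phi (f : R -> R) (p : R * R) : R := ((0 < p.2 < 1) && (p.2 < f p.1))%:R.

Let mphi (f : R -> R) : measurable_fun setT f ->
  measurable_fun setT (fun p : measurableTypeR R * measurableTypeR R => (phi f p)%:E).
Proof.
move=> mf; apply/measurable_EFinP.
rewrite (_ : phi f = (fun p => if (0 < p.2 < 1) && (p.2 < f p.1) then 1 else 0)); last first.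
  by apply/funext => p; rewrite /phi; case: ifP.
have mf1 : measurable_fun setT (fun p : measurableTypeR R * measurableTypeR R => f p.1).
  exact: measurableT_comp mf measurable_fst.
apply: measurable_fun_ifT => //; apply: measurable_and; first apply: measurable_and.
- by apply: measurable_fun_ltr => //; exact: measurable_snd.
- by apply: measurable_fun_ltr => //; exact: measurable_snd.
- by apply: measurable_fun_ltr => //; exact: measurable_snd.
Qed.

Let mphi2 (f : R -> R) : measurable_fun setT f ->
  measurable_fun setT (fun t => \int[lebesgue]_x (phi f (x, t))%:E)%E.
Proof.
move=> mf; apply: (measurable_fun_fubini_tonelli_G _ (mphi mf)).
by move=> p; rewrite lee_fin.
Qed.

Let phiE (f : R -> R) t : measurable_fun setT f ->
  (\int[lebesgue]_x (phi f (x, t))%:E =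
   if (0 < t < 1)%R then lebesgue [set x | (t < f x)%R] else 0)%E.
Proof.
move=> mf; have [t01|t01] := boolP (0 < t < 1); last first.
  by rewrite integral0_eq// => x _; rewrite /phi/= (negbTE t01).
rewrite -[RHS]mul1e -integral_cst; last first.
  by rewrite -preimage_itvoy -[X in measurable X]setTI; exact: mf.
rewrite [RHS]integral_mkcond; apply: eq_integral => x _; rewrite patchE /phi/= t01/=.
have -> : (x \in [set x | t < f x]) = (t < f x) by apply/idP/idP; rewrite inE.
by case: ltP.
Qed.

Let phi_layer (f : R -> R) : measurable_fun setT f -> (forall x, 0 <= f x) ->
  (\int[lebesgue]_x (Num.min (f x) 1)%:E =
   \int[lebesgue]_t \int[lebesgue]_x (phi f (x, t))%:E)%E.
Proof.
move=> mf f0.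
pose F (p : measurableTypeR R * measurableTypeR R) := (phi f p)%:E.
have mF : measurable_fun setT F by exact: mphi.
rewrite -(fubini_tonelli F)//; last by move=> p; rewrite lee_fin.
apply: eq_integral => x _; rewrite /F /phi/=.
transitivity (\int[lebesgue]_(t in `]0%R, (Num.min (f x) 1)%R[) cst 1 t)%E.
  rewrite integral_cst//= mul1e lebesgue_measure_itv/= lte_fin oppr0 adde0.
  have [_//|m0] := ltP 0 (Num.min (f x) 1).
  by congr EFin; apply/eqP; rewrite eq_le m0 le_min f0 ler01.
rewrite integral_mkcond; apply: eq_integral => t _; rewrite patchE mem_setE in_itv/= lt_min.
by case: (ltP 0 t) => //= t0; rewrite andbC; case: ifP.
Qed.

(** With suprema equal to 1, the sets f > t and g > t are both nonempty for every t < 1, as the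
    one-dimensional Brunn-Minkowski inequality demands; their midpoints lie in h > t. Integration
    over the height t gives an additive inequality. *)
Lemma prekopa_leindler1_normalized (f g h : R -> R) (b : R) :
  measurable_fun setT f -> measurable_fun setT g -> measurable_fun setT h ->
  (forall x, 0 <= f x <= 1) -> (forall x, 0 <= g x <= 1) -> (forall x, 0 <= h x) ->
  (forall t, t < 1 -> exists x, t < f x) -> (forall t, t < 1 -> exists x, t < g x) ->
  (forall x, f x != 0 -> `|x| <= b) -> (forall x, g x != 0 -> `|x| <= b) ->
  (forall x y, f x * g y <= h ((x + y) / 2) ^+ 2) ->
  (\int[lebesgue]_x (f x)%:E + \int[lebesgue]_x (g x)%:E <= 2%:E * \int[lebesgue]_x (h x)%:E)%E.
Proof.
move=> mf mg mh f01 g01 h0 supf supg bf bg fgh.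
have min1 (k : R -> R) : (forall x, 0 <= k x <= 1) ->
    (\int[lebesgue]_x (k x)%:E = \int[lebesgue]_x (Num.min (k x) 1)%:E)%E.
  by move=> k01; apply: eq_integral => x _; rewrite min_l//; have /andP[] := k01 x.
have k0 (k : R -> R) : (forall x, 0 <= k x <= 1) -> forall x, 0 <= k x.
  by move=> k01 x; have /andP[] := k01 x.
(* Only heights below 1 are compared; what [h] has above 1 is given away, which is in the right
   direction. *)
have hmin : (\int[lebesgue]_x (Num.min (h x) 1)%:E <= \int[lebesgue]_x (h x)%:E)%E.
  apply: ge0_le_integral => //.
  - by move=> x _; rewrite lee_fin le_min h0 ler01.
  - by apply/measurable_EFinP; exact: measurable_minr.
  - exact/measurable_EFinP.
  - by move=> x _; rewrite lee_fin ge_min lexx.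
rewrite (le_trans _ (lee_wpmul2l _ hmin))//.
rewrite (min1 f)// (min1 g)// !phi_layer//; [|exact: k0|exact: k0].
have phi0 k t : (0 <= \int[lebesgue]_x (phi k (x, t))%:E)%E.
  by apply: integral_ge0 => x _; rewrite lee_fin.
rewrite -ge0_integralD//; [|exact: mphi2|exact: mphi2].
rewrite -ge0_integralZl//; last exact: mphi2.
apply: ge0_le_integral => //.
- by move=> t _; rewrite adde_ge0.
- by apply: emeasurable_funD; exact: mphi2.
- by apply: measurable_funeM; exact: mphi2.
move=> t _; rewrite !phiE//; case: ifPn => [/andP[t0 t1]|_]; last by rewrite adde0 mule0.
have mt (k : R -> R) : measurable_fun setT k -> measurable [set x | t < k x].
  by move=> mk; rewrite -preimage_itvoy -[X in measurable X]setTI; exact: mk.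
have bt (k : R -> R) : measurable_fun setT k -> (forall x, k x != 0 -> `|x| <= b) ->
    (lebesgue [set x | (t < k x)%R] < +oo)%E.
  move=> mk bk; apply: (@le_lt_trans _ _ (lebesgue `[(- b)%R, b]%classic))%E.
    apply: le_measure; rewrite ?inE//; first exact: mt.
    by move=> x /= tx; rewrite in_itv/= -ler_norml bk// gt_eqF// (lt_trans t0).
  by rewrite lebesgue_measure_itv/=; case: ifP => _; rewrite -?EFinB ltry.
apply: brunn_minkowski1; [exact: mt|exact: mt|exact: mt| | |exact: bt|exact: bt|].
- exact: supf.
- exact: supg.
- move=> x y /= tx ty; rewrite ltNge; apply/negP => ht.
  have := fgh x y; apply/negP; rewrite -ltNge.
  have h2 : h ((x + y) / 2) ^+ 2 <= t ^+ 2.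
    by rewrite ler_sqr ?nnegrE// ltW.
  apply: (le_lt_trans h2); rewrite expr2 ltr_pM// ltW//.
Qed.

Lemma integral_le_cbox n (f : 'rV[R]_n -> R) (M b : R) :
  measurable_fun setT (f : BorelR R n -> R) -> 0 <= b -> (forall x, 0 <= f x <= M) ->
  (forall x, f x != 0 -> forall i, `|x 0 i| <= b) ->
  (\int[leb n]_x (f x)%:E <= (M * (2 * b) ^+ n)%:E)%E.
Proof.
move=> mf b0 f0M fb.
have -> : (M * (2 * b) ^+ n)%:E =
    (\int[leb n]_(x in cbox (const_mx (- b)%R) (const_mx b)) cst M%:E x)%E.
  rewrite integral_cst//; last exact: measurable_cbox.
  rewrite [X in (_ * X)%E]leb_cbox; last by move=> i; rewrite !mxE; lra.
  rewrite -EFinM; congr (_ * _)%:E; under eq_bigr do rewrite !mxE.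
  by rewrite prodr_const card_ord; congr (_ ^+ _); ring.
rewrite [leRHS]integral_mkcond; apply: ge0_le_integral => //.
- by move=> x _; rewrite lee_fin; have /andP[] := f0M x.
- exact/measurable_EFinP.
- apply/(measurable_restrictT _ _).1 => //; exact: measurable_cbox.
move=> x _; rewrite patchE; case: ifPn => [_|xb].
  by rewrite lee_fin; have /andP[] := f0M x.
have [->//|fx0] := eqVneq (f x) 0.
exfalso; move/negP: xb; apply; rewrite inE => i.
by rewrite !mxE -ler_norml fb.
Qed.

(** Divide [f] and [g] by their suprema [a] and [c], and [h] by the square root of a c. The additive
    inequality becomes u + v <= 2 w, hence u v <= w^2, where the normalising constants cancel. *)
Lemma prekopa_leindler1 (f g h : R -> R) (M b : R) :
  measurable_fun setT f -> measurable_fun setT g -> measurable_fun setT h ->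
  (forall x, 0 <= f x <= M) -> (forall x, 0 <= g x <= M) -> (forall x, 0 <= h x) ->
  (forall x, f x != 0 -> `|x| <= b) -> (forall x, g x != 0 -> `|x| <= b) ->
  (forall x y, f x * g y <= h ((x + y) / 2) ^+ 2) ->
  (\int[lebesgue]_x (f x)%:E * \int[lebesgue]_x (g x)%:E <=
   \int[lebesgue]_x (h x)%:E * \int[lebesgue]_x (h x)%:E)%E.
Proof.
move=> mf mg mh f0M g0M h0 bf bg fgh.
have sup_pos (k : R -> R) : (forall x, 0 <= k x <= M) ->
    (exists x, k x != 0) -> exists2 a : R, 0 < a & (forall x, 0 <= a^-1 * k x <= 1) /\
      (forall t, t < 1 -> exists x, t < a^-1 * k x).
  move=> k0M [x0 kx0]; pose a := sup (range k).
  have hs : has_sup (range k).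
    split; first by exists (k x0); exists x0.
    by exists M => _ [x _ <-]; have /andP[] := k0M x.
  have ka x : k x <= a by apply: sup_ubound; [case: hs|exists x].
  have a0 : 0 < a.
    by rewrite (lt_le_trans _ (ka x0))// lt_neqAle eq_sym kx0; have /andP[] := k0M x0.
  exists a => //; split=> [x|t t1].
    by rewrite mulr_ge0 ?invr_ge0 ?(ltW a0)//= ?ler_pdivrMl ?mulr1//; have /andP[] := k0M x.
  have ta : 0 < a - t * a by rewrite -[X in X - _]mul1r -mulrBl mulr_gt0// subr_gt0.
  have [_ [x _ <-] kx] := sup_adherent ta hs.
  by exists x; rewrite ltr_pdivlMl// mulrC; rewrite -/a in kx; lra.
have [f0|] := pselect (exists x, f x != 0); last first.
  move=> nf; rewrite [X in (X * _)%E]integral0_eq ?mul0e.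
    by rewrite mule_ge0// integral_ge0// => x _; rewrite lee_fin.
  by move=> x _; congr EFin; apply/eqP; apply: contra_notT nf => fx; exists x.
have [g0|] := pselect (exists x, g x != 0); last first.
  move=> ng; rewrite [X in (_ * X)%E]integral0_eq ?mule0.
    by rewrite mule_ge0// integral_ge0// => x _; rewrite lee_fin.
  by move=> x _; congr EFin; apply/eqP; apply: contra_notT ng => fx; exists x.
have [a a0 [fa01 fasup]] := sup_pos f f0M f0.
have [c c0 [gc01 gcsup]] := sup_pos g g0M g0.
pose s := Num.sqrt (a * c).
have ac0 : 0 < a * c by exact: mulr_gt0.
have s0 : 0 < s by rewrite sqrtr_gt0.
have s2 : s ^+ 2 = a * c by rewrite sqr_sqrtr// ltW.
have /(_ b) := @prekopa_leindler1_normalized (fun x => a^-1 * f x) (fun x => c^-1 * g x)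
  (fun x => s^-1 * h x).
have mM (k : R -> R) (r : R) : measurable_fun setT k -> measurable_fun setT (fun x => r * k x).
  by move=> mk; exact: measurable_funM.
move=> /(_ (mM _ _ mf) (mM _ _ mg) (mM _ _ mh) fa01 gc01).
have hh0 x : 0 <= s^-1 * h x by rewrite mulr_ge0// invr_ge0 ltW.
move=> /(_ hh0 fasup gcsup).
have supp (k : R -> R) (r x : R) : r^-1 * k x != 0 -> k x != 0.
  by apply: contra_neq => ->; rewrite mulr0.
move=> /(_ (fun x h => bf x (supp f a x h)) (fun x h => bg x (supp g c x h))).
have fgh' x y : a^-1 * f x * (c^-1 * g y) <= (s^-1 * h ((x + y) / 2)) ^+ 2.
  rewrite exprMn exprVn s2 invfM mulrACA ler_wpM2l ?fgh//.
  by rewrite mulr_ge0 ?invr_ge0 ?ltW.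
move=> /(_ fgh').
under eq_integral do rewrite EFinM.
under [X in (_ + X)%E]eq_integral do rewrite EFinM.
under [X in (_ <= _ * X)%E]eq_integral do rewrite EFinM.
have Zl (k : R -> R) (r : R) : measurable_fun setT k -> (forall x, 0 <= k x) -> 0 < r ->
  (\int[lebesgue]_x (r^-1%:E * (k x)%:E) = r^-1%:E * \int[lebesgue]_x (k x)%:E)%E.
  move=> mk k0 r0; rewrite ge0_integralZl//.
  - exact/measurable_EFinP.
  - by move=> x _; rewrite lee_fin.
  - by rewrite lee_fin invr_ge0 ltW.
have f_ge0 x : 0 <= f x by have /andP[] := f0M x.
have g_ge0 x : 0 <= g x by have /andP[] := g0M x.
rewrite (Zl f a)// (Zl g c)// (Zl h s)//.
have If : (0 <= \int[lebesgue]_x (f x)%:E)%E by apply: integral_ge0 => x _; rewrite lee_fin.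
have Ig : (0 <= \int[lebesgue]_x (g x)%:E)%E by apply: integral_ge0 => x _; rewrite lee_fin.
have Ih : (0 <= \int[lebesgue]_x (h x)%:E)%E by apply: integral_ge0 => x _; rewrite lee_fin.
suff key (F G H : \bar R) : (0 <= F -> 0 <= G -> 0 <= H ->
    a^-1%:E * F + c^-1%:E * G <= 2%:E * (s^-1%:E * H) -> F * G <= H * H)%E by exact: key.
have ai : 0 < a^-1 by rewrite invr_gt0.
have ci : 0 < c^-1 by rewrite invr_gt0.
have si : 0 < s^-1 by rewrite invr_gt0.
have sac : (s^-1) ^+ 2 = a^-1 * c^-1 by rewrite exprVn s2 invfM.
case: H => [H| |]//; last by move=> _ _ _ _; rewrite mulyy leey.
have noty (x y : R) (X Y : \bar R) : 0 < x -> (x%:E * +oo + X <= Y -> 0 <= X -> Y < +oo -> False)%E.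
  move=> x0; rewrite gt0_muley ?lte_fin// => hle X0 Yoo.
  by have := le_lt_trans (le_trans (leeDl _ X0) hle) Yoo; rewrite ltxx.
(* If the integral of [h] is finite, the additive inequality forces those of [f] and [g] to be
   finite. *)
have Hoo : (2%:E * (s^-1%:E * H%:E) < +oo)%E by rewrite -!EFinM ltry.
case: F => [F| |]// F0; last first.
  move=> G0 _ hle; exfalso; apply: (noty _ 0 _ _ ai hle _ Hoo).
  by rewrite mule_ge0// lee_fin ltW.
case: G => [G| |]// G0; last first.
  move=> _; rewrite addeC => hle; exfalso; apply: (noty _ 0 _ _ ci hle _ Hoo).
  by rewrite mule_ge0// lee_fin ltW.
move=> H0; rewrite -!EFinM -EFinD !lee_fin.
rewrite !lee_fin in F0 G0 H0; move: ai ci si sac; move: (a^-1) (c^-1) (s^-1) => x y z x0 y0 z0 zxy FGH.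
have u0 : 0 <= x * F by rewrite mulr_ge0// ltW.
have v0 : 0 <= y * G by rewrite mulr_ge0// ltW.
have w0 : 0 <= z * H by rewrite mulr_ge0// ltW.
have : (x * F) * (y * G) <= (z * H) * (z * H).
  move: (x * F) (y * G) (z * H) u0 v0 w0 FGH => u v w u0 v0 w0 uvw.
  have : 0 <= (u - v) ^+ 2 by exact: sqr_ge0.
  nra.
rewrite mulrACA [leRHS]mulrACA -expr2 zxy ler_pM2l// mulr_gt0//.
Qed.

(** Induction on the dimension: the integrals over the sections with fixed first coordinate satisfy
    the one-dimensional hypothesis. The bounds [M] and [b] keep them finite and of bounded support,
    so that [fine] loses nothing. *)
Lemma prekopa_leindler n (f g h : 'rV[R]_n -> R) (M b : R) :
  measurable_fun setT (f : BorelR R n -> R) -> measurable_fun setT (g : BorelR R n -> R) ->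
  measurable_fun setT (h : BorelR R n -> R) -> 0 <= b ->
  (forall x, 0 <= f x <= M) -> (forall x, 0 <= g x <= M) -> (forall x, 0 <= h x <= M) ->
  (forall x, f x != 0 -> forall i, `|x 0 i| <= b) ->
  (forall x, g x != 0 -> forall i, `|x 0 i| <= b) ->
  (forall x, h x != 0 -> forall i, `|x 0 i| <= b) ->
  (forall x y, f x * g y <= h (2^-1 *: (x + y)) ^+ 2) ->
  (\int[leb n]_x (f x)%:E * \int[leb n]_x (g x)%:E <=
   \int[leb n]_x (h x)%:E * \int[leb n]_x (h x)%:E)%E.
Proof.
move=> + + + b0; elim: n f g h M => [|n IH] f g h M mf mg mh f0M g0M h0M bf bg bh fgh.
  rewrite !integral_dirac//; try exact/measurable_EFinP.
  rewrite !diracT !mul1e -!EFinM lee_fin -expr2.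
  by have := fgh 0 0; rewrite addr0 scaler0.
have ge0 (k : 'rV[R]_n.+1 -> R) : (forall x, 0 <= k x <= M) -> forall x, 0 <= k x.
  by move=> k0M x; have /andP[] := k0M x.
have sM (k : 'rV[R]_n.+1 -> R) : measurable_fun setT (k : BorelR R n.+1 -> R) ->
    measurable_fun setT (fun p : (measurableTypeR R * BorelR R n)%type => (k (rv_cons p))%:E).
  move=> mk; apply/measurable_EFinP; apply: measurableT_comp mk _.
  exact: measurable_rv_cons.
have sM1 (k : 'rV[R]_n.+1 -> R) x : measurable_fun setT (k : BorelR R n.+1 -> R) ->
    measurable_fun setT (fun y : BorelR R n => k (rv_cons (x, y))).
  move=> mk; apply/measurable_EFinP.
  exact: (measurableT_comp (sM k mk) (pair1_measurable x)).
pose S (k : 'rV[R]_n.+1 -> R) (x : R) := (\int[leb n]_y (k (rv_cons (x, y)))%:E)%E.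
pose M' := M * (2 * b) ^+ n.
have S0 k x : (forall x, 0 <= k x <= M) -> (0 <= S k x)%E.
  by move=> k0M; apply: integral_ge0 => y _; rewrite lee_fin; exact: ge0.
have SM k x : measurable_fun setT (k : BorelR R n.+1 -> R) -> (forall x, 0 <= k x <= M) ->
   (forall x, k x != 0 -> forall i, `|x 0 i| <= b) -> (S k x <= M'%:E)%E.
  move=> mk k0M kb; apply: integral_le_cbox => //; first exact: sM1.
  by move=> y ky i; have := kb _ ky (lift ord0 i); rewrite rv_consS.
have Sfin k x : measurable_fun setT (k : BorelR R n.+1 -> R) -> (forall x, 0 <= k x <= M) ->
   (forall x, k x != 0 -> forall i, `|x 0 i| <= b) -> ((fine (S k x))%:E = S k x)%E.
  move=> mk k0M kb; rewrite fineK// fin_numElt (lt_le_trans _ (S0 _ _ k0M))// (le_lt_trans (SM _ x mk k0M kb)) ?ltry//.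
have intE k : measurable_fun setT (k : BorelR R n.+1 -> R) -> (forall x, 0 <= k x <= M) ->
   (forall x, k x != 0 -> forall i, `|x 0 i| <= b) ->
   (\int[leb n.+1]_x (k x)%:E = \int[lebesgue]_x (fine (S k x))%:E)%E.
  move=> mk k0M kb; rewrite lebS_integral.
  - by apply: eq_integral => x _; rewrite Sfin.
  - exact/measurable_EFinP.
  - by move=> x; rewrite lee_fin; exact: ge0.
rewrite !intE//; apply: (@prekopa_leindler1 _ _ _ M' b).
all: have mS k : measurable_fun setT (k : BorelR R n.+1 -> R) -> (forall x, 0 <= k x <= M) ->
    measurable_fun setT (fun x => fine (S k x)) by
  [move=> mk k0M; apply: measurableT_comp => //;
   apply: (measurable_fun_fubini_tonelli_F _ (sM k mk)) => p; rewrite lee_fin; exact: ge0|].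
all: have S0M k x : measurable_fun setT (k : BorelR R n.+1 -> R) -> (forall x, 0 <= k x <= M) ->
   (forall x, k x != 0 -> forall i, `|x 0 i| <= b) -> 0 <= fine (S k x) <= M' by
  [move=> mk k0M kb; rewrite fine_ge0 ?S0//= -lee_fin Sfin// SM|].
all: have Sb (k : 'rV[R]_n.+1 -> R) x : (forall x, k x != 0 -> forall i, `|x 0 i| <= b) -> fine (S k x) != 0 -> `|x| <= b by
  [move=> kb; rewrite leNgt; apply: contra_neqN => xb; rewrite /S integral0_eq// => y _;
   congr EFin; apply/eqP; apply: contraLR xb => /kb/(_ ord0); rewrite rv_cons0/= -leNgt|].
- exact: mS f mf f0M.
- exact: mS g mg g0M.
- exact: mS h mh h0M.
- by move=> x; exact: S0M f x mf f0M bf.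
- by move=> x; exact: S0M g x mg g0M bg.
- by move=> x; have /andP[] := S0M h x mh h0M bh.
- by move=> x; exact: Sb f x bf.
- by move=> x; exact: Sb g x bg.
(* For fixed first coordinates [x], [y] and their midpoint, the three sections satisfy the
   hypothesis one dimension lower. *)
move=> x y; rewrite -lee_fin EFinM expr2 EFinM !Sfin//.
apply: (IH _ _ _ M); try exact: sM1.
- by move=> z; exact: f0M.
- by move=> z; exact: g0M.
- by move=> z; exact: h0M.
- by move=> z kz i; have := bf _ kz (lift ord0 i); rewrite rv_consS.
- by move=> z kz i; have := bg _ kz (lift ord0 i); rewrite rv_consS.
- by move=> z kz i; have := bh _ kz (lift ord0 i); rewrite rv_consS.
move=> u v; apply: (le_trans (fgh _ _)); rewrite le_eqVlt; apply/orP; left; apply/eqP.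
congr (h _ ^+ 2); apply/rowP => i; case: (unliftP ord0 i) => [j|] ->.
  by rewrite rv_consS !mxE !liftK.
by rewrite rv_cons0 !mxE !unlift_none mulrC.
Qed.

(* For [x] in [A] and [y] in [- A], the midpoint of [x] and [y] lies in the ball of
   radius [r / 2]: apply Prekopa-Leindler to the indicators of [A] and [- A]. *)
Lemma isodiametric n (A : set 'rV[R]_n) (r : R) :
  measurable (A : set (BorelR R n)) -> 0 <= r ->
  (forall x y, A x -> A y -> enorm (x - y) <= r) ->
  (leb n A <= (unit_ball_vol n * (r / 2) ^+ n)%:E)%E.
Proof.
move=> mA r0 Ar.
have [->|/set0P[a Aa]] := eqVneq A set0.
  by rewrite measure0 -leb_cball_ge0// divr_ge0.
have r20 : 0 <= r / 2 by rewrite divr_ge0.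
rewrite -leb_cball_ge0//.
pose A' : set (BorelR R n) := [set x | A (- (x : 'rV[R]_n))].
have A'E : A' = (fun x : BorelR R n => (-1) *: (x : 'rV[R]_n) : BorelR R n) @^-1` A.
  by apply/seteqP; split=> x; rewrite /A'/= scaleN1r.
have mA' : measurable A'.
  rewrite A'E -[X in measurable X]setTI.
  by apply: continuous_Borel mA => //; exact: scaler_continuous.
have lA' : leb n A' = leb n A.
  by rewrite A'E leb_scale ?oppr_eq0//; rewrite normrN1 expr1n invr1 mul1e.
pose b := enorm a + r.
have b0 : 0 <= b by rewrite addr_ge0// enorm_ge0.
have Ab x : A x -> forall i, `|x 0 i| <= b.
  move=> Ax i; rewrite (le_trans (coord_le_enorm _ _))//.
  by rewrite -[x](subrK a) (le_trans (ler_enormD _ _))// addrC lerD2l Ar.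
have ind (B : set (BorelR R n)) : measurable B -> leb n B = (\int[leb n]_x (\1_B x)%:E)%E.
  by move=> mB; rewrite integral_indic// setIT.
have mcb : measurable (@cball R n (r / 2)) by exact: measurable_cball.
have i01 (B : set 'rV[R]_n) x : 0 <= (\1_B x : R) <= 1 by rewrite indicE; case: (_ \in _); rewrite ?lexx ?ler01.
have ineq0 (B : set 'rV[R]_n) x : (\1_B x : R) != 0 -> B x.
  by rewrite indicE; case: (boolP (x \in B)) => [/set_mem|_]//; rewrite eqxx.
have hA : (leb n A * leb n A <= leb n (cball (r / 2)) * leb n (cball (r / 2)))%E.
  rewrite -{2}lA' !ind//.
  apply: (@prekopa_leindler n \1_A \1_A' \1_(@cball R n (r / 2)) 1 b) => //; try exact: measurable_indic.
  - by move=> x /ineq0; exact: Ab.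
  - by move=> x /ineq0 /Ab + i => /(_ i); rewrite mxE normrN.
  - move=> x /ineq0 xr i; rewrite (le_trans (coord_le_enorm _ _))// (le_trans xr)// /b.
    by rewrite ler_wpDl ?enorm_ge0//; lra.
  - move=> x y; rewrite !indicE.
    case: (boolP (x \in A)) => [/set_mem Ax|_]; last by rewrite mul0r sqr_ge0.
    case: (boolP (y \in A')) => [/set_mem Ay|_]; last by rewrite mulr0 sqr_ge0.
    rewrite mem_set ?expr1n ?mulr1// /cball/= enormZ ger0_norm ?invr_ge0//.
    by rewrite mulrC ler_pM2r ?invr_gt0//; have := Ar _ _ Ax Ay; rewrite opprK.
move: hA; rewrite (leb_cball_ge0 _ r20); have := measure_ge0 (leb n) A.
have := measure_ge0 (leb n) (cball (r / 2)); rewrite /= (leb_cball_ge0 _ r20).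
case: (leb n A) => [v| |].
- by rewrite -!EFinM !lee_fin => c0 v0; rewrite -!expr2 ler_sqr.
- by move=> _ _; rewrite mulyy -EFinM leye_eq.
- by move=> _; rewrite leeNy_eq.
Qed.

End prekopa_leindler.

(** * Hausdorff measure *)

Section hausdorff_basics.
Context {R : realType}.

Lemma unit_ball_vol_gt0 d : 0 < @unit_ball_vol R d.
Proof.
suff H k : 0 < @unit_ball_vol R k /\ 0 < @unit_ball_vol R k.+1 by have [] := H d.
elim: k => [|k [IH1 IH2]]; split=> //=.
by rewrite mulr_gt0// divr_gt0// mulr_gt0// pi_gt0.
Qed.

Lemma ediam_le n (C : set 'rV[R]_n) (r : R) :
  (ediam C <= r%:E)%E <-> (forall x y, C x -> C y -> enorm (x - y) <= r).
Proof.
split=> [Cr x y Cx Cy|Cr].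
  by rewrite -lee_fin (le_trans _ Cr)//; apply: ereal_sup_ubound; exists x => //; exists y.
by apply: ge_ereal_sup => _ [x Cx [y Cy <-]]; rewrite lee_fin Cr.
Qed.

Lemma hterm_ge0 d n (C : set 'rV[R]_n) : (0 <= hterm d C)%E.
Proof.
rewrite /hterm; case: ifPn => // C0; rewrite lee_fin.
have [x Cx] := (set0P _).1 C0.
rewrite mulr_ge0 ?(ltW (unit_ball_vol_gt0 _))// exprn_ge0// divr_ge0//.
apply: fine_ge0; apply: (@le_trans _ _ (enorm (x - x))%:E).
  by rewrite subrr enorm0.
by apply: ereal_sup_ubound; exists x => //; exists x.
Qed.

Lemma ediam_fin n (C : set 'rV[R]_n) (delta : R) : C !=set0 -> (ediam C <= delta%:E)%E ->
  exists r : R, [/\ ediam C = r%:E, 0 <= r & r <= delta].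
Proof.
move=> [x Cx] Cd.
have C0 : (0 <= ediam C)%E.
  apply: (@le_trans _ _ (enorm (x - x))%:E); first by rewrite subrr enorm0.
  by apply: ereal_sup_ubound; exists x => //; exists x.
have Cfin : ediam C \is a fin_num.
  by rewrite ge0_fin_numE// (le_lt_trans Cd)// ltry.
exists (fine (ediam C)); split; first by rewrite fineK.
  exact: fine_ge0.
by rewrite -lee_fin fineK.
Qed.

Lemma hterm_le d n (C : set 'rV[R]_n) (r : R) : 0 <= r ->
  (forall x y, C x -> C y -> enorm (x - y) <= r) ->
  (hterm d C <= (unit_ball_vol d * (r / 2) ^+ d)%:E)%E.
Proof.
move=> r0 /ediam_le Cr; rewrite /hterm; case: ifPn => [_|C0].
  by rewrite lee_fin mulr_ge0 ?(ltW (unit_ball_vol_gt0 _))// exprn_ge0// divr_ge0.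
have [s [-> s0 sr]] := ediam_fin ((set0P _).1 C0) Cr.
by rewrite lee_fin/= ler_pM2l ?unit_ball_vol_gt0// lerXn2r ?nnegrE ?divr_ge0// ler_pM2r.
Qed.

Lemma hausdorff_delta_ge0 d n delta (A : set 'rV[R]_n) : (0 <= hausdorff_delta d delta A)%E.
Proof.
apply: le_ereal_inf_tmp => _ [C _ <-].
by apply: nneseries_ge0 => i _ _; exact: hterm_ge0.
Qed.

Lemma hausdorff_delta_le d n (delta : R) (A : set 'rV[R]_n) : 0 < delta ->
  (hausdorff_delta d delta A <= hausdorff d A)%E.
Proof. by move=> d0; apply: ereal_sup_ubound; exists delta. Qed.

Lemma hausdorff_delta_image d m n (f : 'rV[R]_m -> 'rV[R]_n) (A : set 'rV[R]_m) (l delta : R) :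
  0 < l -> (forall x y, A x -> A y -> enorm (f x - f y) <= l * enorm (x - y)) ->
  (hausdorff_delta d (l * delta) (f @` A) <= (l ^+ d)%:E * hausdorff_delta d delta A)%E.
Proof.
move=> l0 fl; rewrite muleC -lee_pdivrMr ?exprn_gt0//.
apply: le_ereal_inf_tmp => _ [C [AC Cd] <-]; rewrite lee_pdivrMr ?exprn_gt0//.
rewrite muleC -nneseriesZl; last by move=> i _; exact: hterm_ge0.
(* The covering sets are cut down to [A], where alone [f] is Lipschitz. *)
apply: (@le_trans _ _ (\sum_(0 <= i <oo) hterm d (f @` (C i `&` A)))%E).
  apply: ereal_inf_lbound; exists (fun i => f @` (C i `&` A)) => //; split.
    by move=> _ [x Ax <-]; have [i _ Ci] := AC x Ax; exists i => //; exists x.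
  move=> i; apply/ediam_le => _ _ [x [Cx Ax] <-] [y [Cy Ay] <-].
  rewrite (le_trans (fl _ _ Ax Ay))// ler_pM2l//.
  by have /ediam_le := Cd i; apply.
apply: lee_nneseries => [i _|i _]; first by move=> _; exact: hterm_ge0.
have [Ci0|/set0P Ci0] := eqVneq (C i) set0.
  by rewrite Ci0 set0I image_set0 /hterm !eqxx mule0.
have [r [Cr r0 rd]] := ediam_fin Ci0 (Cd i).
rewrite {2}/hterm ifF; last by apply/negbTE; apply/set0P.
rewrite Cr -EFinM [fine _]/=.
have -> : l ^+ d * (unit_ball_vol d * (r / 2) ^+ d) = unit_ball_vol d * (l * r / 2) ^+ d.
  by rewrite mulrCA -exprMn mulrA.
apply: hterm_le; first by rewrite mulr_ge0// ltW.
move=> _ _ [x [Cx Ax] <-] [y [Cy Ay] <-].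
rewrite (le_trans (fl _ _ Ax Ay))// ler_pM2l//.
have /ediam_le : (ediam (C i) <= r%:E)%E by rewrite Cr.
exact.
Qed.

Lemma hausdorff_image d m n (f : 'rV[R]_m -> 'rV[R]_n) (A : set 'rV[R]_m) (l : R) :
  0 < l -> (forall x y, A x -> A y -> enorm (f x - f y) <= l * enorm (x - y)) ->
  (hausdorff d (f @` A) <= (l ^+ d)%:E * hausdorff d A)%E.
Proof.
move=> l0 fl; apply: ge_ereal_sup => _ [delta /= d0 <-].
have -> : delta = l * (delta / l) by rewrite mulrC divfK// gt_eqF.
apply: (le_trans (hausdorff_delta_image _ _ l0 fl)).
rewrite lee_pmul2l ?lte_fin ?exprn_gt0//; apply: hausdorff_delta_le.
by rewrite divr_gt0.
Qed.

Lemma hausdorff_isometry d m n (f : 'rV[R]_m -> 'rV[R]_n) (g : 'rV[R]_n -> 'rV[R]_m) :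
  cancel f g -> (forall x y, enorm (f x - f y) <= enorm (x - y)) ->
  (forall x y, enorm (g x - g y) <= enorm (x - y)) ->
  forall A, hausdorff d (f @` A) = hausdorff d A.
Proof.
move=> fK f1 g1 A; apply/eqP; rewrite eq_le; apply/andP; split.
  rewrite -[leRHS]mul1e -(expr1n _ d); apply: hausdorff_image => // x y _ _.
  by rewrite mul1r.
rewrite -{1}(_ : g @` (f @` A) = A); last first.
  rewrite image_comp; apply/seteqP; split=> [_ [x Ax <-]|x Ax]; first by rewrite /= fK.
  by exists x => //=; rewrite fK.
rewrite -[leRHS]mul1e -(expr1n _ d); apply: hausdorff_image => // x y _ _.
by rewrite mul1r.
Qed.

Lemma hausdorff_delta_subset d n (delta : R) (A B : set 'rV[R]_n) : A `<=` B ->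
  (hausdorff_delta d delta A <= hausdorff_delta d delta B)%E.
Proof.
move=> AB; apply: le_ereal_inf => _ [C [BC Cd] <-]; exists C => //.
by split=> //; exact: subset_trans BC.
Qed.

Lemma hausdorff_delta_set0 d n (delta : R) : 0 < delta -> hausdorff_delta d delta (set0 : set 'rV[R]_n) = 0%E.
Proof.
move=> d0; apply/eqP; rewrite eq_le hausdorff_delta_ge0 andbT.
apply: ereal_inf_lbound; exists (fun=> set0).
  by split=> // i; apply/ediam_le.
by rewrite eseries0// => i _ _; rewrite /hterm eqxx.
Qed.

Lemma hausdorff_deltaU d n (delta : R) (A B : set 'rV[R]_n) :
  (hausdorff_delta d delta (A `|` B) <= hausdorff_delta d delta A + hausdorff_delta d delta B)%E.
Proof.
have [/eqP hA|] := boolP (hausdorff_delta d delta A == +oo%E).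
  by rewrite hA addye ?leey// gt_eqF// (lt_le_trans _ (hausdorff_delta_ge0 _ _ _)).
have [/eqP hB|] := boolP (hausdorff_delta d delta B == +oo%E).
  by rewrite hB addey ?leey// gt_eqF// (lt_le_trans _ (hausdorff_delta_ge0 _ _ _)).
rewrite -!ltey => hB hA.
have hAf : hausdorff_delta d delta A \is a fin_num by rewrite ge0_fin_numE ?hausdorff_delta_ge0.
have hBf : hausdorff_delta d delta B \is a fin_num by rewrite ge0_fin_numE ?hausdorff_delta_ge0.
apply/lee_addgt0Pr => e e0.
have e20 : 0 < e / 2 by rewrite divr_gt0.
have [_ [C1 [AC1 C1d] <-] C1e] := lb_ereal_inf_adherent e20 hAf.
have [_ [C2 [BC2 C2d] <-] C2e] := lb_ereal_inf_adherent e20 hBf.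
(* The two covers are interleaved into a single sequence. *)
pose C i := if odd i then C2 i./2 else C1 i./2.
apply: (@le_trans _ _ (\sum_(0 <= i <oo) hterm d (C i))%E).
  apply: ereal_inf_lbound; exists C => //; split; last by move=> i; rewrite /C; case: ifP.
  move=> x [/AC1[i _ C1i]|/BC2[i _ C2i]].
    by exists i.*2 => //; rewrite /C odd_double doubleK.
  by exists i.*2.+1 => //; rewrite /C /= odd_double /= uphalf_double.
have sumC k : (\sum_(0 <= i < k.*2) hterm d (C i) =
    \sum_(0 <= i < k) hterm d (C1 i) + \sum_(0 <= i < k) hterm d (C2 i))%E.
  elim: k => [|k IH]; first by rewrite !big_nil adde0.
  rewrite doubleS !big_nat_recr//= IH /C /= odd_double /= doubleK uphalf_double -!addeA.
  by congr (_ + _)%E; rewrite addeCA.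
have cC : cvgn (fun k => \sum_(0 <= i < k) hterm d (C i))%E.
  by apply: is_cvg_nneseries => i _ _; exact: hterm_ge0.
apply: (lime_le cC); apply: nearW => k.
apply: (@le_trans _ _ (\sum_(0 <= i < k.*2) hterm d (C i))%E).
  apply: lee_sum_nneg_natr => //; last by rewrite -addnn leq_addr.
  by move=> i _ _; exact: hterm_ge0.
rewrite sumC [e]splitr EFinD addeACA; apply: leeD.
  apply: le_trans (ltW C1e); apply: nneseries_lim_ge => i _ _; exact: hterm_ge0.
apply: le_trans (ltW C2e); apply: nneseries_lim_ge => i _ _; exact: hterm_ge0.
Qed.

Lemma hausdorff_delta_bigcup d n (delta : R) (I : eqType) (s : seq I) (A : I -> set 'rV[R]_n) :
  0 < delta ->
  (hausdorff_delta d delta (\big[setU/set0]_(i <- s) A i) <= \sum_(i <- s) hausdorff_delta d delta (A i))%E.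
Proof.
move=> d0; elim: s => [|i s IH]; first by rewrite !big_nil hausdorff_delta_set0.
by rewrite !big_cons (le_trans (hausdorff_deltaU _ _ _ _))// leeD2l.
Qed.

(** The cover is completed with empty sets; these cost nothing even for [d = 0], because [hterm]
    treats them apart. *)
Lemma hausdorff_delta_single d n (delta r : R) (A : set 'rV[R]_n) : 0 < delta -> 0 <= r -> r <= delta ->
  (forall x y, A x -> A y -> enorm (x - y) <= r) ->
  (hausdorff_delta d delta A <= (unit_ball_vol d * (r / 2) ^+ d)%:E)%E.
Proof.
move=> d0 r0 rd Ar; pose C i : set 'rV[R]_n := if i is 0%N then A else set0.
apply: (@le_trans _ _ (\sum_(0 <= i <oo) hterm d (C i))%E).
  apply: ereal_inf_lbound; exists C => //; split.
    by move=> x Ax; exists 0%N.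
  by case=> [|i]; apply/ediam_le => // x y Ax Ay; rewrite (le_trans (Ar _ _ Ax Ay)).
rewrite (nneseries_split _ 1)//; last by move=> i _; exact: hterm_ge0.
rewrite big_nat1 eseries0 ?adde0; last by move=> [|i]// _ _; rewrite /hterm eqxx.
exact: hterm_le.
Qed.

(** The sets of a cover are arbitrary. Their closures are Borel and obey the same diameter bound,
    passed to the closure in one variable and then in the other, so the isodiametric inequality
    applies to each. *)
Lemma hausdorff_ge_leb n (A : set 'rV[R]_n) : measurable (A : set (BorelR R n)) ->
  (leb n A <= hausdorff n A)%E.
Proof.
move=> mA; apply: le_trans (hausdorff_delta_le _ _ (ltr01 : 0 < 1 :> R)).
apply: le_ereal_inf_tmp => _ [C [AC Cd] <-].
have mC i : measurable (closure (C i) : set (BorelR R n)).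
  by apply: closed_Borel; exact: closed_closure.
apply: (@le_trans _ _ (\sum_(0 <= i <oo) leb n (closure (C i)))%E).
  apply: measure_sigma_subadditive => //.
  by move=> x /AC [i _ Ci]; exists i => //; exact: subset_closure.
apply: lee_nneseries => [//|i _].
have [->|/set0P Ci0] := eqVneq (C i) set0.
  by rewrite closure0 measure0 hterm_ge0.
have [r [Cr r0 rd]] := ediam_fin Ci0 (Cd i).
rewrite /hterm ifF; last by apply/negbTE; apply/set0P.
rewrite Cr; apply: isodiametric => //.
have {Cr} Cr : forall x y, C i x -> C i y -> enorm (x - y) <= r.
  by apply/ediam_le; rewrite Cr.
have cl (x : 'rV[R]_n) : closed [set y | enorm (x - y) <= r].
  rewrite (_ : [set y | _] = (fun y => enorm (x - y)) @^-1` [set t | t <= r])//.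
  apply: closed_comp; last exact: closed_le.
  move=> y _; apply: (@continuous_comp 'rV[R]_n 'rV[R]_n R^o (fun y => x - y) (@enorm R n) y).
    by apply: continuousB; [exact: cst_continuous|exact: cvg_id].
  exact: enorm_continuous.
have C1 x : C i x -> forall y, closure (C i) y -> enorm (x - y) <= r.
  move=> Cx; have := cl x; move/closure_id; rewrite /= => E y.
  have sub : C i `<=` [set y | enorm (x - y) <= r] by move=> z; exact: Cr.
  by move=> /(closure_subset sub); rewrite -E.
move=> x y Cx Cy; have := cl y => /closure_id E.
have sub : C i `<=` [set z | enorm (y - z) <= r].
  by move=> z Cz /=; rewrite enorm_distC; exact: C1.
by have := closure_subset sub Cx; rewrite -E /= enorm_distC.
Qed.

End hausdorff_basics.

(** * Equality of H^d and Lebesgue measure on R^d *)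

Section hausdorff_lebesgue.
Context {R : realType}.

Lemma measurable_rv_shift n (v : 'rV[R]_n) :
  measurable_fun setT (fun u : BorelR R n => v + (u : 'rV[R]_n) : BorelR R n).
Proof.
apply: continuous_Borel => u; apply: continuousD; [exact: cst_continuous|exact: cvg_id].
Qed.

(* Uniqueness of Haar measure: [nu A * leb B] is the mass, for [nu x leb], of
   the pairs [(x, y)] with [x] in [A] and [y - x] in [B]; integrating in the
   other order gives [nu (- B) * leb A]. *)
Lemma translation_invariant_leb n (nu : {sigma_finite_measure set (BorelR R n) -> \bar R}) :
  (forall (v : 'rV[R]_n) (A : set (BorelR R n)), measurable A ->
    nu ((fun u : BorelR R n => v + (u : 'rV[R]_n) : BorelR R n) @^-1` A) = nu A) ->
  forall A B : set (BorelR R n), measurable A -> measurable B ->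
  (nu A * leb n B = nu ((fun u : BorelR R n => (- (u : 'rV[R]_n))%R : BorelR R n) @^-1` B) * leb n A)%E.
Proof.
move=> nuT A B mA mB.
have mN : measurable_fun setT (fun u : BorelR R n => - (u : 'rV[R]_n) : BorelR R n).
  by apply: continuous_Borel => u; apply: continuousN; exact: cvg_id.
have mD : measurable_fun setT (fun p : (BorelR R n * BorelR R n)%type =>
    (p.1 : 'rV[R]_n) + (p.2 : 'rV[R]_n) : BorelR R n).
  apply: measurable_fun_row => i; under eq_fun do rewrite mxE.
  apply: measurable_funD.
    exact: measurableT_comp (measurable_coord i) measurable_fst.
  exact: measurableT_comp (measurable_coord i) measurable_snd.
have mNp (C : set (BorelR R n)) : measurable C ->
    measurable ((fun u : BorelR R n => - (u : 'rV[R]_n) : BorelR R n) @^-1` C).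
  by move=> mC; rewrite -[X in measurable X]setTI; exact: mN.
have mTp (v : 'rV[R]_n) (C : set (BorelR R n)) : measurable C ->
    measurable ((fun u : BorelR R n => v + (u : 'rV[R]_n) : BorelR R n) @^-1` C).
  by move=> mC; rewrite -[X in measurable X]setTI; exact: measurable_rv_shift.
have indE (m : {measure set (BorelR R n) -> \bar R}) (k : R) (C : set (BorelR R n)) : 0 <= k -> measurable C ->
    (k%:E * m C = \int[m]_y (k * \1_C y)%:E)%E.
  move=> k0 mC; under eq_integral do rewrite EFinM.
  rewrite ge0_integralZl//; first by rewrite integral_indic// setIT.
  by apply/measurable_EFinP; exact: measurable_indic.
have indEr (m : {measure set (BorelR R n) -> \bar R}) (C : set (BorelR R n)) (l : \bar R) :
    measurable C -> (0 <= l)%E -> (m C * l = \int[m]_y ((\1_C y)%:E * l))%E.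
  move=> mC l0; rewrite ge0_integralZr//; first by rewrite integral_indic// setIT.
  by apply/measurable_EFinP; exact: measurable_indic.
have mI (C : set (BorelR R n)) (k : (BorelR R n * BorelR R n)%type -> BorelR R n) :
    measurable C -> measurable_fun setT k -> measurable_fun setT (fun p => \1_C (k p) : R).
  by move=> mC mk; apply: measurableT_comp mk; exact: measurable_indic.
pose f (p : BorelR R n * BorelR R n) : \bar R :=
  (\1_A p.1 * \1_B ((p.2 : 'rV[R]_n) - (p.1 : 'rV[R]_n) : BorelR R n))%:E.
have mf : measurable_fun setT f.
  apply/measurable_EFinP; apply: measurable_funM.
    by apply: mI => //; exact: measurable_fst.
  apply: mI => //; have mP : measurable_fun setT (fun p : (BorelR R n * BorelR R n)%type =>
      (p.2, - (p.1 : 'rV[R]_n) : BorelR R n)).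
    apply: measurable_fun_pair; first exact: measurable_snd.
    exact: (measurableT_comp mN measurable_fst).
  exact: (measurableT_comp mD mP).
have f0 p : (0 <= f p)%E by rewrite lee_fin mulr_ge0.
transitivity (\int[nu]_x \int[leb n]_y f (x, y))%E.
  rewrite indEr//; apply: eq_integral => x _.
  rewrite -(leb_shift (- (x : 'rV[R]_n)) mB) indE//; last exact: mTp.
  apply: eq_integral => y _; rewrite /f /= !indicE; congr (_ * _%:R)%:E.
  by congr nat_of_bool; apply/idP/idP; rewrite !inE /= addrC.
rewrite fubini_tonelli//.
pose g (p : BorelR R n * BorelR R n) : \bar R :=
  (\1_A ((p.1 : 'rV[R]_n) + (p.2 : 'rV[R]_n) : BorelR R n) *
   \1_B (- (p.1 : 'rV[R]_n) : BorelR R n))%:E.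
have mg : measurable_fun setT g.
  apply/measurable_EFinP; apply: measurable_funM.
    exact: mI.
  by apply: mI => //; exact: (measurableT_comp mN measurable_fst).
have g0 p : (0 <= g p)%E by rewrite lee_fin mulr_ge0.
transitivity (\int[leb n]_y \int[nu]_x g (x, y))%E.
  apply: eq_integral => y _.
  pose E1 : set (BorelR R n) := A `&` ((fun u : BorelR R n => - (u : 'rV[R]_n) : BorelR R n) @^-1`
     ((fun u : BorelR R n => (y : 'rV[R]_n) + (u : 'rV[R]_n) : BorelR R n) @^-1` B)).
  have mE1 : measurable E1 by apply: measurableI => //; apply: mNp; exact: mTp.
  have -> : (\int[nu]_x f (x, y) = nu E1)%E.
    rewrite -[RHS]mul1e indE//; apply: eq_integral => x _.
    by rewrite /f /= /E1 indicI mul1r /=; congr (_ * _)%:E; rewrite !indicE; congr (nat_of_bool _)%:R;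
      apply/idP/idP; rewrite !inE.
  rewrite -(nuT y)// -[LHS]mul1e indE//; last exact: mTp.
  apply: eq_integral => x _; rewrite mul1r /g/= !indicE -natrM mulnb; congr (nat_of_bool _)%:R%:E.
  apply/idP/andP; rewrite !inE /E1 /=.
    by move=> [Ayx]; rewrite opprD addrA subrr add0r addrC.
  by rewrite opprD addrA subrr add0r addrC => -[].
rewrite -fubini_tonelli// indEr//; last exact: mNp.
apply: eq_integral => x _; rewrite -(leb_shift (x : 'rV[R]_n) mA) indE//; last exact: mTp.
by apply: eq_integral => y _; rewrite /g /= mulrC.
Qed.

Lemma measurable_mulmx m n (M : 'M[R]_(m, n)) :
  measurable_fun setT (fun y : BorelR R m => (y : 'rV[R]_m) *m M : BorelR R n).
Proof.
apply: measurable_fun_row => j; under eq_fun do rewrite mxE.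
apply: measurable_sum => i; apply: measurable_funM => //; exact: measurable_coord.
Qed.

Definition ecube n (r : R) : set 'rV[R]_n := cbox 0 (const_mx r).

(** Translation and subadditivity at a fixed scale [delta]. The scale is kept because a cover by one
    ball bounds [hausdorff_delta] only, not [hausdorff]. *)
Lemma unit_cube_cover n N (delta w : R) : 0 < delta ->
  (hausdorff_delta n delta (@ecube n N.+1%:R^-1%R) <= w%:E)%E ->
  (hausdorff_delta n delta (@ecube n 1) <= ((N.+1 ^ n)%:R * w)%:E)%E.
Proof.
move=> d0 cw; pose cube := @ecube n N.+1%:R^-1.
pose v (f : {ffun 'I_n -> 'I_N.+1}) : 'rV[R]_n := \row_i ((f i)%:R / N.+1%:R).
have N0 : 0 < N.+1%:R :> R by rewrite ltr0n.
apply: (@le_trans _ _ (hausdorff_delta n delta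
   (\big[setU/set0]_(f <- index_enum {ffun 'I_n -> 'I_N.+1}) ((fun u => v f + u) @` cube)))).
  apply: hausdorff_delta_subset => x x01.
  have x01' i : 0 <= x 0 i <= 1 by have := x01 i; rewrite !mxE.
  have /choice[k kP] : forall i, exists k : 'I_N.+1, k%:R / N.+1%:R <= x 0 i <= k%:R / N.+1%:R + N.+1%:R^-1.
    have E (k : nat) : k%:R / N.+1%:R + N.+1%:R^-1 = k.+1%:R / N.+1%:R :> R.
      by rewrite -[in RHS]natr1 mulrDl mul1r.
    move=> i; have /andP[x0 x1] := x01' i.
    have xN0 : 0 <= x 0 i * N.+1%:R by rewrite mulr_ge0// ltW.
    have /andP[t1 t2] := truncn_itv xN0.
    have [tN|tN] := ltnP (Num.trunc (x 0 i * N.+1%:R)) N.+1.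
      exists (Ordinal tN); rewrite /= E ler_pdivrMr// ler_pdivlMr// t1.
      by rewrite ltW.
    (* Truncation gives N + 1 only on the face where the coordinate is 1; that face goes to the last
       cell. *)
    exists ord_max; rewrite /= E divff ?gt_eqF// x1 andbT ler_pdivrMr//.
    by apply: le_trans t1; rewrite ler_nat; exact: ltnW.
  rewrite -bigcup_seq; exists [ffun i => k i]; first by rewrite /= mem_index_enum.
  exists (x - v [ffun i => k i]); last by rewrite addrC subrK.
  by move=> i; have := kP i; rewrite !mxE ffunE subr_ge0 lerBlDl.
apply: (le_trans (hausdorff_delta_bigcup _ _ _ d0)).
apply: (@le_trans _ _ (\sum_(f <- index_enum {ffun 'I_n -> 'I_N.+1}) w%:E)%E).
  apply: lee_sum => f _; apply: le_trans cw.
  have iso x y : cube x -> cube y -> enorm (v f + x - (v f + y)) <= 1 * enorm (x - y).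
    by rewrite mul1r opprD addrACA subrr add0r.
  by have := hausdorff_delta_image n delta ltr01 iso; rewrite expr1n mul1e mul1r.
rewrite sumEFin lee_fin (eq_bigl (mem {: {ffun 'I_n -> 'I_N.+1}}))//.
by rewrite sumr_const card_ffun !card_ord mulr_natl.
Qed.

Section hausdorff_leb.
Variables (D d : nat) (hdD : (d <= D)%N) (mu : {measure set (BorelR R D) -> \bar R}).
Hypothesis hmu : forall A : set (BorelR R D), measurable A -> mu A = hausdorff d A.

Let L : 'M[R]_(d, D) := pid_mx d.

Let LL : L *m L^T = 1%:M.
Proof. by rewrite tr_pid_mx pid_mx_id// pid_mx_1. Qed.

Let prj (y : 'rV[R]_D) : 'rV[R]_d := y *m L^T.

Let mprj : measurable_fun setT (prj : BorelR R D -> BorelR R d).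
Proof. exact: measurable_mulmx. Qed.

(* [hmu] only gives H^d on subsets of R^D: [nu] is its restriction to the coordinate
   d-plane [F], read on R^d. *)
Let F : set (BorelR R D) := [set y | enorm ((y : 'rV[R]_D) - prj y *m L) <= 0].

Let mF : measurable F.
Proof.
have mf : measurable_fun setT (fun y : BorelR R D => enorm ((y : 'rV[R]_D) - prj y *m L)).
  apply: (measurableT_comp (continuous_Borel_real (@enorm_continuous R D))).
  apply: measurable_fun_row => i; under eq_fun do rewrite !mxE.
  apply: measurable_funB; first exact: measurable_coord.
  apply: measurable_sum => j; apply: measurable_funM => //.
  exact: (measurableT_comp (measurable_coord j) mprj).
rewrite (_ : F = (fun y : BorelR R D => enorm ((y : 'rV[R]_D) - prj y *m L)) @^-1` `]-oo, 0]); last first.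
  by rewrite preimage_itvNyc.
by rewrite -[X in measurable X]setTI; exact: mf.
Qed.

Let nu : {measure set (BorelR R d) -> \bar R} := pushm (mrestr mu mF) mprj.

Let nuE (A : set 'rV[R]_d) : measurable (A : set (BorelR R d)) -> nu A = hausdorff d A.
Proof.
move=> mA; rewrite /nu /= /pushm /pushforward /mrestr.
rewrite hmu; last by apply: measurableI => //; rewrite -[X in measurable X]setTI; exact: mprj.
rewrite (_ : _ `&` _ = (fun u : 'rV[R]_d => u *m L) @` A); last first.
  apply/seteqP; split=> [y [Ay yF]|_ [u Au <-]].
    exists (prj y) => //; apply/eqP; rewrite eq_sym -subr_eq0; apply/eqP/enorm0_eq0.
    by apply/eqP; rewrite eq_le yF enorm_ge0.
  by rewrite /F /prj /= -mulmxA LL mulmx1 subrr enorm0.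
apply: (@hausdorff_isometry _ _ _ _ _ prj).
- by move=> u; rewrite /prj -mulmxA LL mulmx1.
- by move=> x y; rewrite -mulmxBl enorm_isometry.
- by move=> x y; rewrite /prj -mulmxBl enorm_proj.
Qed.

Let nu_shift (v : 'rV[R]_d) (A : set (BorelR R d)) : measurable A ->
  nu ((fun u : BorelR R d => v + (u : 'rV[R]_d) : BorelR R d) @^-1` A) = nu A.
Proof.
move=> mA; rewrite !nuE//; last by rewrite -[X in measurable X]setTI; exact: measurable_rv_shift.
rewrite -(@hausdorff_isometry _ _ _ _ (fun u => v + u) (fun u => u - v)).
- congr (hausdorff d _); apply/seteqP; split=> [_ [u Au <-]//|u Au].
  by exists (u - v); rewrite /= addrC subrK.
- by move=> u; rewrite addrC addKr.
- by move=> x y; rewrite opprD addrACA subrr add0r.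
- by move=> x y; rewrite opprD addrACA subrr addr0.
Qed.

Let measurable_ecube r : measurable (@ecube d r : set (BorelR R d)).
Proof. exact: measurable_cbox. Qed.

Let ecube_diam r x y : @ecube d r x -> @ecube d r y -> enorm (x - y) <= d%:R * r.
Proof.
move=> xr yr; rewrite (le_trans (enorm_le_sum _))// (@le_trans _ _ (\sum_(i < d) r))//.
  apply: ler_sum => i _; have := xr i; have := yr i; rewrite !mxE => /andP[? ?] /andP[? ?].
  by rewrite ler_norml; apply/andP; split; lra.
by rewrite sumr_const card_ord mulr_natl.
Qed.

Let exN (e : R) : 0 < e -> exists N : nat, N.+1%:R^-1 <= e.
Proof.
move=> e0; exists (Num.trunc e^-1); rewrite -[leRHS]invrK lef_pV2 ?posrE ?invr_gt0//.
by rewrite ltW// truncnS_gt.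
Qed.

Let natM (N : nat) (a : R) : (N.+1 ^ d)%:R * (a * N.+1%:R^-1) ^+ d = a ^+ d.
Proof. by rewrite natrX exprMn mulrCA -exprMn divff ?expr1n ?mulr1// gt_eqF. Qed.

(** Cells of side 1/(N+1) have diameter at most d/(N+1), so the total cost of covering each by
    itself is independent of N, hence bounded uniformly in the scale. *)
Let nu_cube_fin : (nu (@ecube d 1) < +oo)%E.
Proof.
rewrite nuE//; apply: (@le_lt_trans _ _ (unit_ball_vol d * (d%:R / 2) ^+ d)%:E); last exact: ltry.
apply: ge_ereal_sup => _ [delta /= d0 <-].
have [N Nd] := exN (divr_gt0 d0 (ltr0Sn R d)).
have Nd' : d%:R * N.+1%:R^-1 <= delta.
  rewrite (@le_trans _ _ (d.+1%:R * (delta / d.+1%:R)))//.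
    by rewrite ler_pM// ?invr_ge0// ler_nat.
  by rewrite mulrC divfK// gt_eqF.
have := @hausdorff_delta_single _ d d delta _ (@ecube d N.+1%:R^-1) d0 _ Nd' (@ecube_diam _).
rewrite mulr_ge0 ?invr_ge0// => /(_ isT)/(unit_cube_cover d0)/le_trans; apply.
by rewrite mulrCA mulrAC natM.
Qed.

Let nu_sigma_finite : sigma_finite setT nu.
Proof.
exists (fun k => cbox (\row_(i < d) - k%:R) (\row_(i < d) k%:R)); first by rewrite cbox_cover.
move=> k; split; first exact: measurable_cbox.
rewrite nuE; last exact: measurable_cbox.
(* The [k]-th box is contained in an affine image of the unit cube; [k.+1] keeps the ratio positive
   at [k = 0]. *)
pose l : R := k.+1%:R *+ 2.
have l0 : 0 < l by rewrite mulrn_wgt0.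
apply: (@le_lt_trans _ _ ((l ^+ d)%:E * hausdorff d (@ecube d 1))%E); last first.
  by rewrite lte_mul_pinfty ?lee_fin ?exprn_ge0 ?(ltW l0)// -nuE.
pose f (u : 'rV[R]_d) : 'rV[R]_d := l *: u - const_mx k.+1%:R.
apply: (@le_trans _ _ (hausdorff d (f @` @ecube d 1))).
  apply: ge_ereal_sup => _ [delta /= d0 <-].
  apply: le_trans (hausdorff_delta_le _ _ d0); apply: hausdorff_delta_subset => x xk.
  exists (l^-1 *: (x + const_mx k.+1%:R)).
    move=> i; have := xk i; rewrite !mxE => /andP[h1 h2].
    rewrite mulrC divr_ge0 ?(ltW l0)//=; last by rewrite -natr1; lra.
    by rewrite ler_pdivrMr// mul1r /l -natr1; lra.
  by rewrite /f scalerA divff ?gt_eqF// scale1r addrK.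
apply: hausdorff_image => // x y _ _.
by rewrite /f opprB addrA subrK -scalerBr enormZ gtr0_norm.
Qed.

Let c := fine (nu (@ecube d 1)).

Let leb_ecube r : 0 <= r -> leb d (@ecube d r) = (r ^+ d)%:E.
Proof.
move=> r0; rewrite leb_cbox; last by move=> i; rewrite !mxE.
by under eq_bigr do rewrite !mxE subr0; rewrite prodr_const card_ord.
Qed.

(** Inserting a box of volume 1 in the uniqueness formula gives proportionality to Lebesgue measure;
    evaluation at the unit cube identifies the factor as [c]. *)
Let nu_leb (A : set (BorelR R d)) : measurable A -> nu A = (c%:E * leb d A)%E.
Proof.
move=> mA.
pose M := Measure_isSigmaFinite.Build _ _ _ nu nu_sigma_finite.
pose nu' : {sigma_finite_measure set (BorelR R d) -> \bar R} := HB.pack (Measure.sort nu) M.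
pose B : set (BorelR R d) := cbox (const_mx (- 2^-1)) (const_mx 2^-1).
have mB : measurable B by exact: measurable_cbox.
have lB : leb d B = 1%E.
  rewrite leb_cbox; last by move=> i; rewrite !mxE; lra.
  have h2 : 2^-1 + 2^-1 = 1 :> R by field.
  by under eq_bigr do rewrite !mxE opprK h2; rewrite prodr_const expr1n.
have H E : measurable E -> nu E = (nu ((fun u : BorelR R d => (- (u : 'rV[R]_d))%R : BorelR R d) @^-1` B) * leb d E)%E.
  by move=> mE; have := @translation_invariant_leb d nu' nu_shift E B mE mB; rewrite lB mule1.
rewrite H// /c; congr (_ * _)%E; rewrite fineK; last first.
  by rewrite ge0_fin_numE.
by rewrite [RHS]H// leb_ecube// expr1n mule1.
Qed.

(* Cut the unit cube into small cubes and cover each of them by its inscribed ball,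
   at its nominal cost, and by the remainder, at cost [c] times its volume: with
   [theta] the proportion of the cube filled by the ball, [c <= theta + c (1 - theta)]. *)
Let c_le1 : c <= 1.
Proof.
pose theta : R := unit_ball_vol d * (2^-1) ^+ d.
have theta0 : 0 < theta by rewrite mulr_gt0 ?unit_ball_vol_gt0// exprn_gt0.
suff : c <= theta + c * (1 - theta).
  rewrite mulrBr mulr1 => h; have : c * theta <= theta by lra.
  by rewrite ger_pMl.
rewrite -lee_fin {1}/c fineK ?ge0_fin_numE// nuE//.
apply: ge_ereal_sup => _ [delta /= d0 <-].
have [N Nd] := exN d0.
pose s : R := N.+1%:R^-1; have s0 : 0 < s by rewrite invr_gt0.
pose v : 'rV[R]_d := const_mx (s / 2).
pose B : set (BorelR R d) := (fun u : BorelR R d => - v + (u : 'rV[R]_d) : BorelR R d) @^-1` (@cball R d (s / 2)).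
have mB : measurable B by rewrite -[X in measurable X]setTI; apply: measurable_rv_shift => //; exact: measurable_cball.
have s20 : 0 <= s / 2 by rewrite divr_ge0// ltW.
have lB : leb d B = (unit_ball_vol d * (s / 2) ^+ d)%:E.
  by rewrite /B leb_shift ?leb_cball_ge0//; exact: measurable_cball.
have Bs : B `<=` @ecube d s.
  move=> x; rewrite /B/= /cball/= => xs i; have := le_trans (coord_le_enorm _ i) xs.
  by rewrite !mxE ler_norml => /andP[? ?]; apply/andP; split; lra.
have sE : @ecube d s = B `|` (@ecube d s `\` B) by rewrite setDUK.
have hs : (hausdorff_delta d delta (@ecube d s) <=
    (unit_ball_vol d * (s / 2) ^+ d + c * (s ^+ d - unit_ball_vol d * (s / 2) ^+ d))%:E)%E.
  rewrite sE EFinD; apply: (le_trans (hausdorff_deltaU _ _ _ _)); apply: leeD.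
    apply: hausdorff_delta_single => //; first exact: ltW.
    move=> x y; rewrite /B /= /cball/= => xs ys.
    have -> : x - y = (- v + x) - (- v + y) by rewrite opprD addrACA subrr add0r.
    rewrite (le_trans (ler_enormD _ _))// enormN [leRHS]splitr; exact: lerD.
  apply: (le_trans (hausdorff_delta_le _ _ d0)).
  rewrite -nuE; last exact: measurableD.
  rewrite nu_leb; last exact: measurableD.
  have lE : leb d (@ecube d s) = (s ^+ d)%:E by rewrite leb_ecube// ltW.
  have -> : leb d (@ecube d s `\` B) = (s ^+ d - unit_ball_vol d * (s / 2) ^+ d)%:E.
    rewrite EFinB -lE -lB -[in RHS](setIidr Bs); apply: measureD => //.
    by rewrite [ltLHS]lE ltry.
  by rewrite -EFinM.
have := unit_cube_cover d0 hs; move=> /le_trans; apply; rewrite lee_fin.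
rewrite le_eqVlt; apply/orP; left; apply/eqP.
have e1 : (N.+1 ^ d)%:R * (s / 2) ^+ d = (2^-1) ^+ d :> R by rewrite [s / 2]mulrC natM.
have e2 : (N.+1 ^ d)%:R * s ^+ d = 1 :> R by rewrite -[s]mul1r natM expr1n.
transitivity (unit_ball_vol d * ((N.+1 ^ d)%:R * (s / 2) ^+ d) +
  c * ((N.+1 ^ d)%:R * s ^+ d - unit_ball_vol d * ((N.+1 ^ d)%:R * (s / 2) ^+ d))).
  by move: (s ^+ d) ((s / 2) ^+ d) (unit_ball_vol d) ((N.+1 ^ d)%:R : R) => x y u w; ring.
by rewrite e1 e2.
Qed.

Lemma hausdorff_leb (A : set 'rV[R]_d) : measurable (A : set (BorelR R d)) -> hausdorff d A = leb d A.
Proof.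
move=> mA; apply/eqP; rewrite eq_le hausdorff_ge_leb// andbT -nuE// nu_leb//.
by rewrite -[leRHS]mul1e lee_wpmul2r// lee_fin c_le1.
Qed.

End hausdorff_leb.
End hausdorff_lebesgue.

(** * Taylor estimates *)

Section mean_value.
Context {R : realType}.

Lemma norm_le_coord n (v : 'rV[R]_n) (m : R) : 0 <= m -> (forall i, `|v 0 i| <= m) -> `|v| <= m.
Proof.
move=> m0 vm; rewrite [leLHS]/Num.Def.normr/= mx_normrE; apply/bigmax_leP; split => //.
by move=> [j i] _ /=; rewrite (ord1 j).
Qed.

Lemma is_derive_line n (f : 'rV[R]_n -> R) (w v : 'rV[R]_n) (t d : R) :
  is_derive (w + t *: v) v f d -> is_derive t (1:R) (fun s : R => f (w + s *: v)) d.
Proof.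
have E : (fun h : R => h^-1 *: (((fun s : R => f (w + s *: v)) \o shift t) (h *: (1:R)) - f (w + t *: v))) =
    (fun h : R => h^-1 *: ((f \o shift (w + t *: v)) (h *: v) - f (w + t *: v))).
  apply/funext => h; have s1 : h *: (1:R) = h by exact: mulr1.
  by rewrite /= s1 scalerDl addrCA.
case=> d1 d2; split; first by rewrite /derivable E.
by rewrite -d2 /derive E.
Qed.

Lemma mean_value_line (f df : R -> R) (a b : R) :
  (forall t, Num.min a b <= t <= Num.max a b -> is_derive t (1:R) f (df t)) ->
  exists2 c, Num.min a b <= c <= Num.max a b & f b - f a = df c * (b - a).
Proof.
wlog ab : a b / a <= b => [hw|].
  case/orP: (le_total a b) => [|ba]; first exact: hw.
  rewrite minC maxC => /(hw _ _ ba)[c cab E]; exists c => //.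
  by rewrite -opprB E; ring.
rewrite (min_idPl ab) (max_idPr ab) => fd.
have fd' t : t \in `]a, b[%R -> is_derive t (1:R) f (df t).
  by rewrite in_itv/= => /andP[a1 b1]; apply: fd; rewrite !ltW.
have cf : {within `[a, b], continuous f}.
  by apply: derivable_within_continuous => t; rewrite in_itv/= => tab; have [] := fd t tab.
by have [c] := MVT_segment ab fd' cf; rewrite in_itv/= => cab E; exists c.
Qed.

(** [Ck] speaks of partial derivatives only, so the path from [z] to [y] changes one coordinate at a
    time. In the sup norm such a path stays within the larger of the two distances to [x0]. *)
Lemma mean_value_coord n (f : 'rV[R]_n -> R) (df : 'I_n -> 'rV[R]_n -> R) (x0 : 'rV[R]_n) (r : R) :
  (forall i x, `|x - x0| < r -> is_derive x (ebasis i) f (df i x)) ->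
  forall y z, `|y - x0| < r -> `|z - x0| < r ->
  exists xi : 'I_n -> 'rV[R]_n,
    (forall i, `|xi i - x0| <= Num.max `|y - x0| `|z - x0|) /\
    f y - f z = \sum_(i < n) df i (xi i) * (y 0 i - z 0 i).
Proof.
move=> fd y z yr zr.
(* The vertices of the path: [w 0] is [z] and [w n] is [y]. *)
pose w k : 'rV[R]_n := \row_i (if (i < k)%N then y 0 i else z 0 i).
pose m := Num.max `|y - x0| `|z - x0|.
have m0 : 0 <= m by rewrite le_max normr_ge0.
have mr : m < r by rewrite gt_max yr zr.
have ym i : `|y 0 i - x0 0 i| <= m.
  by rewrite le_max; apply/orP; left; have := coord_le_norm (y - x0) i; rewrite !mxE.
have zm i : `|z 0 i - x0 0 i| <= m.
  by rewrite le_max; apply/orP; right; have := coord_le_norm (z - x0) i; rewrite !mxE.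
have step (i : 'I_n) : exists xi, `|xi - x0| <= m /\
    f (w i.+1) - f (w i) = df i xi * (y 0 i - z 0 i).
  have wt t : Num.min 0 (y 0 i - z 0 i) <= t <= Num.max 0 (y 0 i - z 0 i) ->
      `|w i + t *: ebasis i - x0| <= m.
    move=> /andP[t1 t2]; apply: norm_le_coord => // j; rewrite !mxE eqxx /=.
    have [->|ji] := eqVneq j i; last by rewrite mulr0 addr0; case: ifP.
    rewrite ltnn mulr1.
    have := ym i; have := zm i; rewrite !ler_norml => /andP[z1 z2] /andP[y1 y2].
    have [yz|yz] := leP 0 (y 0 i - z 0 i).
      rewrite (min_idPl yz) in t1; rewrite (max_idPr yz) in t2.
      by apply/andP; split; lra.
    have yz' := ltW yz.
    rewrite (min_idPr yz') in t1; rewrite (max_idPl yz') in t2.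
    by apply/andP; split; lra.
  have [|c c01] := @mean_value_line (fun s => f (w i + s *: ebasis i))
      (fun s => df i (w i + s *: ebasis i)) 0 (y 0 i - z 0 i).
    move=> t t01; apply: is_derive_line; apply: fd.
    by apply: le_lt_trans mr; exact: wt.
  rewrite subr0 scale0r addr0 => E.
  exists (w i + c *: ebasis i); split; first exact: wt.
  rewrite -E; congr (f _ - _); apply/rowP => j; rewrite !mxE eqxx /= ltnS leq_eqVlt.
  have [->|ji] := eqVneq j i; first by rewrite eqxx ltnn mulr1 addrC subrK.
  by rewrite (_ : (j == i :> nat) = false) ?mulr0 ?addr0//; apply/negbTE.
have /choice[xi xiP] := step; exists xi; split; first by move=> i; have [] := xiP i.
have -> : f y - f z = \sum_(i < n) (f (w i.+1) - f (w i)).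
  rewrite -(big_mkord predT (fun i => f (w i.+1) - f (w i))) telescope_sumr//.
  by congr (f _ - f _); apply/rowP => j; rewrite !mxE ?ltn_ord.
by apply: eq_bigr => i _; have [_ ->] := xiP i.
Qed.

Lemma lipschitz_near n (f : 'rV[R]_n -> R) (df : 'I_n -> 'rV[R]_n -> R) (U : set 'rV[R]_n) (x0 : 'rV[R]_n) :
  open U -> U x0 -> (forall i x, U x -> is_derive x (ebasis i) f (df i x)) ->
  (forall i, {for x0, continuous (df i)}) ->
  exists r C, [/\ 0 < r, 0 <= C & forall y z, `|y - x0| < r -> `|z - x0| < r ->
    `|f y - f z| <= C * enorm (y - z)].
Proof.
move=> oU Ux0 fd cdf.
have /nbhs_ballP[r1 /= r10 r1U] : nbhs x0 U by exact: open_nbhs_nbhs.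
have /choice[r2 r2P] : forall i, exists r2, 0 < r2 /\ forall y, `|y - x0| < r2 -> `|df i y| <= `|df i x0| + 1.
  move=> i; have /cvgrPdist_lt/(_ _ ltr01)/nbhs_ballP[e /= e0 he] := cdf i.
  exists e; split => // y yx; have := he y; rewrite -ball_normE /= distrC => /(_ yx) h.
  by rewrite -lerBlDl (le_trans (lerB_dist _ _))// distrC ltW.
pose r := \big[Num.min/r1]_(i < n) r2 i.
have r0 : 0 < r by apply/bigmin_gtP; split => // i _; have [] := r2P i.
exists r, (\sum_(i < n) (`|df i x0| + 1)); split=> //.
  by apply: sumr_ge0 => i _; rewrite addr_ge0.
move=> y z yr zr.
have fd' i x : `|x - x0| < r -> is_derive x (ebasis i) f (df i x).
  move=> xr; apply: fd; apply: r1U; rewrite -ball_normE/= distrC (lt_le_trans xr)//.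
  exact: bigmin_le_id.
have [xi [xir ->]] := mean_value_coord fd' yr zr.
rewrite (le_trans (ler_norm_sum _ _ _))// mulr_suml ler_sum// => i _.
rewrite normrM ler_pM//; last by have := coord_le_enorm (y - z) i; rewrite !mxE.
have [_] := r2P i; apply; rewrite (le_lt_trans (xir i))//.
have rr2 : r <= r2 i by exact: bigmin_le_cond.
by rewrite gt_max !(lt_le_trans _ rr2).
Qed.

(** A two-point expansion with the derivative frozen at [x0]. The factor [enorm (y - z)] in the
    remainder is what later makes the projection bilipschitz, and not only accurate as seen from
    [x0]. *)
Lemma taylor1_near n (f : 'rV[R]_n -> R) (df : 'I_n -> 'rV[R]_n -> R)
    (ddf : 'I_n -> 'I_n -> 'rV[R]_n -> R) (U : set 'rV[R]_n) (x0 : 'rV[R]_n) :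
  open U -> U x0 -> (forall i x, U x -> is_derive x (ebasis i) f (df i x)) ->
  (forall i j x, U x -> is_derive x (ebasis j) (df i) (ddf i j x)) ->
  (forall i j, {for x0, continuous (ddf i j)}) ->
  exists r C, [/\ 0 < r, 0 <= C & forall y z, `|y - x0| < r -> `|z - x0| < r ->
    `|f y - f z - \sum_(i < n) df i x0 * (y 0 i - z 0 i)| <=
      C * (enorm (y - x0) + enorm (z - x0)) * enorm (y - z)].
Proof.
move=> oU Ux0 fd dfd cddf.
have /nbhs_ballP[r1 /= r10 r1U] : nbhs x0 U by exact: open_nbhs_nbhs.
have /choice[rC rCP] : forall i, exists rC : R * R, [/\ 0 < rC.1, 0 <= rC.2 &
    forall y z, `|y - x0| < rC.1 -> `|z - x0| < rC.1 -> `|df i y - df i z| <= rC.2 * enorm (y - z)].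
  move=> i; have [r [C [r0 C0 rC]]] := lipschitz_near oU Ux0 (dfd i) (cddf i).
  by exists (r, C).
pose r := \big[Num.min/r1]_(i < n) (rC i).1.
have r0 : 0 < r by apply/bigmin_gtP; split => // i _; have [] := rCP i.
exists r, (\sum_(i < n) ((rC i).2 * n%:R)); split=> //.
  by apply: sumr_ge0 => i _; rewrite mulr_ge0//; have [] := rCP i.
move=> y z yr zr.
have fd' i x : `|x - x0| < r -> is_derive x (ebasis i) f (df i x).
  move=> xr; apply: fd; apply: r1U; rewrite -ball_normE/= distrC (lt_le_trans xr)//.
  exact: bigmin_le_id.
have [xi [xir ->]] := mean_value_coord fd' yr zr.
rewrite -sumrB (le_trans (ler_norm_sum _ _ _))// !mulr_suml ler_sum// => i _.
rewrite -mulrBl normrM; have [_ C0 rCi] := rCP i.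
apply: ler_pM => //; last by have := coord_le_enorm (y - z) i; rewrite !mxE.
have rr2 : r <= (rC i).1 by exact: bigmin_le_cond.
apply: (le_trans (rCi _ _ _ _)).
- by rewrite (le_lt_trans (xir i))// gt_max !(lt_le_trans _ rr2).
- by rewrite subrr normr0; have [] := rCP i.
rewrite -mulrA ler_wpM2l// (le_trans (enorm_le_norm _))// ler_wpM2l//.
rewrite (le_trans (xir i))// ge_max.
by rewrite ler_wpDr ?enorm_ge0 ?norm_le_enorm//= ler_wpDl ?enorm_ge0 ?norm_le_enorm.
Qed.

End mean_value.

(** Completeness together with the norm, for the Banach fixed point theorem on row vectors. *)
HB.instance Definition _ (R : realType) m n := Complete.on 'M[R]_(m, n).

(** * Taylor expansion of vector-valued maps, orthonormalisation, fixed points *)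

Section vector_estimates.
Context {R : realType}.

Lemma enorm_near m n (F : 'I_m -> 'rV[R]_n -> 'rV[R]_n -> R) (N : 'rV[R]_n -> 'rV[R]_n -> R) (x0 : 'rV[R]_n) :
  (forall y z, 0 <= N y z) ->
  (forall j, exists r C, [/\ 0 < r, 0 <= C & forall y z, `|y - x0| < r -> `|z - x0| < r ->
    `|F j y z| <= C * N y z]) ->
  exists r C, [/\ 0 < r, 0 <= C & forall y z, enorm (y - x0) < r -> enorm (z - x0) < r ->
    enorm (\row_j F j y z) <= C * N y z].
Proof.
move=> N0 FC.
have /choice[rC rCP] : forall j, exists rC : R * R, [/\ 0 < rC.1, 0 <= rC.2 &
    forall y z, `|y - x0| < rC.1 -> `|z - x0| < rC.1 -> `|F j y z| <= rC.2 * N y z].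
  by move=> j; have [r [C h]] := FC j; exists (r, C).
pose r := \big[Num.min/1]_(j < m) (rC j).1.
exists r, (\sum_j (rC j).2); split.
- by apply/bigmin_gtP; split => // j _; have [] := rCP j.
- by apply: sumr_ge0 => j _; have [] := rCP j.
move=> y z yr zr; rewrite (le_trans (enorm_le_sum _))// mulr_suml ler_sum// => j _.
rewrite mxE; have [_ _] := rCP j; have rj : r <= (rC j).1 by exact: bigmin_le_cond.
by apply; rewrite (le_lt_trans (norm_le_enorm _))// (lt_le_trans _ rj).
Qed.

Lemma is_derive_coord n m (f : 'rV[R]_n -> 'rV[R]_m) (x v : 'rV[R]_n) (j : 'I_m) :
  derivable f x v -> is_derive x v (fun y => f y 0 j) (('D_v f x) 0 j).
Proof.
move=> fxv; split; first exact: (derivable_mxP _ _ _).1.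
by rewrite derive_mx// mxE.
Qed.

Lemma Ck1_lipschitz n m (f : 'rV[R]_n -> 'rV[R]_m) (U : set 'rV[R]_n) x0 :
  open U -> U x0 -> Ck 1 f U ->
  exists r C, [/\ 0 < r, 0 <= C & forall y z, enorm (y - x0) < r -> enorm (z - x0) < r ->
    enorm (f y - f z) <= C * enorm (y - z)].
Proof.
move=> oU Ux0 [cf df].
have /enorm_near : forall j : 'I_m, exists r C, [/\ 0 < r, 0 <= C &
    forall y z, `|y - x0| < r -> `|z - x0| < r -> `|f y 0 j - f z 0 j| <= C * enorm (y - z)].
  move=> j; apply: (@lipschitz_near _ _ (fun y => f y 0 j) (fun i x => ('D_(ebasis i) f x) 0 j) U) => //.
    by move=> i x Ux; apply: is_derive_coord; have [dfi _] := df i; exact: dfi.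
  move=> i; have [_ /(_ x0 (mem_set Ux0)) c] := df i.
  apply: (@continuous_comp 'rV[R]_n 'rV[R]_m R ('D_(ebasis i) f) (fun v => v 0 j) x0 c).
  exact: coord_continuous.
case=> [y z|r [C [r0 C0 rC]]]; first exact: enorm_ge0.
exists r, C; split => // y z yr zr; rewrite (_ : f y - f z = \row_j (f y 0 j - f z 0 j)) ?rC//.
by apply/rowP => j; rewrite !mxE.
Qed.

(** Vectors are rows, so the partial derivatives are the rows and the differential is
    [v *m jacobian_mx f x]. *)
Definition jacobian_mx n m (f : 'rV[R]_n -> 'rV[R]_m) (x : 'rV[R]_n) : 'M[R]_(n, m) :=
  \matrix_(i, j) ('D_(ebasis i) f x) 0 j.

Lemma Ck2_taylor n m (f : 'rV[R]_n -> 'rV[R]_m) (U : set 'rV[R]_n) x0 :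
  open U -> U x0 -> Ck 2 f U ->
  exists r C, [/\ 0 < r, 0 <= C & forall y z, enorm (y - x0) < r -> enorm (z - x0) < r ->
    enorm (f y - f z - (y - z) *m jacobian_mx f x0) <=
      C * ((enorm (y - x0) + enorm (z - x0)) * enorm (y - z))].
Proof.
move=> oU Ux0 [cf df].
have /enorm_near : forall j : 'I_m, exists r C, [/\ 0 < r, 0 <= C &
    forall y z, `|y - x0| < r -> `|z - x0| < r ->
    `|f y 0 j - f z 0 j - \sum_(i < n) ('D_(ebasis i) f x0) 0 j * (y 0 i - z 0 i)| <=
       C * ((enorm (y - x0) + enorm (z - x0)) * enorm (y - z))].
  move=> j; have [|||r [C [r0 C0 rC]]] := @taylor1_near _ _ (fun y => f y 0 j) (fun i x => ('D_(ebasis i) f x) 0 j)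
     (fun i k x => ('D_(ebasis k) ('D_(ebasis i) f) x) 0 j) U x0 oU Ux0.
  - by move=> i x Ux; apply: is_derive_coord; have [dfi _] := df i; exact: dfi.
  - move=> i k x Ux; apply: is_derive_coord; have [_ [_ /(_ k)[dfi _]]] := df i; exact: dfi.
  - move=> i k; have [_ [_ /(_ k)[_ /(_ x0 (mem_set Ux0)) c]]] := df i.
    apply: (@continuous_comp 'rV[R]_n 'rV[R]_m R ('D_(ebasis k) ('D_(ebasis i) f)) (fun v => v 0 j) x0 c).
    exact: coord_continuous.
  by exists r, C; split => // y z yr zr; rewrite mulrA; exact: rC.
case=> [y z|r [C [r0 C0 rC]]]; first by rewrite mulr_ge0 ?addr_ge0 ?enorm_ge0.
exists r, C; split => // y z yr zr; apply: le_trans (rC y z yr zr).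
rewrite le_eqVlt; apply/orP; left; apply/eqP; congr enorm; apply/rowP => j; rewrite !mxE.
by congr (_ - _); apply: eq_bigr => i _; rewrite !mxE mulrC.
Qed.

Lemma Ck2_taylor_real n (f : 'rV[R]_n -> R) (U : set 'rV[R]_n) x0 :
  open U -> U x0 -> Ck 2 f U ->
  exists r C (A : 'rV[R]_n), [/\ 0 < r, 0 <= C & forall y, enorm (y - x0) < r ->
    `|f y - f x0 - edot A (y - x0)| <= C * enorm (y - x0) ^+ 2].
Proof.
move=> oU Ux0 [cf df].
have [|||r [C [r0 C0 rC]]] := @taylor1_near _ _ f (fun i x => 'D_(ebasis i) f x)
     (fun i k x => 'D_(ebasis k) ('D_(ebasis i) f) x) U x0 oU Ux0.
- by move=> i x Ux; apply: derivableP; have [dfi _] := df i; exact: dfi.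
- move=> i k x Ux; apply: derivableP; have [_ [_ /(_ k)[dfi _]]] := df i; exact: dfi.
- by move=> i k; have [_ [_ /(_ k)[_ /(_ x0 (mem_set Ux0)) c]]] := df i.
exists r, C, (\row_i 'D_(ebasis i) f x0); split => // y yr.
have := rC y x0; rewrite subrr enorm0 addr0 normr0 -mulrA -expr2 => /(_ _ r0) h.
rewrite (_ : edot _ _ = \sum_(i < n) 'D_(ebasis i) f x0 * (y 0 i - x0 0 i)); last first.
  by apply: eq_bigr => i _; rewrite !mxE.
by apply: h; rewrite (le_lt_trans (norm_le_enorm _)).
Qed.

Lemma mulmx_bound m n (M : 'M[R]_(m, n)) :
  exists2 k, 0 <= k & forall u, enorm (u *m M) <= k * enorm u.
Proof.
exists (\sum_j \sum_i `|M i j|); first by rewrite sumr_ge0// => j _; rewrite sumr_ge0.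
move=> u; rewrite (le_trans (enorm_le_sum _))// mulr_suml ler_sum// => j _.
rewrite mxE (le_trans (ler_norm_sum _ _ _))// mulr_suml ler_sum// => i _.
by rewrite normrM mulrC ler_wpM2l// coord_le_enorm.
Qed.

(** The lower rows are orthonormalised by induction; the top row is then made orthogonal to them and
    normalised. [S] is block triangular with a nonzero corner. *)
Lemma gram_schmidt d D (B : 'M[R]_(d, D)) : (forall u : 'rV[R]_d, u *m B = 0 -> u = 0) ->
  exists (S : 'M[R]_d) (L : 'M[R]_(d, D)), [/\ S \in unitmx, L *m L^T = 1%:M & B = S *m L].
Proof.
elim: d B => [|d IH] B Binj.
  exists 1%:M, B; rewrite unitmx1 mul1mx; split => //.
  by apply/matrixP => -[].
pose b : 'rV[R]_D := usubmx (B : 'M[R]_(1 + d, D)); pose B' := dsubmx (B : 'M[R]_(1 + d, D)).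
have BE : (B : 'M[R]_(1 + d, D)) = col_mx b B' by rewrite vsubmxK.
have Binj1 (u : 'rV[R]_(1 + d)) : u *m col_mx b B' = 0 -> u = 0 by rewrite -BE; exact: Binj.
have [|S' [L' [S'u LL' B'E]]] := IH B'.
  move=> u uB'; have := Binj1 (row_mx 0 u); rewrite mul_row_col mul0mx add0r => /(_ uB').
  by rewrite -row_mx0 => /eq_row_mx[].
pose b' := b - b *m L'^T *m L'.
have b'L : b' *m L'^T = 0 by rewrite mulmxBl -(mulmxA _ L') LL' mulmx1 subrr.
(* Otherwise the top row would be a combination of the others, contradicting injectivity. *)
have n0 : enorm b' != 0.
  apply/eqP => /enorm0_eq0/eqP; rewrite subr_eq0 => /eqP bE.
  have := Binj1 (row_mx 1%:M (- (b *m L'^T *m invmx S'))).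
  rewrite mul_row_col mul1mx mulNmx B'E mulmxA -(mulmxA _ (invmx S') S') mulVmx// mulmx1 -bE subrr.
  move=> /(_ erefl); rewrite -row_mx0 => /eq_row_mx[/matrixP/(_ 0 0)].
  by rewrite !mxE /= => /eqP; rewrite oner_eq0.
pose l := (enorm b')^-1 *: b'.
have lL : l *m L'^T = 0 by rewrite -scalemxAl b'L scaler0.
have ll : l *m l^T = 1%:M.
  apply/matrixP => i j; rewrite !ord1 [RHS]mxE eqxx mulr1n [LHS]mxE.
  transitivity (edot l l); first by apply: eq_bigr => k _; rewrite [X in _ * X]mxE.
  by rewrite edotZl edotZr -sqr_enorm mulrA -expr2 -exprMn mulVf// expr1n.
pose S : 'M[R]_(1 + d) := block_mx (enorm b')%:M (b *m L'^T) 0 S'.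
pose L : 'M[R]_(1 + d, D) := col_mx l L'.
have Su : S \in unitmx.
  by rewrite unitmxE det_ublock unitrM -[X in _ && X]unitmxE S'u andbT det_scalar1 unitfE.
have LL : L *m L^T = 1%:M.
  have Ll : L' *m l^T = 0 by rewrite -[L']trmxK -trmx_mul lL trmx0.
  by rewrite tr_col_mx mul_col_row ll lL LL' Ll -scalar_mx_block.
have SL : S *m L = B.
  rewrite mul_block_col mul0mx add0r -B'E [RHS]BE; congr (col_mx _ _).
  by rewrite mul_scalar_mx scalerA divff// scale1r addrC /b' addrC subrK.
by exists S, L.
Qed.

(** The fixed point theorem is applied in the sup norm, whereas [q] is a Euclidean constant: hence
    the factor [d]. *)
Lemma contraction_fixpoint d (f : 'rV[R]_d -> 'rV[R]_d) (rho q : R) : 0 <= rho -> 0 <= q ->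
  q * d%:R < 1 ->
  (forall u, enorm u <= rho -> enorm (f u) <= rho) ->
  (forall u v, enorm u <= rho -> enorm v <= rho -> enorm (f u - f v) <= q * enorm (u - v)) ->
  exists2 u, enorm u <= rho & f u = u.
Proof.
move=> rho0 q0 qd fr fq.
pose U : set 'rV[R]_d := [set u | enorm u <= rho].
have qd0 : 0 <= q * d%:R by rewrite mulr_ge0.
have fU : {homo f : x / U x >-> U x} by exact: fr.
have cU : closed U.
  rewrite (_ : U = (@enorm R d) @^-1` [set t | t <= rho])//.
  by apply: closed_comp; [move=> x _; exact: enorm_continuous|exact: closed_le].
have ctr : is_contraction (mkfun fU).
  exists (NngNum qd0); split => //= -[u v] [/= Uu Uv].
  rewrite (le_trans (norm_le_enorm _))// (le_trans (fq _ _ Uu Uv))// -mulrA ler_wpM2l//.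
  exact: enorm_le_norm.
have [|u Uu E] := banach_fixed_point ctr cU; first by exists 0; rewrite /U/= enorm0.
by exists u.
Qed.

End vector_estimates.

(** * Local geometry of submanifolds *)

Section local_structure.
Context {R : realType}.

Lemma flat_closed d D : closed (@flat R D d).
Proof.
rewrite (_ : flat d = \bigcap_(i in [set i : 'I_D | (d <= i)%N]) ((fun v : 'rV[R]_D => v 0 i) @^-1` [set 0])).
  apply: closed_bigI => i _; apply: closed_comp; last exact: closed_eq.
  by move=> v _; exact: coord_continuous.
by apply/seteqP; split.
Qed.

Lemma mulmx_pid_flat d D (u : 'rV[R]_d) : flat d (u *m (pid_mx d : 'M[R]_(d, D))).
Proof.
move=> i di; rewrite mxE big1// => k _; rewrite mxE.
by rewrite (_ : (k == i :> nat) = false) ?mulr0//; apply/negbTE; rewrite neq_ltn (leq_trans (ltn_ord k) di).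
Qed.

Lemma flat_mulmx_pid d D (w : 'rV[R]_D) : flat d w -> w *m (pid_mx d : 'M[R]_D) = w.
Proof.
move=> fw; apply/rowP => i; rewrite mxE (bigD1 i)//= mxE eqxx /=.
rewrite big1 ?addr0; last first.
  by move=> k ki; rewrite mxE (_ : (k == i :> nat) = false) ?mulr0//; apply/negbTE.
by case: ltnP => [_|/fw ->]; rewrite ?mulr1 ?mul0r.
Qed.

Lemma min_lt_half (s : seq R) : all (fun x => 0 < x) s -> exists2 m : R, 0 < m & all (fun x => m < x) s.
Proof.
elim: s => [_|x s IH /= /andP[x0 /IH[m m0 ms]]]; first by exists 1.
exists (Num.min (x / 2) m); first by rewrite lt_min divr_gt0.
rewrite gt_min ltr_pdivrMr// ltr_pMr// ltr1n /=.
by apply/allP => y ys; rewrite gt_min (allP ms y ys) orbT.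
Qed.

(* The rows of [L] are an orthonormal basis of the tangent space at [x], obtained
   from the differential of the parametrisation [psi] by Gram-Schmidt. Second-order
   Taylor expansion of [psi] controls the component of [y - z] normal to the tangent
   space, and a contraction solves [(y - x) *m L^T = v]. *)
Lemma local_structure D d (hdD : (d <= D)%N) (Omega : set 'rV[R]_D) (x : 'rV[R]_D) (h0 : R) :
  0 < h0 -> Omega x -> embedded_submanifold d (eball x h0 `&` Omega) ->
  exists (L : 'M[R]_(d, D)) (r C : R), [/\ 0 < r, 0 <= C, L *m L^T = 1%:M,
    (forall rho, rho <= r -> measurable (Omega `&` eball x rho : set (BorelR R D))) &
    (forall y z, Omega y -> Omega z -> enorm (y - x) < r -> enorm (z - x) < r ->
      enorm (y - z) ^+ 2 <= enorm ((y - z) *m L^T) ^+ 2 +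
        C * ((enorm (y - x) + enorm (z - x)) * enorm (y - z)) ^+ 2) /\
    (forall rho, 0 < rho -> exists2 r0, 0 < r0 & forall v, enorm v < r0 ->
      exists y, [/\ Omega y, enorm (y - x) < rho & (y - x) *m L^T = v])].
Proof.
move=> h00 Ox emb; have Mx : (eball x h0 `&` Omega) x by split; rewrite // /eball/= subrr enorm0.
have [U [V [phi [psi [[oU Ux oV sphi spsi] [UV [VU img]]]]]]] := emb x Mx.
pose a := phi x; have Va : V a by have [] := UV x Ux.
have imgP y : U y -> eball x h0 y -> Omega y -> flat d (phi y).
  move=> Uy xy Oy; have : (phi @` (U `&` (eball x h0 `&` Omega))) (phi y) by exists y.
  by rewrite img => -[].
have imgP2 w : V w -> flat d w -> exists y, [/\ U y, eball x h0 y, Omega y, phi y = w & psi w = y].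
  move=> Vw fw; have : (V `&` flat d) w by [].
  rewrite -img => -[y [Uy [xy Oy]] yw]; exists y; split => //.
  by rewrite -yw; have [_ ->] := UV y Uy.
have fa : flat d a by apply: imgP => //; rewrite /eball/= subrr enorm0.
have psia : psi a = x by have [] := UV x Ux.
have [r1 [C1 [r10 C10 psiT]]] := Ck2_taylor oV Va (spsi 2%N).
have [r2 [C2 [r20 C20 phiL]]] := Ck1_lipschitz oU Ux (sphi 1%N).
have [r3 [C3 [r30 C30 psiL]]] := Ck1_lipschitz oV Va (spsi 1%N).
have [r4 r40 aV] := open_eball oV Va.
have [r5 r50 xU] := open_eball oU Ux.
pose A := jacobian_mx psi a.
pose J : 'M[R]_(d, D) := pid_mx d.
have JJ : J *m J^T = 1%:M by rewrite tr_pid_mx pid_mx_id// pid_mx_1.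
have JtJ : J^T *m J = pid_mx d by rewrite tr_pid_mx pid_mx_id.
have fD w w' : flat d w -> flat d w' -> flat d (w + w') by move=> h h' i di; rewrite mxE h// h'// addr0.
have fB w w' : flat d w -> flat d w' -> flat d (w - w') by move=> h h' i di; rewrite !mxE h// h'// subrr.
have faJ u : flat d (a + u *m J) by apply: fD => //; exact: mulmx_pid_flat.
have aJa u : a + u *m J - a = u *m J by rewrite addrC addKr.
have eJ u : enorm (u *m J) = enorm u by rewrite enorm_isometry.
pose B := J *m A.
(* Along a kernel vector of length s, [psi] moves by at most C1 s^2; the Lipschitz inverse [phi]
   then gives s <= C2 C1 s^2, which fails for small s. *)
have Binj (u : 'rV[R]_d) : u *m B = 0 -> u = 0.
  move=> uB; apply/eqP; apply: contraT => u0.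
  have nu0 : 0 < enorm u.
    by rewrite lt_neqAle enorm_ge0 andbT eq_sym; apply: contra u0 => /eqP/enorm0_eq0 ->.
  have [|s s0 /=] := @min_lt_half [:: r1; r3; r4; r2 / (C3 + 1); (C2 * C1 + 1)^-1].
    by rewrite /= r10 r30 r40 divr_gt0 ?invr_gt0// ltr_wpDl// mulr_ge0.
  move=> /and5P[s1 s3 s4 s2 /andP[s5 _]].
  pose v := (s / enorm u) *: u.
  have vs : enorm v = s by rewrite enormZ ger0_norm ?divfK ?gt_eqF// divr_ge0// ltW.
  have vB : v *m B = 0 by rewrite -scalemxAl uB scaler0.
  have a0 : enorm (a - a) = 0 by rewrite subrr enorm0.
  have wV : V (a + v *m J) by apply: aV; rewrite /eball/= aJa eJ vs.
  have [Uw phiw] := VU _ wV.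
  have := psiT (a + v *m J) a; rewrite aJa eJ vs a0 => /(_ s1 r10).
  rewrite -mulmxA -/A -/B vB subr0 addr0 psia => T1.
  have := psiL (a + v *m J) a; rewrite aJa eJ vs a0 psia => /(_ s3 r30) T3.
  have s2' : C3 * s < r2 by move: s2; rewrite ltr_pdivlMr ?ltr_wpDl//; nra.
  have := phiL (psi (a + v *m J)) x; rewrite phiw subrr enorm0 -/a aJa eJ vs => /(_ (le_lt_trans T3 s2') r20) T2.
  have T4 : s <= C2 * (C1 * (s * s)) by rewrite (le_trans T2)// ler_wpM2l.
  have C21 : 0 <= C2 * C1 by exact: mulr_ge0.
  move: s5; rewrite -[s]invrK ltf_pV2 ?posrE ?invr_gt0// ?ltr_wpDl// => s5.
  have : s * (C2 * C1 + 1) < 1 by rewrite mulrC -ltr_pdivlMr// div1r.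
  nra.
have [S [L [Su LL BE]]] := gram_schmidt Binj.
(* The last bound makes [phi] send the ball of radius [r] into the Taylor ball of [psi]; [+ 1]
   guards against [C2 = 0]. *)
have [|r r0 /=] := @min_lt_half [:: h0; r2; r5; r1 / (C2 + 1)].
  by rewrite /= h00 r20 r50 divr_gt0// ltr_wpDl.
move=> /and5P[rh rr2 rr5 rr1 _].
have rr1' : C2 * r < r1 by move: rr1; rewrite ltr_pdivlMr ?ltr_wpDl//; nra.
(* [C1] is the Taylor constant of [psi]; each of the two factors of its remainder costs one [C2]
   when expressed in Omega, and Pythagoras squares the result. *)
exists L, r, ((C1 * C2 ^+ 2) ^+ 2); split => //.
- exact: sqr_ge0.
- move=> rho rho_r; have ballU t : enorm (t - x) < rho -> U t.
    by move=> tr; apply: xU; rewrite /eball/= (lt_trans _ rr5)// (lt_le_trans tr).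
  (* Within the ball, Omega is the set where [phi] is flat, so its complement [W] is open. *)
  pose W := [set t | eball x rho t /\ ~ flat d (phi t)].
  have oW : open W.
    rewrite openE => t [tr tf]; rewrite /interior.
    have n1 : nbhs t (eball x rho) by apply: open_nbhs_nbhs; split => //; exact: eball_open.
    have n2 : nbhs t (phi @^-1` (~` flat d)).
      have ct : {for t, continuous phi} by have := sphi 0%N; apply; apply/mem_set/ballU.
      apply: ct; apply: open_nbhs_nbhs; split => //; apply: closed_openC; exact: flat_closed.
    by apply: filterS (filterI n1 n2) => z [].
  rewrite (_ : _ `&` _ = eball x rho `\` W).
    by apply: measurableD; apply: open_Borel => //; exact: eball_open.
  apply/seteqP; split=> [t [Ot tr]|t [tr nW]].
    split => // -[_]; apply; apply: imgP => //; first exact: ballU.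
    by rewrite /eball/= (lt_trans _ rh)// (lt_le_trans tr).
  have ft : flat d (phi t) by apply: contrapT => nf; apply: nW.
  have [Vt pt] := UV t (ballU t tr).
  have [y [_ _ Oy _ py]] := imgP2 _ Vt ft.
  by split => //; rewrite -pt py.
split.
- move=> y z Oy Oz yr zr.
  have loc t : Omega t -> enorm (t - x) < r -> [/\ U t, V (phi t), psi (phi t) = t, flat d (phi t) & enorm (phi t - a) <= C2 * enorm (t - x)].
    move=> Ot tr; have Ut : U t by apply: xU; exact: lt_trans rr5.
    have [Vt pt] := UV t Ut; split => //.
      by apply: imgP => //; exact: lt_trans rh.
    by apply: phiL; [exact: lt_trans rr2|rewrite subrr enorm0].
  have [Uy Vy py fy ly] := loc y Oy yr; have [Uz Vz pz fz lz] := loc z Oz zr.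
  have lr1 t : enorm (t - x) < r -> enorm (phi t - a) <= C2 * enorm (t - x) -> enorm (phi t - a) < r1.
    by move=> tr /le_lt_trans; apply; rewrite (le_lt_trans _ rr1')// ler_wpM2l// ltW.
  have := psiT (phi y) (phi z) (lr1 y yr ly) (lr1 z zr lz); rewrite py pz -/A.
  pose u := (phi y - phi z) *m J^T.
  have uJ : phi y - phi z = u *m J by rewrite -mulmxA JtJ flat_mulmx_pid//; exact: fB.
  rewrite {1}uJ -mulmxA -/B BE; set e := y - z - _ => T1.
  rewrite (enorm_pythagoras LL (y - z)) lerD2l.
  (* The linear part of [y - z] lies in the span of [L], so its normal component is that of the
     remainder [e]. *)
  have -> : y - z - (y - z) *m L^T *m L = e - e *m L^T *m L.
    have projB (t w : 'rV[R]_D) : w *m L^T *m L = w -> t - t *m L^T *m L = t - w - (t - w) *m L^T *m L.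
      by move=> wL; rewrite !mulmxBl wL opprB addrA subrK.
    by apply: projB; rewrite mulmxA -(mulmxA (u *m S)) LL mulmx1.
  have eL : enorm (e - e *m L^T *m L) <= enorm e.
    rewrite -ler_sqr ?nnegrE ?enorm_ge0// (enorm_pythagoras LL e) lerDr sqr_ge0//.
  have pyz : enorm (phi y - phi z) <= C2 * enorm (y - z) by apply: phiL; exact: lt_trans rr2.
  rewrite -exprMn ler_sqr ?nnegrE ?enorm_ge0//; last by rewrite !mulr_ge0 ?addr_ge0 ?enorm_ge0// sqr_ge0.
  apply: (le_trans eL); apply: (le_trans T1); rewrite -mulrA ler_wpM2l// expr2 -mulrA.
  rewrite [leRHS](_ : _ = (C2 * enorm (y - x) + C2 * enorm (z - x)) * (C2 * enorm (y - z))); last by ring.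
  by apply: ler_pM; rewrite ?addr_ge0 ?enorm_ge0//; exact: lerD.
- move=> rho rho0.
  have [k k0 kS] := mulmx_bound (invmx S).
  (* With s K < 1 the contraction constant 2 k C1 s, times [d], stays below 1, and the ball of
     radius [s] is preserved. *)
  pose K := 4 * (k * C1 + 1) * d.+1%:R.
  have kC : 0 <= k * C1 by exact: mulr_ge0.
  have K0 : 0 < K by rewrite /K !mulr_gt0 ?ltr_wpDl.
  have [|s s0 /=] := @min_lt_half [:: r1; r3; r4; rho / (C3 + 1); K^-1].
    by have C31 : 0 < C3 + 1 by [rewrite ltr_wpDl]; rewrite /= r10 r30 r40 divr_gt0// invr_gt0 K0.
  move=> /and5P[s1 s3 s4 s2 /andP[s5 _]].
  have s2' : C3 * s < rho by move: s2; rewrite ltr_pdivlMr ?ltr_wpDl//; nra.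
  have sK : s * K < 1 by rewrite -ltr_pdivlMr// div1r.
  exists (s / (2 * (k + 1))); first by rewrite divr_gt0// mulr_gt0// ltr_wpDl.
  move=> v vs.
  (* The nonlinear part of the projected parametrisation. Its Lipschitz constant is small near 0,
     and the equation to solve is u S = v - E u. *)
  pose E u := (psi (a + u *m J) - x) *m L^T - u *m S.
  have EL u u' : enorm u <= s -> enorm u' <= s -> enorm (E u - E u') <= C1 * ((enorm u + enorm u') * enorm (u - u')).
    move=> us u's; have := psiT (a + u *m J) (a + u' *m J).
    rewrite !aJa !eJ => /(_ (le_lt_trans us s1) (le_lt_trans u's s1)).
    have -> : a + u *m J - (a + u' *m J) = (u - u') *m J.
      by rewrite opprD addrACA subrr add0r mulmxBl.
    rewrite eJ => /(le_trans _); apply; rewrite -mulmxA -/A -/B BE.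
    apply: le_trans (enorm_proj LL _); rewrite le_eqVlt; apply/orP; left; apply/eqP; congr enorm.
    have projB (p q : 'rV[R]_D) : (p - q - (u - u') *m (S *m L)) *m L^T =
        (p - x) *m L^T - u *m S - ((q - x) *m L^T - u' *m S).
      rewrite mulmxBl -!mulmxA LL mulmx1 !mulmxBl.
      by apply/rowP => i; rewrite !mxE; ring.
    by rewrite projB.
  have E0 : E 0 = 0 by rewrite /E !mul0mx addr0 -/a psia subrr mul0mx subr0.
  pose f u := (v - E u) *m invmx S.
  have Es u : enorm u <= s -> enorm (E u) <= C1 * (s * enorm u).
    move=> us; have := EL u 0 us; rewrite enorm0 E0 !subr0 addr0 => /(_ (ltW s0)) h.
    by rewrite (le_trans h)// ler_wpM2l// ler_wpM2r ?enorm_ge0.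
  have kC1s : k * C1 * s * (4 * d.+1%:R) <= 1.
    apply: le_trans (ltW sK); rewrite /K; have : 0 <= s * (4 * d.+1%:R) by rewrite mulr_ge0// ltW.
    nra.
  have kC1s4 : k * C1 * s <= 4^-1.
    rewrite -[leRHS]mul1r ler_pdivlMr// (le_trans _ kC1s)// ler_wpM2l//.
      by rewrite mulr_ge0// ltW.
    by rewrite ler_peMr// ler1n.
  have [||||u us fu] := @contraction_fixpoint R d f s (k * C1 * s * 2) (ltW s0).
  - by rewrite !mulr_ge0// ltW.
  - have : k * C1 * s * 2 * d%:R <= k * C1 * s * 2 * d.+1%:R by rewrite ler_wpM2l ?ler_nat// !mulr_ge0// ltW.
    lra.
  - move=> u us; rewrite (le_trans (kS _))//.
    have h1 : enorm (v - E u) <= enorm v + C1 * (s * s).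
      rewrite (le_trans (ler_enormD _ _))// enormN lerD2l (le_trans (Es _ us))//.
      by rewrite ler_wpM2l// ler_wpM2l// ltW.
    have h2 : enorm v * (2 * (k + 1)) < s by rewrite -ltr_pdivlMr// mulr_gt0// ltr_wpDl.
    have h3 : k * enorm v <= s / 2 by have := enorm_ge0 v; nra.
    apply: (le_trans (ler_wpM2l k0 h1)); rewrite mulrDr.
    have h4 : k * (C1 * (s * s)) <= s / 4 by rewrite !mulrA mulrC ler_wpM2l// ltW.
    lra.
  - move=> u w us ws; rewrite /f -mulmxBl (le_trans (kS _))//.
    have -> : v - E u - (v - E w) = E w - E u by apply/rowP => i; rewrite !mxE; ring.
    rewrite (enorm_distC (E w)) -!mulrA ler_wpM2l// (le_trans (EL _ _ us ws))// ler_wpM2l// mulrA ler_wpM2r ?enorm_ge0//.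
    by rewrite mulr_natr mulr2n; exact: lerD.
  have wV : V (a + u *m J) by apply: aV; rewrite /eball/= aJa eJ (le_lt_trans us).
  have [y [Uy _ Oy yw py]] := imgP2 _ wV (faJ u).
  exists y; split => //.
    rewrite -py -psia (le_lt_trans (psiL _ _ _ _))// ?subrr ?enorm0//.
      by rewrite aJa eJ (le_lt_trans us).
    by rewrite aJa eJ (le_lt_trans _ s2')// ler_wpM2l.
  have : f u *m S = u *m S by rewrite fu.
  by rewrite /f mulmxKV// /E py => /eqP; rewrite subr_eq addrC subrK => /eqP <-.
Qed.

End local_structure.

(** * H^d seen through the tangent projection *)

Section chart_measure.
Context {R : realType}.

(** Turns the d-th power of a Lipschitz constant 1 + O(s^2) into a volume factor of the same
    form. *)
Lemma expr_le_linear (t : R) d : 0 <= t -> t <= 1 -> (1 + t) ^+ d <= 1 + 3 ^+ d * t.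
Proof.
move=> t0 t1; elim: d => [|d IH]; first by rewrite !expr0; lra.
rewrite exprSr (@le_trans _ _ ((1 + 3 ^+ d * t) * (1 + t)))//.
  by rewrite ler_wpM2r// addr_ge0.
have e3 : 1 <= 3 ^+ d :> R by rewrite exprn_ege1// ler1n.
rewrite exprSr; move: (3 ^+ d) e3 => e e3.
have h1 : 0 <= t * (e - 1) by rewrite mulr_ge0// subr_ge0.
have h2 : 0 <= e * (t * (1 - t)) by rewrite !mulr_ge0 ?subr_ge0// (le_trans ler01).
lra.
Qed.

Variables (D d : nat) (hdD : (d <= D)%N) (mu : {measure set (BorelR R D) -> \bar R}).
Hypothesis hmu : forall A : set (BorelR R D), measurable A -> mu A = hausdorff d A.

Definition chart_proj (L : 'M[R]_(d, D)) (x y : 'rV[R]_D) : 'rV[R]_d := (y - x) *m L^T.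

Definition chart_set (Omega : set 'rV[R]_D) (L : 'M[R]_(d, D)) (x : 'rV[R]_D) (r : R)
    (A : set 'rV[R]_d) : set 'rV[R]_D :=
  [set y | (Omega y /\ enorm (y - x) < r) /\ A (chart_proj L x y)].

Lemma measurable_chart_proj (L : 'M[R]_(d, D)) (x : 'rV[R]_D) :
  measurable_fun setT (chart_proj L x : BorelR R D -> BorelR R d).
Proof.
have mB : measurable_fun setT (fun y : BorelR R D => (y : 'rV[R]_D) - x : BorelR R D).
  apply: measurable_fun_row => i; under eq_fun do rewrite !mxE.
  by apply: measurable_funB => //; exact: measurable_coord.
exact: (measurableT_comp (measurable_mulmx L^T) mB).
Qed.

Lemma measurable_chart_set (Omega : set 'rV[R]_D) L x r A :
  measurable (Omega `&` eball x r : set (BorelR R D)) -> measurable (A : set (BorelR R d)) ->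
  measurable (chart_set Omega L x r A : set (BorelR R D)).
Proof.
move=> mO mA; rewrite (_ : chart_set _ _ _ _ _ = (Omega `&` eball x r) `&` (chart_proj L x @^-1` A))//.
apply: measurableI => //; rewrite -[X in measurable X]setTI.
exact: measurable_chart_proj.
Qed.

(** The projection maps the piece of Omega over [A] onto [A] without increasing distances, which
    gives the lower bound; its inverse is (1 + 16 C s^2)-Lipschitz, which gives the upper one. *)
Lemma chart_measure (Omega : set 'rV[R]_D) (x : 'rV[R]_D) (h0 : R) :
  0 < h0 -> Omega x -> embedded_submanifold d (eball x h0 `&` Omega) ->
  exists (L : 'M[R]_(d, D)) (r1 r0 K : R), [/\ [/\ 0 < r1, 0 < r0, 0 <= K & L *m L^T = 1%:M],
    measurable (Omega `&` eball x r1 : set (BorelR R D)),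
    (forall y, Omega y -> enorm (y - x) < r1 ->
      enorm (y - x - chart_proj L x y *m L) <= K * enorm (chart_proj L x y) ^+ 2 /\
      enorm (y - x) - enorm (chart_proj L x y) <= K * enorm (chart_proj L x y) ^+ 3) &
    (forall s (A : set 'rV[R]_d), 0 <= s -> s < r0 -> measurable (A : set (BorelR R d)) ->
      (forall u, A u -> enorm u <= s) ->
      (leb d A <= mu (chart_set Omega L x r1 A) <= (1 + K * s ^+ 2)%:E * leb d A)%E)].
Proof.
move=> h00 Ox emb.
have [L [r [C [r_gt0 C0 LL mOr [bilip surj]]]]] := local_structure hdD h00 Ox emb.
have C1 : 0 < C + 1 by rewrite ltr_wpDl.
(* Small enough for C |y - x|^2 <= 1/4, so that the quartic term is absorbed and |y - x| is at most
   twice its projection. *)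
have [|r1 r10 /=] := @min_lt_half R [:: r; (2 * (C + 1))^-1; 1].
  by rewrite /= r_gt0 ltr01 invr_gt0 mulr_gt0.
move=> /and4P[r1r r1C r11 _].
have Cr1 : C * r1 ^+ 2 <= 4^-1.
  have h : r1 * (2 * (C + 1)) < 1 by rewrite -ltr_pdivlMr ?mulr_gt0// div1r.
  have h2 : (r1 * (2 * (C + 1))) ^+ 2 <= 1 by rewrite expr_le1// ?mulr_ge0// ltW// ltW.
  move: (h2); rewrite exprMn => h3.
  have : C <= (C + 1) ^+ 2 by nra.
  have := sqr_ge0 r1; nra.
have dist2 y : Omega y -> enorm (y - x) < r1 ->
    enorm (y - x) ^+ 2 <= enorm (chart_proj L x y) ^+ 2 + C * (enorm (y - x) ^+ 2) ^+ 2.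
  move=> Oy yr; have := bilip y x Oy Ox (lt_trans yr r1r); rewrite subrr enorm0 addr0 -expr2.
  by apply.
have dist y : Omega y -> enorm (y - x) < r1 -> enorm (y - x) <= 2 * enorm (chart_proj L x y).
  move=> Oy yr; have := dist2 y Oy yr; have := enorm_ge0 (y - x); have := enorm_ge0 (chart_proj L x y).
  move: (enorm (y - x)) (enorm (chart_proj L x y)) yr => a b ar b0 a0 h.
  have aC : C * a ^+ 2 <= 4^-1 by apply: le_trans Cr1; rewrite ler_wpM2l// lerXn2r ?nnegrE// ltW.
  rewrite -ler_sqr ?nnegrE ?mulr_ge0// exprMn.
  have := sqr_ge0 a; nra.
have [r2 r20 surj2] := surj r1 r10.
(* [r2] makes the projection surjective onto the sets [A] considered; the second bound gives 16 C
   s^2 <= 1/2. *)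
have [|r0 r00 /=] := @min_lt_half R [:: r2; (8 * (C + 1))^-1; 1].
  by rewrite /= r20 ltr01 invr_gt0 mulr_gt0.
move=> /and4P[r02 r0C r01 _].
pose sC := Num.sqrt C.
have sC0 : 0 <= sC by exact: sqrtr_ge0.
have sC2 : sC ^+ 2 = C by rewrite sqr_sqrtr.
have e3 : 1 <= 3 ^+ d :> R by rewrite exprn_ege1// ler1n.
have C16 : 0 <= 16 * C by rewrite mulr_ge0.
have sC4 : 0 <= 4 * sC by rewrite mulr_ge0.
have e30 : 0 <= 3 ^+ d :> R by exact: exprn_ge0.
(* The first term serves the normal component; the second dominates 16 C for the distance and
   carries [3 ^+ d] for the measure. *)
exists L, r1, r0, (4 * sC + 3 ^+ d * (16 * C)); split.
- by split => //; rewrite addr_ge0// mulr_ge0.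
- by apply: mOr; exact: ltW.
- move=> y Oy yr; have h1 := dist y Oy yr; have h2 := dist2 y Oy yr.
  have p := enorm_pythagoras LL (y - x); rewrite -/(chart_proj L x y) in p.
  have := enorm_ge0 (y - x); have := enorm_ge0 (chart_proj L x y).
  have := enorm_ge0 (y - x - chart_proj L x y *m L).
  move: (enorm (y - x)) (enorm (chart_proj L x y)) (enorm (y - x - chart_proj L x y *m L)) yr h1 h2 p.
  move=> a b n ar h1 h2 p n0 b0 a0.
  have a2 : a ^+ 2 <= 4 * b ^+ 2 by rewrite (_ : 4 * b ^+ 2 = (2 * b) ^+ 2) ?lerXn2r ?nnegrE ?mulr_ge0//; ring.
  have a4 : (a ^+ 2) ^+ 2 <= 16 * (b ^+ 2) ^+ 2.
    rewrite (_ : 16 * _ = (4 * b ^+ 2) ^+ 2); last by ring.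
    by rewrite lerXn2r ?nnegrE ?sqr_ge0// mulr_ge0// sqr_ge0.
  have ca : C * (a ^+ 2) ^+ 2 <= C * (16 * (b ^+ 2) ^+ 2) by rewrite ler_wpM2l.
  have n2 : n ^+ 2 <= C * (16 * (b ^+ 2) ^+ 2) by lra.
  split.
    apply: (@le_trans _ _ (4 * sC * b ^+ 2)).
      rewrite -ler_sqr ?nnegrE ?mulr_ge0 ?sqr_ge0// !exprMn sC2.
      by rewrite (le_trans n2)// le_eqVlt; apply/orP; left; apply/eqP; ring.
    by rewrite ler_wpM2r ?sqr_ge0// lerDl mulr_ge0.
  apply: (@le_trans _ _ (16 * C * b ^+ 3)).
    (* For a >= b, (a - b) b <= a^2 - b^2: dividing the quartic bound by b makes it cubic. *)
    have [b_0|b1] := eqVneq b 0; first by rewrite b_0 expr0n /= mulr0; lra.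
    have bgt0 : 0 < b by rewrite lt_neqAle eq_sym b1.
    rewrite -(ler_pM2r bgt0) (_ : 16 * C * b ^+ 3 * b = C * (16 * (b ^+ 2) ^+ 2)); last by ring.
    have cab : a ^+ 2 - b ^+ 2 <= C * (16 * (b ^+ 2) ^+ 2) by lra.
    have [ab|ab] := leP a b; last first.
      by apply: le_trans cab; have : 0 <= (a - b) * a by [rewrite mulr_ge0// subr_ge0 ltW]; lra.
    by apply: (@le_trans _ _ 0); [nra|rewrite !mulr_ge0// sqr_ge0].
  rewrite ler_wpM2r ?exprn_ge0// ler_wpDl ?mulr_ge0// ler_peMl// mulr_ge0//.
- move=> s A s0 sr0 mA As.
  pose E := chart_set Omega L x r1 A.
  have mE : measurable (E : set (BorelR R D)) by apply: measurable_chart_set => //; apply: mOr; exact: ltW.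
  have EA : chart_proj L x @` E = A.
    apply/seteqP; split=> [_ [y [_ Ay] <-]//|v Av].
    have [|y [Oy yr yv]] := surj2 v; first by rewrite (le_lt_trans (As v Av))// (lt_trans sr0).
    by exists y => //; rewrite /E /chart_set /= /chart_proj yv.
  rewrite hmu// -(hausdorff_leb hdD hmu mA); apply/andP; split.
    rewrite -{1}EA -[leRHS]mul1e -(expr1n R d); apply: hausdorff_image => // y z _ _.
    rewrite mul1r /chart_proj -mulmxBl opprB addrA subrK; exact: enorm_proj.
  pose t := 16 * C * s ^+ 2.
  have t0 : 0 <= t by rewrite !mulr_ge0// sqr_ge0.
  have t2 : t <= 2^-1.
    have h : s * (8 * (C + 1)) <= 1 by rewrite -ler_pdivlMr ?mulr_gt0// div1r ltW// (lt_trans sr0).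
    rewrite /t; have : s ^+ 2 <= s * 1 by rewrite expr2 ler_wpM2l// ltW// (lt_trans sr0).
    nra.
  have lip y z : E y -> E z -> enorm (y - z) <= (1 + t) * enorm (chart_proj L x y - chart_proj L x z).
    move=> [[Oy yr] Ay] [[Oz zr] Az].
    have := bilip y z Oy Oz (lt_trans yr r1r) (lt_trans zr r1r).
    have -> : (y - z) *m L^T = chart_proj L x y - chart_proj L x z.
      by rewrite /chart_proj -mulmxBl opprB addrA subrK.
    have ys : enorm (y - x) <= 2 * s by rewrite (le_trans (dist y Oy yr))// ler_pM2l// As.
    have zs : enorm (z - x) <= 2 * s by rewrite (le_trans (dist z Oz zr))// ler_pM2l// As.
    have := enorm_ge0 (y - z); have := enorm_ge0 (chart_proj L x y - chart_proj L x z).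
    have := enorm_ge0 (y - x); have := enorm_ge0 (z - x).
    move: (enorm (y - x)) (enorm (z - x)) ys zs (enorm (y - z)) (enorm (chart_proj _ _ _ - _)) => b c bs cs a e c0 b0 e0 a0.
    have bc : (b + c) ^+ 2 <= (4 * s) ^+ 2 by rewrite lerXn2r ?nnegrE ?addr_ge0 ?mulr_ge0//; lra.
    rewrite exprMn => h.
    have h2 : a ^+ 2 * (1 - t) <= e ^+ 2.
      have : C * ((b + c) ^+ 2 * a ^+ 2) <= C * ((4 * s) ^+ 2 * a ^+ 2).
        by rewrite ler_wpM2l// ler_wpM2r ?sqr_ge0.
      rewrite /t; move: (a ^+ 2) (e ^+ 2) h => a2 e2 h; rewrite exprMn; lra.
    rewrite -ler_sqr ?nnegrE ?mulr_ge0 ?addr_ge0// exprMn.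
    (* Valid for 0 <= t <= 1/2; it converts a^2 (1 - t) <= e^2 into a <= (1 + t) e. *)
    have h3 : 1 <= (1 + t) ^+ 2 * (1 - t) by nra.
    apply: (@le_trans _ _ ((1 + t) ^+ 2 * (a ^+ 2 * (1 - t)))).
      by rewrite mulrCA ler_peMr ?sqr_ge0.
    by rewrite ler_wpM2l// sqr_ge0.
  (* A section of the projection over [A], with junk value [x] elsewhere; the estimate [lip] makes
     the projection injective on [E]. *)
  have /choice[g gP] : forall v, exists y, A v -> E y /\ chart_proj L x y = v.
    move=> v; have [Av|nAv] := pselect (A v); last by exists x.
    have : (chart_proj L x @` E) v by rewrite EA.
    by move=> [y Ey yv]; exists y.
  have gA : g @` A = E.
    apply/seteqP; split=> [_ [v Av <-]|y Ey]; first by have [] := gP v Av.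
    have Av : A (chart_proj L x y) by case: Ey.
    exists (chart_proj L x y) => //; have [Eg gv] := gP _ Av.
    have := lip _ _ Eg Ey; rewrite gv subrr enorm0 mulr0 => h.
    by apply/eqP; rewrite -subr_eq0; apply/eqP/enorm0_eq0/eqP; rewrite eq_le h enorm_ge0.
  rewrite -/E -gA; have t1 : 0 < 1 + t by rewrite ltr_wpDr.
  apply: (@le_trans _ _ (((1 + t) ^+ d)%:E * hausdorff d A)%E).
    apply: hausdorff_image => // v w Av Aw.
    by have [Ev ev] := gP v Av; have [Ew ew] := gP w Aw; rewrite -{2}ev -{2}ew; exact: lip.
  rewrite lee_wpmul2r ?(le_trans _ (hausdorff_delta_le _ _ ltr01)) ?hausdorff_delta_ge0// lee_fin.
  rewrite (le_trans (expr_le_linear _ t0 _))//; first by lra.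
  rewrite lerD2l /t mulrA ler_wpM2r ?sqr_ge0// lerDr mulr_ge0//.
Qed.

End chart_measure.

(** * Mean square error of an i.i.d. average *)

Section bounded_measurable.
Context d (T : measurableType d) {R : realType}.

(** A class closed under sums and products whose members are integrable for every finite measure,
    which settles integrability throughout. *)
Definition bounded_mfun (f : T -> R) : Prop :=
  measurable_fun setT f /\ exists b, forall t, `|f t| <= b.

Lemma bounded_mfun_cst a : bounded_mfun (fun=> a).
Proof. by split; [exact: measurable_cst|exists `|a|]. Qed.

Lemma bounded_mfunD f g : bounded_mfun f -> bounded_mfun g -> bounded_mfun (fun t => f t + g t).
Proof.
move=> [mf [b fb]] [mg [c gc]]; split; first exact: measurable_funD.
by exists (b + c) => t; rewrite (le_trans (ler_normD _ _))// lerD.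
Qed.

Lemma bounded_mfunM f g : bounded_mfun f -> bounded_mfun g -> bounded_mfun (fun t => f t * g t).
Proof.
move=> [mf [b fb]] [mg [c gc]]; split; first exact: measurable_funM.
by exists (b * c) => t; rewrite normrM ler_pM.
Qed.

Lemma bounded_mfun_sum I (s : seq I) (f : I -> T -> R) : (forall i, bounded_mfun (f i)) ->
  bounded_mfun (fun t => \sum_(i <- s) f i t).
Proof.
move=> bf; elim: s => [|i s IH].
  by under [X in bounded_mfun X]eq_fun do rewrite big_nil; exact: bounded_mfun_cst.
by under [X in bounded_mfun X]eq_fun do rewrite big_cons; exact: bounded_mfunD.
Qed.

Variable mu : {measure set T -> \bar R}.

Lemma bounded_mfun_integrable f A : measurable A -> (mu A < +oo)%E -> bounded_mfun f ->
  mu.-integrable A (EFin \o f).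
Proof.
move=> mA Aoo [mf [b fb]]; apply: measurable_bounded_integrable => //.
  exact: measurable_funTS.
exists b; split; first exact: num_real.
by move=> c bc t _; apply: le_trans (fb t) _; exact: ltW.
Qed.

Hypothesis muoo : (mu setT < +oo)%E.

Lemma bounded_integralE f : bounded_mfun f ->
  (\int[mu]_t (f t)%:E = (\int[mu]_t f t)%:E)%E.
Proof.
by move=> bf; rewrite /Rintegral fineK// integrable_fin_num//; exact: bounded_mfun_integrable.
Qed.

Lemma Rintegral_sum I (s : seq I) (f : I -> T -> R) : (forall i, bounded_mfun (f i)) ->
  \int[mu]_t (\sum_(i <- s) f i t) = \sum_(i <- s) \int[mu]_t f i t.
Proof.
move=> bf; elim: s => [|i s IH].
  rewrite big_nil; under eq_Rintegral do rewrite big_nil.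
  by rewrite Rintegral_cst// mul0r.
rewrite big_cons -IH; under eq_Rintegral do rewrite big_cons.
rewrite RintegralD//; apply: bounded_mfun_integrable => //.
exact: bounded_mfun_sum.
Qed.

End bounded_measurable.

Section iid.
Context {R : realType}.
Variables (D : nat) (P : probability (BorelR R D) R) (dT : measure_display)
  (T : measurableType dT) (Pr : probability T R) (X : nat -> T -> 'rV[R]_D).
Hypothesis hXmeas : forall i, measurable_fun setT (X i : T -> BorelR R D).
Hypothesis hXlaw : forall i (A : set (BorelR R D)), measurable A -> Pr (X i @^-1` A) = P A.
Hypothesis hXind : mutually_independent Pr X.

Let Proo : (Pr setT < +oo)%E. Proof. by rewrite probability_setT ltry. Qed.
Let Poo : (P setT < +oo)%E. Proof. by rewrite probability_setT ltry. Qed.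

Lemma bounded_mfun_sample (z : BorelR R D -> R) i : bounded_mfun z -> bounded_mfun (fun w => z (X i w)).
Proof.
move=> [mz [b zb]]; split; last by exists b => w.
exact: (measurableT_comp mz (hXmeas i)).
Qed.

Lemma expectation_sample (z : BorelR R D -> R) i : bounded_mfun z ->
  \int[Pr]_w z (X i w) = \int[P]_y z y.
Proof.
move=> bz; rewrite /Rintegral; congr fine.
transitivity (\int[pushforward Pr (X i : T -> BorelR R D)]_y (z y)%:E)%E.
  rewrite (integral_pushforward (hXmeas i))//.
  - by apply/measurable_EFinP; case: bz.
  - by rewrite preimage_setT; apply: bounded_mfun_integrable => //; exact: bounded_mfun_sample.
apply: (@eq_measure_integral _ _ _ _ P (pushm Pr (hXmeas i))) => A mA _.
exact: hXlaw.
Qed.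

Lemma expectation_sampleM (z : BorelR R D -> R) i j : bounded_mfun z -> i != j ->
  \int[Pr]_w (z (X i w) * z (X j w)) = (\int[P]_y z y) ^+ 2.
Proof.
move=> bz ij.
have mW : measurable_fun setT (fun w => (X i w, X j w) : (BorelR R D * BorelR R D)%type).
  exact: measurable_fun_pair.
pose F (p : (BorelR R D * BorelR R D)%type) : R := z p.1 * z p.2.
have bF : bounded_mfun F.
  case: bz => mz [b zb]; apply: bounded_mfunM; split.
  - exact: (measurableT_comp mz measurable_fst).
  - by exists b => p; exact: zb.
  - exact: (measurableT_comp mz measurable_snd).
  - by exists b => p; exact: zb.
have PPoo : ((P \x P)%E setT < +oo)%E.
  by rewrite -setXTT product_measure1E// lte_mul_pinfty// ge0_fin_numE.
have zI : P.-integrable setT (EFin \o z) by exact: bounded_mfun_integrable.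
rewrite /Rintegral.
transitivity (fine (\int[pushforward Pr (fun w => (X i w, X j w) : (BorelR R D * BorelR R D)%type)]_p (F p)%:E)%E).
  congr fine; rewrite (integral_pushforward mW)//.
  - by apply/measurable_EFinP; case: bF.
  - rewrite preimage_setT; apply: bounded_mfun_integrable => //.
    by apply: bounded_mfunM; exact: bounded_mfun_sample.
rewrite (@eq_measure_integral _ _ _ _ (P \x P)%E (pushm Pr mW)); last first.
  move=> A mA _; apply/esym; apply: product_measure_unique => // A1 A2 mA1 mA2.
  rewrite /= /pushm /pushforward.
  have u : uniq [:: i; j] by rewrite /= mem_seq1 ij.
  (* Independence over the list [i; j] gives the law of the pair on rectangles; the values at other
     indices are arbitrary. *)
  pose A12 k := if k == i then A1 else A2.
  have mA12 k : measurable (A12 k) by rewrite /A12; case: ifP.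
  have := hXind u mA12.
  rewrite !big_cons big_nil /A12 eqxx [j == i]eq_sym (negbTE ij) mule1 !hXlaw// => <-.
    congr (Pr _); apply/seteqP; split => w /=.
      move=> [A1w A2w] k; rewrite /= !inE => /orP[]/eqP->; first by rewrite eqxx.
      by rewrite eq_sym (negbTE ij).
    move=> h; have := h i; have := h j; rewrite /= !inE !eqxx orbT eq_sym (negbTE ij).
    by move=> /(_ isT) ? /(_ isT).
rewrite -(integral12_prod_meas1 (m1 := P) (m2 := P)); last exact: bounded_mfun_integrable.
pose m := \int[P]_y z y.
have inner x : (\int[P]_y (z x * z y)%:E = (z x * m)%:E)%E.
  rewrite bounded_integralE//; last by apply: bounded_mfunM => //; exact: bounded_mfun_cst.
  by rewrite RintegralZl.
rewrite /F /= /fubini_F /=; under eq_integral do rewrite inner.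
rewrite bounded_integralE//; last exact: (bounded_mfunM bz (bounded_mfun_cst _ m)).
by rewrite RintegralZr// -/m expr2.
Qed.

(** Center [k] and use (a + b)^2 <= 2 a^2 + 2 b^2; the variance is bounded by the second moment. For
    the estimator, [s] is 1/(n h^d). *)
Lemma mse_bound (k : BorelR R D -> R) (s p : R) n : bounded_mfun k ->
  (\int[Pr]_w ((s * \sum_(i < n) k (X i w) - p) ^+ 2)%:E <=
   (2 * s ^+ 2 * n%:R * \int[P]_y (k y ^+ 2) + 2 * (s * n%:R * \int[P]_y k y - p) ^+ 2)%:E)%E.
Proof.
move=> bk; pose m := \int[P]_y k y; pose z y := k y + - m.
have bz : bounded_mfun z by exact: (bounded_mfunD bk (bounded_mfun_cst _ (- m))).
have bk2 : bounded_mfun (fun y => k y * k y) by exact: bounded_mfunM.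
have bz2 : bounded_mfun (fun y => z y * z y) by exact: bounded_mfunM.
have P1 : fine (P setT) = 1 by rewrite probability_setT.
have Pr1 : fine (Pr setT) = 1 by rewrite probability_setT.
have I f : bounded_mfun f -> P.-integrable setT (EFin \o f) by exact: bounded_mfun_integrable.
have z0 : \int[P]_y z y = 0.
  rewrite RintegralD//; [|exact: I|by apply: I; exact: bounded_mfun_cst].
  by rewrite Rintegral_cst// P1 mulr1 subrr.
have zz : \int[P]_y (z y * z y) <= \int[P]_y (k y ^+ 2).
  rewrite (_ : (fun y => z y * z y) = (fun y => (k y * k y) + ((- (2 * m)) * k y + m ^+ 2))); last first.
    by apply/funext => y; rewrite /z; ring.
  have bmk : bounded_mfun (fun y => (- (2 * m)) * k y).
    exact: (bounded_mfunM (bounded_mfun_cst _ (- (2 * m))) bk).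
  have bc : bounded_mfun (fun _ : BorelR R D => m ^+ 2) by exact: bounded_mfun_cst.
  rewrite RintegralD//; [|exact: I|by apply: I; exact: bounded_mfunD].
  rewrite RintegralD//; [|exact: I|exact: I].
  rewrite RintegralZl//; last exact: I.
  rewrite Rintegral_cst// P1 mulr1 -/m.
  under eq_Rintegral do rewrite -expr2.
  by have := sqr_ge0 m; lra.
pose Z i w := z (X i w).
have bZ i : bounded_mfun (Z i) by exact: bounded_mfun_sample.
have bSZ : bounded_mfun (fun w => \sum_(i <- index_enum 'I_n) Z i w) by exact: bounded_mfun_sum.
have bSZ2 : bounded_mfun (fun w => (\sum_(i < n) Z i w) * (\sum_(i < n) Z i w)) by exact: bounded_mfunM.
have EZ : \int[Pr]_w ((\sum_(i < n) Z i w) * (\sum_(i < n) Z i w)) <= n%:R * \int[P]_y (k y ^+ 2).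
  under eq_Rintegral do rewrite mulr_suml.
  rewrite Rintegral_sum//; last by move=> i; exact: bounded_mfunM.
  rewrite (@le_trans _ _ (\sum_(i < n) \int[P]_y (k y ^+ 2)))//; last first.
    by rewrite sumr_const card_ord mulr_natl.
  apply: ler_sum => i _; under eq_Rintegral do rewrite mulr_sumr.
  rewrite Rintegral_sum//; last by move=> j; exact: bounded_mfunM.
  (* The cross terms are products of independent centered variables and vanish. *)
  rewrite (bigD1 i)//= big1 ?addr0; last first.
    by move=> j ji; rewrite expectation_sampleM// ?z0 ?expr0n// eq_sym.
  by rewrite (expectation_sample _ bz2).
pose b := s * n%:R * m - p.
have bub : bounded_mfun (fun w => 2 * s ^+ 2 * ((\sum_(i < n) Z i w) * (\sum_(i < n) Z i w)) + 2 * b ^+ 2).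
  exact: (bounded_mfunD (bounded_mfunM (bounded_mfun_cst _ (2 * s ^+ 2)) bSZ2) (bounded_mfun_cst _ (2 * b ^+ 2))).
apply: (@le_trans _ _ (\int[Pr]_w (2 * s ^+ 2 * ((\sum_(i < n) Z i w) * (\sum_(i < n) Z i w)) + 2 * b ^+ 2)%:E)%E).
  apply: ge0_le_integral => //.
  - by move=> w _; rewrite lee_fin sqr_ge0.
  - apply/measurable_EFinP; apply: measurable_funX; apply: measurable_funB => //.
    by apply: measurable_funM => //; apply: measurable_sum => i; exact: (bounded_mfun_sample _ bk).1.
  - by apply/measurable_EFinP; case: bub.
  move=> w _; rewrite lee_fin.
  have -> : \sum_(i < n) k (X i w) = \sum_(i < n) Z i w + n%:R * m.
    rewrite [RHS](_ : _ = \sum_(i < n) (Z i w + m)).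
      by apply: eq_bigr => i _; rewrite /Z /z subrK.
    by rewrite [RHS]big_split/= sumr_const card_ord -[m *+ n]mulr_natl.
  rewrite /b; move: (\sum_(i < n) _) => S.
  have : 0 <= (s * S - (s * n%:R * m - p)) ^+ 2 by exact: sqr_ge0.
  move: (n%:R) => nn; nra.
rewrite bounded_integralE// lee_fin RintegralD//; last 2 first.
- by apply: bounded_mfun_integrable => //; exact: (bounded_mfunM (bounded_mfun_cst _ (2 * s ^+ 2)) bSZ2).
- by apply: bounded_mfun_integrable => //; exact: bounded_mfun_cst.
rewrite RintegralZl//; last exact: bounded_mfun_integrable.
rewrite Rintegral_cst// Pr1 mulr1 lerD2r -[leRHS]mulrA.
by rewrite ler_wpM2l// mulr_ge0// sqr_ge0.
Qed.

End iid.

(** * Integration against a density and comparison of measures *)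

Section integral_tools.
Context d (T : measurableType d) {R : realType}.
Import HBNNSimple.

(** Monotone approximation by simple functions, valid for any measure [mu]: H^d on R^D is not
    sigma-finite when d < D. *)
Lemma integral_density_ge0 (mu P : {measure set T -> \bar R}) (p : T -> R) (f : T -> \bar R) :
  (forall t, 0 <= p t) -> measurable_fun setT p ->
  (forall A, measurable A -> P A = \int[mu]_(t in A) (p t)%:E)%E ->
  measurable_fun setT f -> (forall t, 0 <= f t)%E ->
  (\int[P]_t f t = \int[mu]_t (f t * (p t)%:E))%E.
Proof.
move=> p0 mp Pp mf f0; pose h := nnsfun_approx measurableT mf.
have hf t : (h n t)%:E @[n --> \oo] --> f t by apply: cvg_nnsfun_approx => // x _; exact: f0.
have nd t : nondecreasing_seq (fun n => h n t) by move=> a b ab; exact/lefP/nd_nnsfun_approx.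
transitivity (limn (fun n => \int[P]_t (h n t)%:E)%E).
  rewrite -monotone_convergence//.
  - by apply: eq_integral => t _; apply/esym/cvg_lim => //; exact: hf.
  - by move=> n; exact/measurable_EFinP/measurable_funP.
  - by move=> n t _; rewrite lee_fin.
  - by move=> t _ a b ab; rewrite lee_fin nd.
have mpe : measurable_fun setT (EFin \o p) by exact/measurable_EFinP.
transitivity (limn (fun n => \int[mu]_t ((h n t)%:E * (p t)%:E))%E); last first.
  rewrite -monotone_convergence//.
  - apply: eq_integral => t _; apply/cvg_lim => //; apply: cvgeZr => //; exact: hf.
  - by move=> n; apply: emeasurable_funM => //; exact/measurable_EFinP/measurable_funP.
  - by move=> n t _; rewrite mule_ge0// lee_fin.
  - by move=> t _ a b ab; rewrite lee_wpmul2r ?lee_fin// nd.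
congr (limn _); apply/funext => n.
rewrite integralT_nnsfun sintegralE.
have p0e t : (0 <= (p t)%:E)%E by rewrite lee_fin.
have mh x : measurable_fun setT (fun t => (x * \1_(h n @^-1` [set x]) t)%:E).
  by apply/measurable_EFinP; apply: measurable_funM.
transitivity (\int[mu]_t (\sum_(x \in range (h n)) ((x * \1_(h n @^-1` [set x]) t)%:E * (p t)%:E)))%E; last first.
  apply: eq_integral => t _.
  by rewrite -ge0_mule_fsuml ?fsumEFin// -?fimfunE// => x; exact: nnfun_muleindic_ge0.
rewrite ge0_integral_fsum//; last 2 first.
- by move=> x; exact: emeasurable_funM.
- by move=> x t _; rewrite mule_ge0// nnfun_muleindic_ge0.
apply: eq_fsbigr => x /set_mem[t0 _ hx].
have x0 : 0 <= x by rewrite -hx.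
have mhx : measurable (h n @^-1` [set x]) by [].
rewrite Pp// [in LHS]integral_mkcond.
under [RHS]eq_integral do rewrite EFinM -muleA.
rewrite ge0_integralZl//; last 2 first.
- by apply: emeasurable_funM => //; apply/measurable_EFinP.
- by move=> t _; rewrite mule_ge0// lee_fin.
by congr (_ * _)%E; apply: eq_integral => t _; rewrite epatch_indic muleC.
Qed.

(* Compare the integrals of the nonnegative functions [G + M] and [M - G]. *)
Lemma le_bounded_integral_measure (nu la : {measure set T -> \bar R}) (B : set T) (e M : R) (G : T -> R) :
  measurable B -> 0 <= e -> (la B < +oo)%E -> (la B <= nu B)%E ->
  (forall A, measurable A -> A `<=` B -> nu A <= (1 + e)%:E * la A)%E ->
  measurable_fun setT G -> (forall t, `|G t| <= M) ->
  `|\int[nu]_(t in B) G t - \int[la]_(t in B) G t| <= 2 * e * M * fine (la B).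
Proof.
move=> mB e0 laB lanu nula mG GM.
have nuB : (nu B < +oo)%E.
  by rewrite (le_lt_trans (nula B _ _))// lte_mul_pinfty// ?lee_fin ?addr_ge0// ge0_fin_numE.
have bG : bounded_mfun G by split => //; exists M.
have e10 : 0 <= 1 + e by rewrite addr_ge0.
have up (F : T -> R) : (forall t, 0 <= F t) -> bounded_mfun F ->
    \int[nu]_(t in B) F t <= (1 + e) * \int[la]_(t in B) F t.
  move=> F0 bF; have mF : measurable_fun setT (EFin \o F) by apply/measurable_EFinP; case: bF.
  rewrite -lee_fin EFinM /Rintegral !fineK ?integrable_fin_num//; try exact: bounded_mfun_integrable.
  have F0e t : (0 <= (F t)%:E)%E by rewrite lee_fin.
  rewrite (@eq_measure_integral _ _ _ _ (mrestr nu mB)); last first.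
    by move=> A mA AB; rewrite /= /mrestr (setIidl AB).
  rewrite [in leRHS](@eq_measure_integral _ _ _ _ (mrestr la mB)); last first.
    by move=> A mA AB; rewrite /= /mrestr (setIidl AB).
  rewrite -[1 + e]/((NngNum e10)%:num) -ge0_integral_mscale//; last exact: measurable_funTS.
  apply: ge0_le_measure_integral => // A mA.
  by rewrite /mscale /mrestr /= nula//; exact: measurableI.
have bc : bounded_mfun (fun _ : T => M) by exact: bounded_mfun_cst.
have I (m : {measure set T -> \bar R}) f : (m B < +oo)%E -> bounded_mfun f -> m.-integrable B (EFin \o f).
  by move=> mBoo; exact: bounded_mfun_integrable.
have h1 : \int[nu]_(t in B) G t + M * fine (nu B) <= (1 + e) * (\int[la]_(t in B) G t + M * fine (la B)).
  rewrite -!Rintegral_cst// -!RintegralD//; try exact: I.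
  apply: up; last exact: bounded_mfunD.
  by move=> t; have := GM t; rewrite ler_norml => /andP[? _]; lra.
have bN : bounded_mfun (fun t => -1 * G t) by exact: (bounded_mfunM (bounded_mfun_cst _ (-1)) bG).
have h2 : M * fine (nu B) - \int[nu]_(t in B) G t <= (1 + e) * (M * fine (la B) - \int[la]_(t in B) G t).
  rewrite -!Rintegral_cst// -!RintegralB//; try exact: I.
  apply: up; first by move=> t; have := GM t; rewrite ler_norml => /andP[_ ?]; lra.
  rewrite (_ : (fun t => M - G t) = (fun t => M + -1 * G t)); first exact: bounded_mfunD.
  by apply/funext => t; rewrite mulN1r.
have MB : `|\int[la]_(t in B) G t| <= M * fine (la B).
  rewrite -(@Rintegral_cst _ _ _ la)//; apply: le_trans (le_normr_Rintegral _ _) _ => //; first exact: I.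
  by apply: le_Rintegral => //; [apply: (I _ (fun t => `|G t|)) => //; split; [exact: measurableT_comp|exists M => t; rewrite normr_id] | exact: I].
have nl : fine (la B) <= fine (nu B) by rewrite fine_le// ge0_fin_numE.
have M0 : M * fine (la B) <= M * fine (nu B).
  have [[t _]|B0] := pselect (exists t, B t).
    by rewrite ler_wpM2l// (le_trans _ (GM t)).
  have -> : B = set0 by rewrite -subset0 => t Bt; apply: B0; exists t.
  by rewrite !measure0.
move: MB; rewrite ler_norml => /andP[MB1 MB2].
rewrite ler_norml; apply/andP; split; nra.
Qed.

End integral_tools.

Section integral_density.
Context d (T : measurableType d) {R : realType}.
Variables (mu : {measure set T -> \bar R}) (P : {measure set T -> \bar R}) (p : T -> R).
Hypothesis Poo : (P setT < +oo)%E.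
Hypothesis p0 : forall t, 0 <= p t.
Hypothesis mp : measurable_fun setT p.
Hypothesis Pp : forall A, measurable A -> (P A = \int[mu]_(t in A) (p t)%:E)%E.

Lemma density_integrable f : bounded_mfun f -> mu.-integrable setT (EFin \o (fun t => f t * p t)).
Proof.
move=> [mf [M fM]].
have ip : mu.-integrable setT (EFin \o p).
  apply/integrableP; split; first exact/measurable_EFinP.
  under eq_integral do rewrite /= ger0_norm//.
  by rewrite -Pp.
apply: (le_integrable _ _ _ (integrableZl measurableT M ip)) => //.
  by apply/measurable_EFinP; exact: measurable_funM.
move=> t _; rewrite /= lee_fin !normrM ler_wpM2r// (le_trans (fM t))// ler_norm//.
Qed.

(** Apply the nonnegative case to [f + M] and to [M], then subtract; both integrals are finite
    because [P] is. *)
Lemma Rintegral_density f : bounded_mfun f -> \int[P]_t f t = \int[mu]_t (f t * p t).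
Proof.
move=> bf; have [mf [M fM]] := bf.
have bM : bounded_mfun (fun _ : T => M) by exact: bounded_mfun_cst.
have nn g : bounded_mfun g -> (forall t, 0 <= g t) -> \int[P]_t g t = \int[mu]_t (g t * p t).
  move=> [mg _] g0; congr fine; apply: (integral_density_ge0 p0 mp Pp) => [|t]; last by rewrite lee_fin.
  exact/measurable_EFinP.
have M0 : forall t : T, 0 <= M by move=> t; rewrite (le_trans _ (fM t)).
have fM0 t : 0 <= f t + M by have := fM t; rewrite ler_norml => /andP[? _]; rewrite -lerBlDr sub0r.
have := nn _ (bounded_mfunD bf bM) fM0.
rewrite RintegralD//; try exact: bounded_mfun_integrable.
rewrite (nn (fun=> M))//.
under [X in _ = X -> _]eq_Rintegral do rewrite mulrDl.
rewrite RintegralD//; [by move/addIr|exact: density_integrable|exact: (density_integrable bM)].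
Qed.

End integral_density.

(** * The kernel *)

Section kernel.
Context {R : realType}.
Variables (D d : nat) (hdD : (d <= D)%N) (K : R -> R).
Hypothesis hKsupp : forall t, 1 < t -> K t = 0.
Hypothesis hKC2 : Ck 2 (fun u : 'rV[R]_D => K (enorm u)) setT.

(* Only the profile [K] along a coordinate axis of R^D enters. If [D = 0] every norm
   is [0] and the claim is empty. *)
Lemma kernel_lipschitz : exists LK, 0 <= LK /\
  forall u v : 'rV[R]_D, `|K (enorm u) - K (enorm v)| <= LK * `|enorm u - enorm v|.
Proof.
case: D hKC2 => [|D'] hK.
  exists 0; split => // u v; rewrite (_ : u = v) ?subrr ?normr0 ?mulr0//.
  by apply/rowP => -[].
pose e : 'rV[R]_D'.+1 := ebasis ord0.
pose kap (u : 'rV[R]_D'.+1) : R := K (enorm u).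
have [_ /(_ ord0)[dK [cK _]]] := hK.
have ne (t : R) : enorm (0 + t *: e) = `|t|.
  rewrite add0r enormZ (_ : enorm e = 1) ?mulr1// /enorm big_ord_recl big1; last first.
    by move=> i _; rewrite mxE /= expr0n.
  by rewrite mxE eqxx addr0 expr1n sqrtr1.
pose f (t : R) : R := kap (0 + t *: e).
pose df (t : R) : R := 'D_e kap (0 + t *: e).
have fE (t : R) : 0 <= t -> f t = K t by move=> t0; rewrite /f /kap ne ger0_norm.
have fd (t : R) : is_derive t (1 : R) f (df t).
  by apply: is_derive_line; apply/derivableP; exact: dK.
have cline (t : R) : {for t, continuous (fun t : R => 0 + t *: e : 'rV[R]_D'.+1)}.
  by apply: cvgD; [exact: cvg_cst|apply: cvgZl; exact: cvg_id].
have cdf : continuous (fun t => `|df t|).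
  move=> t; apply: cvg_norm; apply: (@continuous_comp _ _ _ (fun t : R => 0 + t *: e) ('D_e kap)).
    exact: cline.
  by apply: cK; rewrite inE.
(* [K] vanishes beyond 1, so a bound for its derivative on [0, 2] controls it everywhere. *)
have [|c _ cmax] := @EVT_max R (fun t => `|df t|) 0 2 (ler0n R 2).
  exact: continuous_subspaceT.
pose LK : R := `|df c|.
have LK0 : 0 <= LK by exact: normr_ge0.
have lip (s t : R) : 0 <= s -> s <= t -> t <= 2 -> `|K s - K t| <= LK * `|s - t|.
  move=> s0 st t2; rewrite -!fE//; last exact: le_trans st.
  have [z] := @mean_value_line R f df t s (fun z _ => fd z).
  rewrite minEle maxEle; case: ifPn => [ts|nts].
    have -> : s = t by apply/eqP; rewrite eq_le st ts.
    by move=> _ _; rewrite subrr normr0 mulr_ge0.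
  move=> /andP[sz zt] ->; rewrite normrM ler_wpM2r// cmax// in_itv /= (le_trans s0 sz) (le_trans zt t2)//.
exists LK; split => // u v.
have hw (s t : R) : 0 <= s -> s <= t -> `|K s - K t| <= LK * `|s - t|.
  move=> s0 st; have [t2|t2] := leP t 2; first exact: lip.
  rewrite (hKsupp (lt_trans _ t2))//; last by lra.
  have [s1|s1] := leP s 1; last by rewrite hKsupp// subrr normr0 mulr_ge0.
  (* Past 2 the value 0 is replaced by [K 2], which brings the pair back to [0, 2] and only shortens
     the distance. *)
  rewrite -(@hKsupp 2)//; last by lra.
  have s2 : s <= 2 by lra.
  rewrite (le_trans (lip _ _ s0 s2 (lexx _)))// ler_wpM2l// distrC [leRHS]distrC !ger0_norm; lra.
case/orP: (le_total (enorm u) (enorm v)) => uv; first exact: hw (enorm_ge0 _) uv.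
by rewrite distrC [X in _ * X]distrC; exact: hw (enorm_ge0 _) uv.
Qed.

Lemma kernel_bounded : exists KB, 0 <= KB /\ forall u : 'rV[R]_D, `|K (enorm u)| <= KB.
Proof.
have [LK [LK0 lip]] := kernel_lipschitz.
have z : enorm (0 : 'rV[R]_D) = 0 by rewrite enorm0.
exists (`|K 0| + LK); split=> [|u]; first by rewrite addr_ge0.
have [u1|u1] := leP (enorm u) 1; last by rewrite hKsupp// normr0 addr_ge0.
have := lip u 0; rewrite z subr0 (ger0_norm (enorm_ge0 u)) => h.
rewrite -[K (enorm u)](subrK (K 0)) (le_trans (ler_normD _ _))// addrC lerD2l.
by rewrite (le_trans h)// ler_piMr.
Qed.

(** The smoothness of the kernel is given on R^D while its moments are taken on R^d; an isometric
    embedding transfers radial bounds. *)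
Lemma enorm_lift (v : 'rV[R]_d) : exists u : 'rV[R]_D, enorm u = enorm v.
Proof.
exists (v *m pid_mx d); apply: enorm_isometry.
by rewrite tr_pid_mx pid_mx_id// pid_mx_1.
Qed.

Lemma measurable_radial : measurable_fun setT (fun u : BorelR R D => K (enorm (u : 'rV[R]_D))).
Proof.
apply: (@continuous_Borel_real R D (fun u => K (enorm u))) => u.
by case: hKC2 => cK _; apply: cK; rewrite inE.
Qed.

Lemma measurable_radial_lift : measurable_fun setT (fun v : BorelR R d => K (enorm (v : 'rV[R]_d))).
Proof.
pose L : 'M[R]_(d, D) := pid_mx d.
have LL : L *m L^T = 1%:M by rewrite tr_pid_mx pid_mx_id// pid_mx_1.
under eq_fun do rewrite -(enorm_isometry LL).
exact: (measurableT_comp measurable_radial (measurable_mulmx L)).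
Qed.

End kernel.

Section kernel_moments.
Context {R : realType}.

Lemma edot0l n (u : 'rV[R]_n) : edot 0 u = 0.
Proof. by rewrite -(scale0r 0) edotZl mul0r. Qed.

Lemma norm_edot_le n (u v : 'rV[R]_n) : `|edot u v| <= enorm u * enorm v.
Proof.
rewrite ler_norml edot_le andbT lerNl -mulN1r -edotZl scaleN1r.
by rewrite -(enormN u) edot_le.
Qed.

Lemma measurable_affine n (a : R) (x : 'rV[R]_n) :
  measurable_fun setT (fun u : BorelR R n => a *: ((u : 'rV[R]_n) - x) : BorelR R n).
Proof.
apply: measurable_fun_row => i; under eq_fun do rewrite !mxE.
by apply: measurable_funM => //; apply: measurable_funB => //; exact: measurable_coord.
Qed.

Lemma bounded_mfun_scale n (K : R -> R) (x : 'rV[R]_n) (h : R) : 0 < h ->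
  bounded_mfun (fun u : BorelR R n => K (enorm (u : 'rV[R]_n))) ->
  bounded_mfun (fun u : BorelR R n => K (enorm ((u : 'rV[R]_n) - x) / h)).
Proof.
move=> h0 [mK [b Kb]].
have E u : enorm (u - x) / h = enorm (h^-1 *: (u - x)) by rewrite enormZ gtr0_norm ?invr_gt0// mulrC.
split; last by exists b => u; rewrite E.
by under eq_fun do rewrite E; exact: (measurableT_comp mK (measurable_affine _ x)).
Qed.

(** Used with [s = -1], to annihilate odd integrands, and with [s = h], to reduce to the unit
    ball. *)
Lemma Rintegral_leb_scale n (s : R) (A : set (BorelR R n)) (f : BorelR R n -> R) :
  s != 0 -> measurable A -> (leb n A < +oo)%E -> bounded_mfun f ->
  \int[leb n]_(u in (fun u : BorelR R n => s *: (u : 'rV[R]_n) : BorelR R n) @^-1` A) f (s *: (u : 'rV[R]_n)) =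
  `|s| ^- n * \int[leb n]_(u in A) f u.
Proof.
move=> s0 mA Aoo bf; have [mf [M fM]] := bf.
pose phi := fun u : BorelR R n => s *: (u : 'rV[R]_n) : BorelR R n.
have mphi : measurable_fun setT phi.
  by have := measurable_affine s (0 : 'rV[R]_n); under eq_fun do rewrite subr0.
have mpA : measurable (phi @^-1` A) by rewrite -[X in measurable X]setTI; exact: mphi.
have sn0 : 0 <= `|s| ^- n by rewrite invr_ge0 exprn_ge0.
have pAoo : (leb n (phi @^-1` A) < +oo)%E.
  by rewrite leb_scale// lte_mul_pinfty// ?lee_fin// ge0_fin_numE.
have nn g : bounded_mfun g -> (forall u, 0 <= g u) ->
    \int[leb n]_(u in phi @^-1` A) g (phi u) = `|s| ^- n * \int[leb n]_(u in A) g u.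
  move=> bg g0; have [mg _] := bg.
  have mge : measurable_fun setT (EFin \o g) by exact/measurable_EFinP.
  rewrite /Rintegral -[X in X * _]/(fine (`|s| ^- n)%:E) -fineM//; last first.
    by rewrite integrable_fin_num//; exact: bounded_mfun_integrable.
  congr fine.
  transitivity (\int[pushm (leb n) mphi]_(u in A) (g u)%:E)%E.
    rewrite /= /pushm ge0_integral_pushforward//; first exact: measurable_funTS.
    by move=> y ?; rewrite lee_fin.
  rewrite -[`|s| ^- n]/((NngNum sn0)%:num) -ge0_integral_mscale//; last 2 first.
    exact: measurable_funTS.
    by move=> u ?; rewrite lee_fin.
  by apply: eq_measure_integral => B mB _; rewrite /= /mscale /pushm /pushforward leb_scale.
have bM : bounded_mfun (fun _ : BorelR R n => M) by exact: bounded_mfun_cst.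
have fM0 u : 0 <= f u + M by have := fM u; rewrite ler_norml => /andP[? _]; rewrite -lerBlDr sub0r.
have bfp : bounded_mfun (f \o phi).
  by split; [exact: measurableT_comp|exists M => u; exact: fM].
have := nn _ (bounded_mfunD bf bM) fM0.
rewrite RintegralD//; [|exact: (bounded_mfun_integrable _ _ bfp)|exact: bounded_mfun_integrable].
rewrite RintegralD//; [|exact: bounded_mfun_integrable|exact: bounded_mfun_integrable].
rewrite (nn (fun=> M))//; first by rewrite mulrDr => /addIr.
by move=> u; rewrite (le_trans _ (fM u)).
Qed.

Variables (n : nat) (K : R -> R).
Hypothesis hKsupp : forall t, 1 < t -> K t = 0.
Hypothesis bK : bounded_mfun (fun u : BorelR R n => K (enorm (u : 'rV[R]_n))).
Hypothesis hKint : (\int[leb n]_u (K (enorm (u : 'rV[R]_n)))%:E)%E = 1%E.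

Lemma bounded_mfun_kernel_affine h (p0 : R) (b : 'rV[R]_n) : 0 < h ->
  bounded_mfun (fun u : BorelR R n => K (enorm (u : 'rV[R]_n) / h) * (p0 + edot b u)).
Proof.
move=> h0; have [mKh [B KB]] : bounded_mfun (fun u : BorelR R n => K (enorm (u : 'rV[R]_n) / h)).
  by have := bounded_mfun_scale 0 h0 bK; under eq_fun do rewrite subr0.
split.
  apply: measurable_funM => //; apply: measurable_funD => //.
  rewrite /edot; apply: measurable_sum => i; apply: measurable_funM => //; exact: measurable_coord.
exists (B * (`|p0| + enorm b * h)) => u.
have [uh|uh] := leP (enorm (u : 'rV[R]_n)) h.
  rewrite normrM ler_pM// (le_trans (ler_normD _ _))// lerD2l (le_trans (norm_edot_le _ _))//.
  by rewrite ler_wpM2l// enorm_ge0.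
rewrite hKsupp ?ltr_pdivlMr ?mul1r// mul0r normr0 mulr_ge0//.
  exact: le_trans (KB 0).
by rewrite addr_ge0// mulr_ge0// ?enorm_ge0// ltW.
Qed.

(** Reflection kills the linear part; dilation by [h] reduces the constant part to [hKint], since
    [K] vanishes outside the unit ball. *)
Lemma kernel_moment h (p0 : R) (b : 'rV[R]_n) : 0 < h ->
  \int[leb n]_(u in @cball R n h) (K (enorm (u : 'rV[R]_n) / h) * (p0 + edot b u)) = p0 * h ^+ n.
Proof.
move=> h0; have mB := @measurable_cball R n.
have Boo r : 0 < r -> (leb n (@cball R n r) < +oo)%E by move=> r0; rewrite leb_cball// ltry.
have aff := bounded_mfun_kernel_affine _ _ h0.
have I p b' := bounded_mfun_integrable (mB h) (Boo h h0) (aff p b').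
have -> : \int[leb n]_(u in @cball R n h) (K (enorm (u : 'rV[R]_n) / h) * (p0 + edot b u)) =
    p0 * \int[leb n]_(u in @cball R n h) (K (enorm (u : 'rV[R]_n) / h) * (1 + edot 0 u)) +
    \int[leb n]_(u in @cball R n h) (K (enorm (u : 'rV[R]_n) / h) * (0 + edot b u)).
  rewrite -RintegralZl// -RintegralD//; last first.
    by apply: (integrableZl _ p0 (I 1 0)).
  apply: eq_Rintegral => u _; rewrite edot0l; ring.
have -> : \int[leb n]_(u in @cball R n h) (K (enorm (u : 'rV[R]_n) / h) * (0 + edot b u)) = 0.
  have := @Rintegral_leb_scale n (-1) (@cball R n h) _ _ (mB h) (Boo h h0) (aff 0 b).
  rewrite oppr_eq0 oner_eq0 normrN normr1 expr1n invr1 mul1r => /(_ erefl).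
  have -> : (fun u : BorelR R n => -1 *: (u : 'rV[R]_n)) @^-1` (@cball R n h) = @cball R n h.
    by apply/seteqP; split=> u; rewrite /cball /= scaleN1r enormN.
  have -> : \int[leb n]_(u in @cball R n h) (K (enorm (-1 *: (u : 'rV[R]_n)) / h) * (0 + edot b (-1 *: (u : 'rV[R]_n)))) =
     - \int[leb n]_(u in @cball R n h) (K (enorm (u : 'rV[R]_n) / h) * (0 + edot b u)).
    rewrite -[RHS]mulN1r -RintegralZl//.
    by apply: eq_Rintegral => u _; rewrite edotZr scaleN1r enormN; ring.
  by lra.
rewrite addr0; congr (_ * _).
have := @Rintegral_leb_scale n h (@cball R n h) _ _ (mB h) (Boo h h0) (aff 1 0).
rewrite gt_eqF// => /(_ erefl).
have -> : (fun u : BorelR R n => h *: (u : 'rV[R]_n)) @^-1` (@cball R n h) = @cball R n 1.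
  by apply/seteqP; split=> u; rewrite /cball /= enormZ gtr0_norm// ger_pMr.
rewrite gtr0_norm//.
have -> : \int[leb n]_(u in @cball R n 1) (K (enorm (h *: (u : 'rV[R]_n)) / h) * (1 + edot 0 (h *: (u : 'rV[R]_n)))) = 1.
  rewrite /Rintegral [X in fine X](_ : _ = 1%E)// -[RHS]hKint integral_mkcond.
  apply: eq_integral => u _; rewrite patchE enormZ gtr0_norm// mulrAC mulfV ?gt_eqF// mul1r edot0l addr0 mulr1.
  case: ifPn => //; rewrite notin_setE /cball /= => /negP; rewrite -ltNge => u1.
  by rewrite hKsupp.
move=> /esym/(congr1 (fun x => h ^+ n * x)); rewrite mulrA mulfV ?mul1r ?mulr1//.
by rewrite expf_neq0// gt_eqF.
Qed.

End kernel_moments.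

(** * Local moments of the kernel *)

Section local_moments.
Context {R : realType}.

Lemma Rintegral_approx dT (T : measurableType dT) (m : {measure set T -> \bar R}) (E : set T) (f g : T -> R) c :
  measurable E -> (m E < +oo)%E -> m.-integrable E (EFin \o f) -> m.-integrable E (EFin \o g) ->
  (forall t, E t -> `|f t - g t| <= c) ->
  `|\int[m]_(t in E) f t - \int[m]_(t in E) g t| <= c * fine (m E).
Proof.
move=> mE Eoo fi gi fg; rewrite -RintegralB// -(@Rintegral_cst _ _ _ m)//.
have i1 : m.-integrable E (EFin \o (fun t => f t - g t)) by exact: (integrableB mE fi gi).
apply: le_trans (le_normr_Rintegral mE i1) _; apply: le_Rintegral => //.
  exact: integrable_norm.
exact: bounded_mfun_integrable (bounded_mfun_cst _ _).
Qed.

Variables (D d : nat) (hdD : (d <= D)%N) (Omega : set 'rV[R]_D)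
  (mu : {measure set (BorelR R D) -> \bar R}).
Hypothesis hmu : forall A : set (BorelR R D), measurable A -> mu A = hausdorff d A.
Variables (P : probability (BorelR R D) R) (p : 'rV[R]_D -> R).
Hypothesis hp0 : forall y, 0 <= p y.
Hypothesis hpOmega : forall y, ~ Omega y -> p y = 0.
Hypothesis hpmeas : measurable_fun setT (p : BorelR R D -> R).
Hypothesis hdens : forall A : set (BorelR R D), measurable A -> P A = (\int[mu]_(y in A) (p y)%:E)%E.
Variable K : R -> R.
Hypothesis hKsupp : forall t, 1 < t -> K t = 0.
Hypothesis hKint : (\int[leb d]_u (K (enorm (u : 'rV[R]_d)))%:E)%E = 1%E.
Hypothesis hKC2 : Ck 2 (fun u : 'rV[R]_D => K (enorm u)) setT.

(** The Lipschitz bound compares vectors of different dimensions: [w] is y - x in R^D and [v] its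
    tangent projection in R^d. *)
Lemma kernel_constants : exists LK KB : R, [/\ 0 <= LK, 0 <= KB,
  forall (w : 'rV[R]_D) (v : 'rV[R]_d) h, 0 < h ->
    `|K (enorm w / h) - K (enorm v / h)| <= LK * (`|enorm w - enorm v| / h),
  forall (w : 'rV[R]_D) h, 0 < h -> `|K (enorm w / h)| <= KB &
  forall (v : 'rV[R]_d) h, 0 < h -> `|K (enorm v / h)| <= KB].
Proof.
have [LK [LK0 lip]] := kernel_lipschitz hKsupp hKC2.
have [KB [KB0 bd]] := kernel_bounded hKsupp hKC2.
have sc m (w : 'rV[R]_m) h : 0 < h -> enorm w / h = enorm (h^-1 *: w).
  by move=> h0; rewrite enormZ gtr0_norm ?invr_gt0// mulrC.
exists LK, KB; split => // [w v h h0|w h h0|v h h0].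
- have [v' v'E] := enorm_lift hdD (h^-1 *: v).
  have E : `|enorm w - enorm v| / h = `|enorm w / h - enorm v / h|.
    by rewrite -mulrBl normrM (gtr0_norm (x := h^-1)) ?invr_gt0.
  by rewrite E !sc// -v'E; exact: lip.
- by rewrite sc.
- by have [v' v'E] := enorm_lift hdD (h^-1 *: v); rewrite sc// -v'E.
Qed.

Lemma bounded_mfun_sample_kernel (x : 'rV[R]_D) h : 0 < h ->
  bounded_mfun (fun y : BorelR R D => K (enorm ((y : 'rV[R]_D) - x) / h)).
Proof.
move=> h0; apply: bounded_mfun_scale => //; split; first exact: (measurable_radial hKC2).
by have [KB [_ bd]] := kernel_bounded hKsupp hKC2; exists KB.
Qed.

Lemma bounded_mfun_chart_kernel : bounded_mfun (fun v : BorelR R d => K (enorm (v : 'rV[R]_d))).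
Proof.
split; first exact: (measurable_radial_lift hdD hKC2).
have [LK [KB [_ _ _ _ bd]]] := kernel_constants; exists KB => v.
by have := bd v 1 ltr01; rewrite divr1.
Qed.

(** Points of Omega within [h] of [x] project into the ball of radius [h]. The chart set over that
    ball may be larger, but there the kernel vanishes. [f] is the identity for the bias and the
    square for the variance. *)
Lemma Rintegral_kernel_support (x : 'rV[R]_D) (L : 'M[R]_(d, D)) r1 h (f : R -> R) :
  L *m L^T = 1%:M -> 0 < h -> h < r1 -> measurable (Omega `&` eball x r1 : set (BorelR R D)) ->
  f 0 = 0 -> bounded_mfun (fun y : BorelR R D => f (K (enorm ((y : 'rV[R]_D) - x) / h))) ->
  \int[P]_y f (K (enorm ((y : 'rV[R]_D) - x) / h)) =
  \int[mu]_(y in chart_set Omega L x r1 (@cball R d h)) (f (K (enorm ((y : 'rV[R]_D) - x) / h)) * p y).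
Proof.
move=> LL h0 hr mO f0 bf.
have Poo : (P setT < +oo)%E by rewrite probability_setT ltry.
rewrite (Rintegral_density Poo hp0 hpmeas hdens)//.
rewrite [RHS]/Rintegral integral_mkcond; congr fine; apply: eq_integral => y _.
rewrite patchE; case: ifPn => //; rewrite notin_setE => nE.
have [Oy|nOy] := pselect (Omega y); last by rewrite hpOmega// mulr0.
have [yh|yh] := leP (enorm ((y : 'rV[R]_D) - x)) h; last first.
  by rewrite hKsupp ?f0 ?mul0r// ltr_pdivlMr ?mul1r.
exfalso; apply: nE; split; first by split => //; exact: le_lt_trans hr.
by rewrite /cball /= (le_trans _ yh)//; exact: enorm_proj.
Qed.

(** The integrand depends on the projection only, so the integral is over R^d for the pushforward
    [nu] of [mu] restricted to the chart set; [nu] exceeds Lebesgue measure by a factor at most 1 +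
    Kc h^2 on the ball. *)
Lemma chart_integral_approx (x : 'rV[R]_D) (L : 'M[R]_(d, D)) (r1 Kc h p0 M : R) (b : 'rV[R]_d) :
  0 < h -> 0 <= Kc -> measurable (Omega `&` eball x r1 : set (BorelR R D)) ->
  (forall A : set 'rV[R]_d, measurable (A : set (BorelR R d)) -> (forall u, A u -> enorm u <= h) ->
     (leb d A <= mu (chart_set Omega L x r1 A) <= (1 + Kc * h ^+ 2)%:E * leb d A)%E) ->
  (forall u : 'rV[R]_d, `|K (enorm u / h) * (p0 + edot b u)| <= M) ->
  `|\int[mu]_(y in chart_set Omega L x r1 (@cball R d h))
      (K (enorm (chart_proj L x y) / h) * (p0 + edot b (chart_proj L x y))) - p0 * h ^+ d| <=
  2 * (Kc * h ^+ 2) * M * (unit_ball_vol d * h ^+ d).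
Proof.
move=> h0 Kc0 mO sand GM.
pose B := @cball R d h; have mB : measurable B by exact: measurable_cball.
have mpr := measurable_chart_proj L x.
pose E := chart_set Omega L x r1 B.
have mE : measurable (E : set (BorelR R D)) by exact: measurable_chart_set.
pose nu : {measure set (BorelR R d) -> \bar R} := pushm (mrestr mu mE) mpr.
have nuE A : measurable A -> A `<=` B -> nu A = mu (chart_set Omega L x r1 A).
  move=> mA AB; rewrite /nu /= /pushm /pushforward /mrestr /=; congr (mu _).
  by apply/seteqP; split=> y /= => [[Ay [? _]]|[? Ay]]; split => //; split => //; exact: AB.
pose G (u : BorelR R d) : R := K (enorm (u : 'rV[R]_d) / h) * (p0 + edot b u).
have bG : bounded_mfun G by exact: (bounded_mfun_kernel_affine hKsupp bounded_mfun_chart_kernel _ _ h0).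
have lebB : leb d B = (unit_ball_vol d * h ^+ d)%:E by exact: leb_cball.
have sB A : measurable A -> A `<=` B -> (leb d A <= nu A <= (1 + Kc * h ^+ 2)%:E * leb d A)%E.
  by move=> mA AB; rewrite nuE//; apply: sand => // u /AB.
have /andP[lB uB] := sB B mB (@subset_refl _ _).
have nuB : (nu B < +oo)%E by rewrite (le_lt_trans uB)// lebB -EFinM ltry.
have muE : (mu E < +oo)%E by rewrite -nuE.
have Eoo : (mrestr mu mE setT < +oo)%E by rewrite /mrestr setTI.
have bGp : bounded_mfun (fun y : BorelR R D => G (chart_proj L x y)).
  by have [mG _] := bG; split; [exact: (measurableT_comp mG mpr)|exists M => y; exact: GM].
have -> : \int[mu]_(y in E) (K (enorm (chart_proj L x y) / h) * (p0 + edot b (chart_proj L x y))) =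
    \int[nu]_(u in B) G u.
  transitivity (\int[nu]_u G u); last first.
    rewrite [RHS]/Rintegral integral_mkcond; congr fine; apply: eq_integral => u _.
    rewrite patchE; case: ifPn => //; rewrite notin_setE /B /cball /= => /negP; rewrite -ltNge => uh.
    by rewrite /G hKsupp ?mul0r// ltr_pdivlMr ?mul1r.
  transitivity (\int[mrestr mu mE]_y G (chart_proj L x y)); last first.
    rewrite /Rintegral; congr fine; rewrite /nu /= /pushm (integral_pushforward mpr)//.
    - by apply/measurable_EFinP; case: bG.
    - by rewrite preimage_setT; exact: (bounded_mfun_integrable _ _ bGp).
  (* The restriction of [mu] to [E] has density the indicator of [E], so the density formula
     applies. *)
  have Eind A : measurable A -> (mrestr mu mE A = \int[mu]_(y in A) (\1_E y)%:E)%E.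
    by move=> mA; rewrite integral_indic// setIC.
  rewrite (Rintegral_density Eoo _ _ Eind bGp)//.
  rewrite /Rintegral integral_mkcond; congr fine; apply: eq_integral => y _.
  by rewrite patchE indicE; case: ifPn => _; rewrite ?mulr1 ?mulr0.
have fB : fine (leb d B) = unit_ball_vol d * h ^+ d by rewrite lebB.
rewrite -(kernel_moment hKsupp bounded_mfun_chart_kernel hKint p0 b h0) -fB.
apply: (@le_bounded_integral_measure _ _ R nu (leb d) B (Kc * h ^+ 2) M G) => //.
- by rewrite mulr_ge0// sqr_ge0.
- by have := ltry (unit_ball_vol d * h ^+ d); rewrite -lebB.
- by move=> A mA AB; have /andP[] := sB A mA AB.
- by case: bG.
Qed.

(** With u the projection of y - x, replacing p(y) by p(x) + <b, u> and |y - x| by |u| inside the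
    kernel costs O(h^2) pointwise, on a set of measure O(h^d); passing to Lebesgue measure costs a
    further factor 1 + O(h^2). *)
Lemma local_moments (x : 'rV[R]_D) (h0 : R) (U : set 'rV[R]_D) (g : 'rV[R]_D -> R) :
  Omega x -> 0 < h0 -> embedded_submanifold d (eball x h0 `&` Omega) ->
  open U -> U x -> Ck 2 g U -> (forall y, U y -> Omega y -> p y = g y) ->
  exists eta C, [/\ 0 < eta, 0 <= C & forall h, 0 < h -> h < eta ->
    `|\int[P]_y K (enorm ((y : 'rV[R]_D) - x) / h) - p x * h ^+ d| <= C * h ^+ d.+2 /\
    \int[P]_y (K (enorm ((y : 'rV[R]_D) - x) / h) ^+ 2) <= C * h ^+ d].
Proof.
move=> Ox h00 emb oU Ux gC2 pg.
have [L [r1 [r0 [Kc [[r10 r00 Kc0 LL] mO ydist sand]]]]] := chart_measure hdD hmu h00 Ox emb.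
have [rt [Ct [A [rt0 Ct0 taylor]]]] := Ck2_taylor_real oU Ux gC2.
have [rho rho0 xU] := open_eball oU Ux.
have [LK [KB [LK0 KB0 lip bD bd]]] := kernel_constants.
have K1 : 0 < 1 + Kc by rewrite ltr_wpDr.
(* Points projecting into the ball of radius [h] lie within (1 + Kc) h of [x], hence the divided
   radii for Taylor and for [U]. *)
have [|eta eta0 /=] := @min_lt_half R [:: r1; r0; 1; rt / (1 + Kc); rho / (1 + Kc)].
  by rewrite /= r10 r00 ltr01 !divr_gt0.
move=> /and5P[eta1 etar0 eta_1 etart /andP[etarho _]].
(* Tangential part of the gradient [A] of the extension [g]. *)
pose b : 'rV[R]_d := A *m L^T.
(* Error on the density: the Taylor remainder at distance (1 + Kc) h, and the gradient along the
   normal component of y - x. *)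
pose C1 := Ct * (1 + Kc) ^+ 2 + enorm A * Kc.
pose M1 := `|p x| + enorm b.
(* Error on the product: density error times the kernel bound, plus kernel error times the bound
   [M1] of the affine density. *)
pose C2 := KB * C1 + LK * Kc * M1.
pose V : R := unit_ball_vol d.
have V0 : 0 < V by exact: unit_ball_vol_gt0.
have C10 : 0 <= C1 by rewrite addr_ge0// mulr_ge0 ?sqr_ge0 ?enorm_ge0.
have M10 : 0 <= M1 by rewrite addr_ge0 ?enorm_ge0.
have C20 : 0 <= C2 by rewrite addr_ge0// !mulr_ge0.
(* The first summand bounds the bias, by replacement error and measure distortion; the second bounds
   the second moment. *)
exists eta, ((C2 * (1 + Kc) + 2 * Kc * (KB * M1)) * V + KB ^+ 2 * (M1 + C1) * ((1 + Kc) * V)).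
have T1 : 0 <= (C2 * (1 + Kc) + 2 * Kc * (KB * M1)) * V.
  by apply: mulr_ge0; [apply: addr_ge0; rewrite !mulr_ge0// ltW|exact: ltW].
have T2 : 0 <= KB ^+ 2 * (M1 + C1) * ((1 + Kc) * V).
  apply: mulr_ge0; first by apply: mulr_ge0; [exact: sqr_ge0|exact: addr_ge0].
  by apply: mulr_ge0; exact: ltW.
split => //; first exact: addr_ge0.
move=> h hgt0 heta.
have hr1 : h < r1 by exact: lt_trans eta1.
have hr0 : h < r0 by exact: lt_trans etar0.
have h1 : h <= 1 by rewrite ltW// (lt_trans heta).
have hge0 := ltW hgt0.
have h2 : 0 <= h ^+ 2 by exact: sqr_ge0.
pose E := chart_set Omega L x r1 (@cball R d h).
have mB := @measurable_cball R d h.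
have mE : measurable (E : set (BorelR R D)) by exact: measurable_chart_set.
have sandh (B : set 'rV[R]_d) : measurable (B : set (BorelR R d)) -> (forall u, B u -> enorm u <= h) ->
    (leb d B <= mu (chart_set Omega L x r1 B) <= (1 + Kc * h ^+ 2)%:E * leb d B)%E.
  by move=> mB' Bh; exact: sand.
have /andP[_ muEle] := sandh (@cball R d h) mB (fun u uh => uh).
rewrite leb_cball// -EFinM in muEle.
have muEoo : (mu E < +oo)%E by rewrite (le_lt_trans muEle)// ltry.
have muEh : fine (mu E) <= (1 + Kc) * (V * h ^+ d).
  rewrite -lee_fin fineK ?ge0_fin_numE// (le_trans muEle)// lee_fin ler_wpM2r ?mulr_ge0 ?exprn_ge0 ?(ltW V0)//.
  by rewrite lerD2l ler_piMr// expr_le1.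
have affM (u : 'rV[R]_d) : enorm u <= h -> `|p x + edot b u| <= M1.
  move=> uh; rewrite (le_trans (ler_normD _ _))// lerD2l (le_trans (norm_edot_le _ _))//.
  by rewrite ler_piMr ?enorm_ge0// (le_trans uh).
have GM (u : 'rV[R]_d) : `|K (enorm u / h) * (p x + edot b u)| <= KB * M1.
  have [uh|uh] := leP (enorm u) h; first by rewrite normrM ler_pM// ?bd// affM.
  by rewrite hKsupp ?mul0r ?normr0 ?mulr_ge0// ltr_pdivlMr ?mul1r.
have pE y : E y -> `|p y - (p x + edot b (chart_proj L x y))| <= C1 * h ^+ 2 /\
    `|K (enorm (y - x) / h) - K (enorm (chart_proj L x y) / h)| <= LK * (Kc * h ^+ 2).
  move=> [[Oy yr] uh]; have [nle ale] := ydist y Oy yr; have tle := enorm_proj LL (y - x).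
  rewrite -/(chart_proj L x y) in tle; rewrite /cball /= in uh.
  set u := chart_proj L x y in nle ale tle uh *.
  have u0 := enorm_ge0 u.
  have u2 : enorm u ^+ 2 <= h ^+ 2 by rewrite lerXn2r ?nnegrE.
  have u3 : enorm u ^+ 3 <= h ^+ 3 by rewrite lerXn2r ?nnegrE.
  have h3 : h ^+ 3 <= h by rewrite exprS ler_piMr// expr_le1.
  have ah : enorm (y - x) <= (1 + Kc) * h.
    have : Kc * enorm u ^+ 3 <= Kc * h by rewrite ler_wpM2l// (le_trans u3).
    by rewrite mulrDl mul1r; lra.
  have aeta r : eta < r / (1 + Kc) -> enorm (y - x) < r.
    by rewrite ltr_pdivlMr// => hr; rewrite (le_lt_trans ah)// (le_lt_trans _ hr)// mulrC ler_wpM2r ?ltW.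
  split; last first.
    (* The cubic bound on the difference of norms, divided by [h], leaves order h^2. *)
    apply: (le_trans (lip (y - x) u h hgt0)); rewrite ler_wpM2l// ger0_norm ?subr_ge0//.
    rewrite ler_pdivrMr// -mulrA -exprSr (le_trans ale)// ler_wpM2l//.
  rewrite (pg y)//; last by apply: xU; exact: aeta.
  rewrite (pg x)//.
  (* By adjunction <b, u> = <A, u L>: what separates it from <A, y - x> is the normal component. *)
  have -> : g y - (g x + edot b u) = (g y - g x - edot A (y - x)) + edot A (y - x - u *m L).
    by rewrite [edot A (y - x - _)]edotDr -(scaleN1r (u *m L)) edotZr [edot A (u *m L)]edotC mulmx_edot edotC -/b; ring.
  rewrite (le_trans (ler_normD _ _))// /C1 mulrDl lerD//.
    rewrite (le_trans (taylor y (aeta _ etart)))// -mulrA ler_wpM2l// -exprMn.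
    by rewrite lerXn2r ?nnegrE ?enorm_ge0// mulr_ge0// ltW.
  rewrite (le_trans (norm_edot_le _ _))// -mulrA ler_wpM2l ?enorm_ge0// (le_trans nle)// ler_wpM2l//.
pose k (y : BorelR R D) : R := K (enorm ((y : 'rV[R]_D) - x) / h).
have bk : bounded_mfun k by exact: bounded_mfun_sample_kernel.
have bk2 : bounded_mfun (fun y => k y ^+ 2) by exact: (bounded_mfunM bk bk).
have Poo : (P setT < +oo)%E by rewrite probability_setT ltry.
have ik : mu.-integrable E (EFin \o (fun y => k y * p y)).
  apply: (integrableS measurableT mE) => //; exact: (density_integrable Poo hp0 hpmeas hdens bk).
have ik2 : mu.-integrable E (EFin \o (fun y => k y ^+ 2 * p y)).
  apply: (integrableS measurableT mE) => //; exact: (density_integrable Poo hp0 hpmeas hdens bk2).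
have bG : bounded_mfun (fun y : BorelR R D =>
    K (enorm (chart_proj L x y) / h) * (p x + edot b (chart_proj L x y))).
  have [mG _] := bounded_mfun_kernel_affine hKsupp bounded_mfun_chart_kernel (p x) b hgt0.
  by split; [exact: (measurableT_comp mG (measurable_chart_proj L x))|exists (KB * M1) => y; exact: GM].
split.
  have := @chart_integral_approx x L r1 Kc h (p x) (KB * M1) b hgt0 Kc0 mO sandh GM.
  have -> := @Rintegral_kernel_support x L r1 h id LL hgt0 hr1 mO erefl bk.
  have := @Rintegral_approx _ _ mu E (fun y => k y * p y) _ (C2 * h ^+ 2) mE muEoo ik (bounded_mfun_integrable mE muEoo bG).
  rewrite -/E /k /=.
  set I := Rintegral _ _ _; set J := Rintegral _ _ _ => hIJ hJ.
  have {hIJ} hIJ : `|I - J| <= C2 * h ^+ 2 * fine (mu E).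
    apply: hIJ => y Ey; have [pa ka] := pE y Ey; have [_ uh] := Ey.
    rewrite /= (_ : _ - _ = K (enorm (y - x) / h) * (p y - (p x + edot b (chart_proj L x y))) +
      (K (enorm (y - x) / h) - K (enorm (chart_proj L x y) / h)) * (p x + edot b (chart_proj L x y))); last by ring.
    rewrite (le_trans (ler_normD _ _))// !normrM /C2 mulrDl lerD//.
      by rewrite -mulrA ler_pM// bD.
    rewrite (_ : LK * Kc * M1 * h ^+ 2 = LK * (Kc * h ^+ 2) * M1); last by ring.
    by rewrite ler_pM// affM.
  rewrite -[I](subrK J) -addrA (le_trans (ler_normD _ _))//.
  apply: (@le_trans _ _ ((C2 * (1 + Kc) + 2 * Kc * (KB * M1)) * V * h ^+ d.+2)); last first.
    by rewrite ler_wpM2r ?exprn_ge0// lerDl.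
  rewrite (_ : _ * _ * h ^+ d.+2 = C2 * h ^+ 2 * ((1 + Kc) * (V * h ^+ d)) + 2 * (Kc * h ^+ 2) * (KB * M1) * (V * h ^+ d)).
    by rewrite lerD// (le_trans hIJ)// ler_wpM2l// mulr_ge0.
  rewrite (_ : h ^+ d.+2 = h ^+ d * h ^+ 2); first by ring.
  by rewrite -exprD addn2.
have /= -> := @Rintegral_kernel_support x L r1 h (fun t => t ^+ 2) LL hgt0 hr1 mO (expr0n _ 2) bk2.
have i0 : mu.-integrable E (EFin \o (fun=> 0)).
  exact: (bounded_mfun_integrable mE muEoo (bounded_mfun_cst _ 0)).
have := @Rintegral_approx _ _ mu E (fun y => k y ^+ 2 * p y) (fun=> 0) (KB ^+ 2 * (M1 + C1)) mE muEoo ik2 i0.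
rewrite Rintegral_cst// mul0r subr0 => h3.
apply: (@le_trans _ _ (KB ^+ 2 * (M1 + C1) * fine (mu E))).
  apply: (le_trans (ler_norm _)); apply: h3 => y Ey; have [pa _] := pE y Ey; have [_ uh] := Ey.
  rewrite subr0 normrM ler_pM// ?normrX; first by rewrite lerXn2r ?nnegrE ?bD.
  rewrite -[p y](subrK (p x + edot b (chart_proj L x y))) addrC (le_trans (ler_normD _ _))// lerD ?affM//.
  by rewrite (le_trans pa)// ler_piMr// expr_le1.
apply: (@le_trans _ _ (KB ^+ 2 * (M1 + C1) * ((1 + Kc) * V) * h ^+ d)); last first.
  by rewrite ler_wpM2r ?exprn_ge0// lerDr.
rewrite -(mulrA _ _ (h ^+ d)) -(mulrA (1 + Kc)) ler_wpM2l//.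
by apply: mulr_ge0; [exact: sqr_ge0|exact: addr_ge0].
Qed.

End local_moments.

(** * Balance of bias and variance at the prescribed bandwidth *)

Unset Implicit Arguments. Set Strict Implicit. Set Printing Implicit Defensive.

Theorem theorem1p2 (R : realType) (D d : nat) (hdD : (d <= D)%N)
  (Omega : set 'rV[R]_D)
  (* H^d on R^D, as a measure on the Borel sets *)
  (mu : {measure set (BorelR R D) -> \bar R})
  (hmu : forall A : set (BorelR R D), measurable A -> mu A = hausdorff d A)
  (* Lebesgue measure on R^d *)
  (lam : {measure set (BorelR R d) -> \bar R})
  (hlam : forall a b : 'rV[R]_d, (forall i, a 0 i <= b 0 i) ->
     lam [set u | forall i, a 0 i <= u 0 i <= b 0 i] =
     (\prod_(i < d) (b 0 i - a 0 i))%:E)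
  (* the law P and its density p w.r.t. H^d *)
  (P : probability (BorelR R D) R) (p : 'rV[R]_D -> R)
  (hp0 : forall y, 0 <= p y)
  (hpOmega : forall y, ~ Omega y -> p y = 0)
  (hpmeas : measurable_fun setT (p : BorelR R D -> R))
  (hdens : forall A : set (BorelR R D), measurable A ->
     P A = (\int[mu]_(y in A) (p y)%:E)%E)
  (* regularity of Omega and p at H^d-a.e. point of Omega *)
  (hreg : exists N0 : set 'rV[R]_D, hausdorff d N0 = 0%E /\
     forall x, Omega x -> ~ N0 x ->
       (exists h0 : R, 0 < h0 /\ embedded_submanifold d (eball x h0 `&` Omega)) /\
       (exists (U : set 'rV[R]_D) (g : 'rV[R]_D -> R),
          [/\ open U, U x, Ck 2 g U & forall y, U y -> Omega y -> p y = g y]))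
  (* the kernel *)
  (K : R -> R)
  (hKsupp : forall t, 1 < t -> K t = 0)
  (hKint : (\int[lam]_u (K (enorm u))%:E)%E = 1%E)
  (hKC2 : Ck 2 (fun u : 'rV[R]_D => K (enorm u)) setT)
  (* i.i.d. sample X_1, X_2, ... (X_(i+1) = X i) with law P *)
  (dT : measure_display) (T : measurableType dT) (Pr : probability T R)
  (X : nat -> T -> 'rV[R]_D)
  (hXmeas : forall i, measurable_fun setT (X i : T -> BorelR R D))
  (hXlaw : forall i (A : set (BorelR R D)), measurable A ->
     Pr (X i @^-1` A) = P A)
  (hXind : mutually_independent Pr X)
  (* bandwidth h_n = c n^(-1/(d+4)) *)
  (c : R) (hc : 0 < c) :
  let h := fun n : nat => c * n%:R `^ (- (1 / (d%:R + 4))) in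
  exists N : set 'rV[R]_D, hausdorff d N = 0%E /\
    forall x, Omega x -> ~ N x ->
      exists (C : R) (n0 : nat), forall n : nat, (n0 <= n)%N ->
        (\int[Pr]_w ((kde d K h X n x w - p x) ^+ 2)%:E <=
           (C * n%:R `^ (- (4 / (d%:R + 4))))%:E)%E.
Proof.
move=> h; have [N0 [N00 reg]] := hreg; exists N0; split => // x Ox nNx.
have [[h0 [h00 emb]] [U [g [oU Ux gC2 pg]]]] := reg x Ox nNx.
have lamE : forall A, measurable A -> lam A = leb d A by exact: leb_unique.
have hKint' : (\int[leb d]_u (K (enorm (u : 'rV[R]_d)))%:E)%E = 1%E.
  by rewrite -hKint; apply: eq_measure_integral => A mA _; rewrite lamE.
have [eta [C [eta0 C0 mom]]] := local_moments hdD hmu hp0 hpOmega hpmeas hdens hKsupp hKint' hKC2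
  Ox h00 emb oU Ux gC2 pg.
(* The condition h_n < eta amounts to n > (c / eta)^(d+4); starting from [k.+1] also makes [n]
   positive. *)
have [k ck] : exists k : nat, (c / eta) ^+ (d + 4) < k%:R.
  exists (Num.bound ((c / eta) ^+ (d + 4))); by apply: archi_boundP; rewrite exprn_ge0// divr_ge0// ltW.
(* The two summands come from the variance and from the squared bias. *)
exists (2 * C / c ^+ d + 2 * C ^+ 2 * c ^+ 4), k.+1 => n kn.
have n0 : 0 < n%:R :> R by rewrite ltr0n (leq_trans _ kn).
pose q : R := n%:R `^ (- (1 / (d%:R + 4))).
have q0 : 0 < q by rewrite powR_gt0.
have d40 : d%:R + 4 != 0 :> R by rewrite gt_eqF// ltr_wpDl.
have qX m : q ^+ m = n%:R `^ (- (m%:R / (d%:R + 4))).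
  by rewrite -powR_mulrn ?(ltW q0)// /q -powRrM mulNr mulrAC mul1r.
have qn : q ^+ (d + 4) * n%:R = 1.
  by rewrite qX natrD divff// powR_inv1 ?(ltW n0)// mulVf// gt_eqF.
have hE : h n = c * q by [].
have hn0 : 0 < h n by rewrite hE mulr_gt0.
have m0 : (0 < d + 4)%N by rewrite addn_gt0 orbT.
have hn : h n < eta.
  rewrite -(@ltr_pXn2r _ (d + 4)) ?nnegrE ?(ltW hn0) ?(ltW eta0)//.
  rewrite hE exprMn -(ltr_pM2r n0) -mulrA qn mulr1 mulrC -ltr_pdivrMr ?exprn_gt0//.
  by rewrite -expr_div_n (lt_trans ck)// ltr_nat.
have [bias var] := mom _ hn0 hn.
rewrite -(qX 4%N).
have bk := bounded_mfun_sample_kernel hKsupp hKC2 x hn0.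
rewrite /kde (le_trans (mse_bound hXmeas hXlaw hXind _ (p x) n bk))// lee_fin.
move: bias var; set I := Rintegral _ _ _; set J := Rintegral _ _ _ => bias var.
have hd0 : 0 < h n ^+ d by rewrite exprn_gt0.
have cd0 : 0 < c ^+ d by rewrite exprn_gt0.
have -> : 2 * (n%:R * h n ^+ d)^-1 ^+ 2 * n%:R * J = 2 * (n%:R * h n ^+ d)^-1 * (J / h n ^+ d).
  by field; rewrite !gt_eqF.
have -> : (n%:R * h n ^+ d)^-1 * n%:R * I - p x = (I - p x * h n ^+ d) / h n ^+ d.
  by field; rewrite !gt_eqF.
rewrite [leRHS]mulrDl lerD//.
  (* The exponent is chosen for this: n = q^-(d+4), so 1/(n h^d) has the same order q^4 as h^4. *)
  have sE : (n%:R * h n ^+ d)^-1 = q ^+ 4 / c ^+ d.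
    have nE : n%:R = (q ^+ (d + 4))^-1 :> R.
      by rewrite -[LHS](mulKf (x := q ^+ (d + 4))) ?qn ?mulr1// gt_eqF// exprn_gt0.
    by rewrite nE hE exprMn exprD; field; rewrite ?expf_neq0 ?gt_eqF.
  rewrite sE (_ : 2 * C / c ^+ d * q ^+ 4 = 2 * (q ^+ 4 / c ^+ d) * C); last by field; rewrite gt_eqF.
  by rewrite ler_wpM2l ?ler_pdivrMr// mulr_ge0// divr_ge0 ?exprn_ge0// ltW.
rewrite -[leRHS]mulrA -[leRHS]mulrA ler_pM2l// -exprMn -hE.
have : `|(I - p x * h n ^+ d) / h n ^+ d| <= C * h n ^+ 2.
  rewrite normrM (gtr0_norm (x := (h n ^+ d)^-1)) ?invr_gt0// ler_pdivrMr// (le_trans bias)//.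
  by rewrite -mulrA -exprD add2n.
move=> le_bias; rewrite -[leLHS]real_normK ?num_real//; apply: le_trans (_ : (C * h n ^+ 2) ^+ 2 <= _).
  by rewrite lerXn2r ?nnegrE// mulr_ge0// exprn_ge0// ltW.
by rewrite exprMn -exprM hE exprMn.
Qed.
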